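(* Let $1\le p<+\infty$, let $\omega$ be a weight on $\mathbb{R}^+$, and let $\mathbf{E}=L^p_\omega(\mathbb{R}^+)$. Then: i) $\sigma(\mathbf{S}_t)=\{z\in\mathbb{C}:\ |z|\le e^{\mathfrak{a}_0t}\}$ for all $t>0$. ii) $\sigma(P^+\mathbf{S}_{-t})=\{z\in\mathbb{C}:\ |z|\le e^{\mathfrak{a}_1t}\}$ for all $t>0$. Let $T$ be a bounded operator on $\mathbf{E}$ commuting with $(\mathbf{S}_t)_{t\ge0}$ or with $(P^+\mathbf{S}_{-t})_{t\ge0}$, and let $\mu_T$ be the symbol of $T$. iii) If $T$ commutes with $\mathbf{S}_t$ for all $t\ge0$, then $\overline{\mu_T(\mathcal{O})}\subset\sigma(T)$, where $\mathcal{O}=\{z\in\mathbb{C}:\ \operatorname{Im}z<\mathfrak{a}_0\}$. iv) If $T$ commutes with $P^+\mathbf{S}_{-t}$ for all $t\ge0$, then $\overline{\mu_T(\mathcal{V})}\subset\sigma(T)$, where $\mathcal{V}=\{z\in\mathbb{C}:\ \operatorname{Im}z>-\mathfrak{a}_1\}$.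
   Context: $\mathbb{R}^+=[0,\infty)$. A weight on $\mathbb{R}^+$ is a positive continuous function $\omega$ on $\mathbb{R}^+$ with $0<\inf_{x\ge0}\frac{\omega(x+t)}{\omega(x)}\le\sup_{x\ge0}\frac{\omega(x+t)}{\omega(x)}<+\infty$ for all $t\in\mathbb{R}^+$. $L^p_\omega(\mathbb{R}^+)$ is the Banach space of (complex-valued) measurable functions $f$ on $\mathbb{R}^+$ with $\int_0^\infty|f(x)|^p\omega(x)^p\,dx<+\infty$, with the corresponding norm. Functions on $\mathbb{R}^+$ are extended by $0$ to $\mathbb{R}$ when needed, and $P^+$ is the projection restricting a function on $\mathbb{R}$ to $\mathbb{R}^+$. For $t\ge0$, $\mathbf{S}_t$ is the right translation by $t$ on $\mathbf{E}$ ($\mathbf{S}_tf(x)=f(x-t)$ for $x\ge t$ and $0$ for $0\le x<t$), and $P^+\mathbf{S}_{-t}$ is the left translation, $(P^+\mathbf{S}_{-t}f)(x)=f(x+t)$, $x\ge0$. $\sigma(\cdot)$ denotes the spectrum of a bounded operator on $\mathbf{E}$. Set $\mathfrak{a}_0=\lim_{t\to+\infty}\ln\|\mathbf{S}_t\|^{1/t}$, $\mathfrak{a}_1=\lim_{t\to+\infty}\ln\|P^+\mathbf{S}_{-t}\|^{1/t}$. Symbol: $(f)_a(x)=f(x)e^{ax}$ for $a\in\mathbb{R}$; $\hat g(x)=\int_{\mathbb{R}}g(t)e^{-ixt}\,dt$ is the Fourier transform (extended to $L^2(\mathbb{R})$) and $\mathcal{F}^{-1}$ its inverse. Operators commuting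 with all $\mathbf{S}_t$, or with all $P^+\mathbf{S}_{-t}$, are Wiener-Hopf operators (i.e. $P^+\mathbf{S}_{-a}T\mathbf{S}_a=T$ for all $a\ge0$), and every Wiener-Hopf operator $T$ has, for each $a\in[-\mathfrak{a}_1,\mathfrak{a}_0]$, a function $h_a\in L^\infty(\mathbb{R})$ with $(Tf)_a=P^+\mathcal{F}^{-1}(h_a\widehat{(f)_a})$ for all $f\in\mathbf{E}$ with $(f)_a\in L^2(\mathbb{R}^+)$; its symbol is $x+ia\mapsto h_a(x)$. If $T$ commutes with all $\mathbf{S}_t$ (resp. with all $P^+\mathbf{S}_{-t}$), the symbol $\mu_T$ on $\mathcal{O}$ (resp. $\mathcal{V}$) is the bounded holomorphic function on $\mathcal{O}$ (resp. $\mathcal{V}$) such that $$(Tf)_a=P^+\mathcal{F}^{-1}\big(\mu_T(\cdot+ia)\,\widehat{(f)_a}\big)$$ for all $f\in C_c^\infty(\mathbb{R}^+)$ (smooth functions with compact support in $\mathbb{R}^+$) and all real $a<\mathfrak{a}_0$ (resp. $a>-\mathfrak{a}_1$); it is the holomorphic extension of the symbol $h$. *)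

(* Defs.v *)
From HB Require Import structures.
From mathcomp Require Import all_boot all_order all_algebra.
From mathcomp Require Import all_classical all_reals all_analysis.
From mathcomp Require Import complex.

Set Implicit Arguments.
Unset Strict Implicit.
Unset Printing Implicit Defensive.

Import Order.TTheory GRing.Theory Num.Theory numFieldNormedType.Exports.

Local Open Scope classical_set_scope.
Local Open Scope complex_scope.
Local Open Scope ring_scope.

Section WeightedSpace.
Context {R : realType}.
Local Notation C := R[i].
Local Notation leb := (@lebesgue_measure R).
Implicit Types (p t a : R) (w : R -> R) (f g : R -> C) (D : set R).

Definition cmod (z : C) : R := Normc.normc z.

Definition cmeasurable D f : Prop :=
  measurable_fun D (fun x => complex.Re (f x)) /\
  measurable_fun D (fun x => complex.Im (f x)).

(* The norm takes values in [0, +oo], so that an infinite norm is never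
   confused with a finite one. *)
Definition wnorm D p w f : \bar R :=
  ((\int[leb]_(x in D) (cmod (f x) `^ p * w x `^ p)%:E) `^ p^-1)%E.

Definition wLp D p w : set (R -> C) :=
  [set f | cmeasurable D f /\ (wnorm D p w f < +oo)%E].

Definition Rplus : set R := `[0, +oo[%classic.

Definition weight w : Prop :=
  [/\ {within Rplus, continuous w},
      (forall x, 0 <= x -> 0 < w x) &
      forall t, 0 <= t ->
        (0 < ereal_inf [set (w (x + t) / w x)%:E | x in Rplus])%E /\
        (ereal_sup [set (w (x + t) / w x)%:E | x in Rplus] < +oo)%E].

(* L^p_w(R^+).  Its vectors are handled through representatives R -> C, of
   which only the values on R^+ matter, up to equality almost everywhere. *)
Definition E p w : set (R -> C) := wLp Rplus p w.
Definition Enorm p w f : \bar R := wnorm Rplus p w f.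
Definition Eeq f g : Prop := f = g %[ae leb in Rplus].

(* An operator on E is given on representatives.  Linearity up to Eeq and
   boundedness force it to be compatible with Eeq, because Enorm p w (f - g) = 0
   as soon as Eeq f g; conversely every bounded operator on the quotient lifts. *)
Definition operator := (R -> C) -> (R -> C).
Implicit Types (T U : operator).

Definition bounded_operator p w T : Prop :=
  [/\ (forall f, E p w f -> E p w (T f)),
      (forall (c : C) f g, E p w f -> E p w g ->
         Eeq (T (fun x => c * f x + g x)) (fun x => c * T f x + T g x)) &
      exists M : R, forall f, E p w f ->
        (Enorm p w (T f) <= M%:E * Enorm p w f)%E].

Definition opnorm p w T : R :=
  fine (ereal_sup [set Enorm p w (T f) | f in
                     [set f | E p w f /\ (Enorm p w f <= 1)%E]]).

Definition spectrum p w T : set C :=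
  [set z | ~ exists U,
     [/\ bounded_operator p w U,
         (forall f, E p w f -> Eeq (U (fun x => T f x - z * f x)) f) &
         forall f, E p w f -> Eeq (fun x => T (U f) x - z * U f x) f]].

(* For t >= 0 only. *)
Definition right_shift t : operator :=
  fun f x => if t <= x then f (x - t) else 0.
Definition left_shift t : operator :=
  fun f x => if 0 <= x then f (x + t) else 0.

Definition commutes_with p w (V : R -> operator) T : Prop :=
  forall t, 0 <= t -> forall f, E p w f -> Eeq (T (V t f)) (V t (T f)).

Definition growth p w (V : R -> operator) : R :=
  lim (ln (opnorm p w (V t) `^ t^-1) @[t --> +oo%R]).

Definition alpha0 p w : R := growth p w right_shift.
Definition alpha1 p w : R := growth p w left_shift.

End WeightedSpace.

Section Fourier.
Context {R : realType}.
Local Notation C := R[i].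
Local Notation leb := (@lebesgue_measure R).
Implicit Types (a : R) (f g G : R -> C).

Definition cintegral f : C :=
  (\int[leb]_x complex.Re (f x)) +i* (\int[leb]_x complex.Im (f x)).

Definition expi (s : R) : C := cos s +i* sin s.

Definition fourier g : R -> C :=
  fun x => cintegral (fun t => g t * expi (- (x * t))).

Definition L1 : set (R -> C) := wLp setT 1 (cst 1).
Definition L2 : set (R -> C) := wLp setT 2 (cst 1).
Definition L2dist f g : \bar R := wnorm setT 2 (cst 1) (fun x => f x - g x).

(* G is the Fourier-Plancherel transform of g, i.e. (g, G) lies in the graph of
   the continuous extension to L^2(R) of [fourier] on L^1 and L^2.  Hence
   [fourierL2 g G] also reads: g is the inverse transform of G. *)
Definition fourierL2 g G : Prop :=
  [/\ L2 g, L2 G & exists u : nat -> R -> C,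
     [/\ (forall n, L1 (u n) /\ L2 (u n)),
         L2dist (u n) g @[n --> \oo] --> 0%E &
         L2dist (fourier (u n)) G @[n --> \oo] --> 0%E]].

Definition exp_twist a f : R -> C := fun x => f x * (expR (a * x))%:C.

(* Smooth functions on R whose support is a compact subset of R^+ = [0, +oo[. *)
Definition test_function f : Prop :=
  [/\ (forall n x, derivable (derive1n n (fun y => complex.Re (f y))) x 1),
      (forall n x, derivable (derive1n n (fun y => complex.Im (f y))) x 1),
      compact (closure [set x | f x != 0]) &
      closure [set x | f x != 0] `<=` Rplus].

(* R[i]^o carries the usual topology of the complex plane, and derivability
   over the field R[i] in the direction 1 is complex differentiability. *)
Definition holomorphic_on (D : set C) (mu : C -> C) : Prop :=
  forall z, D z -> derivable (mu : C^o -> C^o) z 1.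

(* mu is the symbol of T on D, for D an open half-plane bounded by a horizontal
   line: the real numbers a that occur are those for which the line Im z = a
   lies in D. *)
Definition is_symbol (T : operator) (D : set C) (mu : C -> C) : Prop :=
  [/\ holomorphic_on D mu,
      (exists M : R, forall z, D z -> cmod (mu z) <= M) &
      forall f, test_function f -> forall a, (forall x, D (x +i* a)) ->
        exists2 g, fourierL2 g (fun x => mu (x +i* a) *
                                         fourier (exp_twist a f) x) &
                   Eeq (exp_twist a (T f)) g].

End Fourier.

Section HalfPlanes.
Context {R : realType}.

Definition calO (p : R) (w : R -> R) : set R[i] :=
  [set z | complex.Im z < alpha0 p w].
Definition calV (p : R) (w : R -> R) : set R[i] :=
  [set z | - alpha1 p w < complex.Im z].

End HalfPlanes.

(* Main.v *)
From HB Require Import structures.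
Require Import Defs.
From mathcomp Require Import all_boot all_order all_algebra.
From mathcomp Require Import all_classical all_reals all_analysis.
From mathcomp Require Import measurable_realfun.
From mathcomp Require Import complex ring lra.
Import Order.TTheory GRing.Theory Num.Theory numFieldNormedType.Exports.
Local Open Scope classical_set_scope.
Local Open Scope complex_scope.
Local Open Scope ring_scope.
Set Implicit Arguments.
Unset Strict Implicit.
Unset Printing Implicit Defensive.
(** The proof studies the functionals ell h = integral of h(x) e^(-izx) dx over
    the half-line, with z = x0 + i a.

    Let T commute with the right shifts.  It is causal: on [0, N), T f depends
    only on f on [0, N).  So T extends to all locally p-integrable functions on
    the half-line.  An operator T that commutes with the left shifts takes the
    same form once time is reversed: f |-> T (f (N - .)) (N - .) commutes with
    the right shifts and, on a fixed window, is the same for all large N.  The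
    two halves of the theorem thus become statements about local operators that
    commute with the right shifts ([local_operator], [right_model],
    [left_model]).

    If a < a' < alpha0, there are stretches [s, s + n] of any length n on which
    w (s + x) >= e^(a' x) w s, because otherwise the growth exponent would be at
    most a' ([right_stretch], [left_stretch]).  Translating functions into such
    a stretch bounds the extension of T, by a constant that does not depend on
    n, with respect to the density (w (s + x) / w s)^p on [0, n), which is at
    least e^(p a' x).  Since a < a', ell (T h) is then defined for every h of
    compact support, although ell need not be continuous on the space.

    By translation invariance g s = ell (T 1_[0,s)) satisfies
    g (s + t) = g s + e^(-izs) g t, which for z <> 0 determines g up to a factor.
    Hence ell (T h) = m (ell h), first for indicator functions of intervals
    ([char_exists]), then by density ([char_compact]) and truncation
    ([char_bounded]): ell is an eigenvector of the transpose of T.  This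
    constrains the resolvent.  If U is an inverse of T - l of norm at most M,
    then (m - l)^k ell (U^k h) = ell h for all k, while |ell (U^k h)| is
    O(M^k); so |m - l| >= 1 / M ([resolvent_char]).

    For the shift by t, m = e^(-izt), and these values are dense in the disc of
    the statement, which therefore lies in the spectrum.  Outside of the disc the
    Neumann series inverts ([neumann_inverse]).

    Finally m is the value of the symbol mu at z.  The defining relation of mu
    describes T f on the half-line only.  It is applied to the translates
    f (. - X) of a test function and paired with the Fejer kernel
    (1 - cos (y s)) / s^2, whose Fourier transform vanishes outside of [- y, y];
    for X >= y the truncation is invisible in the pairing.  The kernels
    concentrate as y grows, so mu z (ell f) = ell (T f) = m (ell f)
    ([symbol_identity]), and a bump f of small support has ell f <> 0.  So, when
    l is not in the spectrum, |mu z - l| >= 1 / M for all z <> 0 of the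
    half-plane, for z = 0 as well by continuity, and l is not in the closure of
    the image ([closure_avoids]). *)

(** * Complex modulus and exponentials *)

Arguments cmod : simpl never.

Section ComplexModulus.
Context {R : realType}.
Local Notation C := R[i].
Implicit Types (z : C) (r s : R).

Lemma cmodE z : cmod z = Num.sqrt (complex.Re z ^+ 2 + complex.Im z ^+ 2).
Proof. by case: z. Qed.

Lemma cmod_ge0 z : 0 <= cmod z.
Proof. by rewrite cmodE sqrtr_ge0. Qed.

Lemma cmodM z1 z2 : cmod (z1 * z2) = cmod z1 * cmod z2.
Proof. exact: Normc.normcM. Qed.

Lemma cmodD z1 z2 : cmod (z1 + z2) <= cmod z1 + cmod z2.
Proof. exact: le_normcD. Qed.

Lemma cmodN z : cmod (- z) = cmod z.
Proof. exact: normcN. Qed.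

Lemma cmod0 : cmod (0 : C) = 0.
Proof. exact: Normc.normc0. Qed.

Lemma cmod1 : cmod (1 : C) = 1.
Proof. exact: Normc.normc1. Qed.

Lemma cmod_eq0 z : cmod z = 0 -> z = 0.
Proof. exact: Normc.eq0_normc. Qed.

Lemma cmod_gt0 z : z != 0 -> 0 < cmod z.
Proof.
move=> z0; rewrite lt_neqAle cmod_ge0 andbT eq_sym.
by apply: contra z0 => /eqP/cmod_eq0 ->.
Qed.

Lemma cmodV z : cmod z^-1 = (cmod z)^-1.
Proof. exact: Normc.normcV. Qed.

Lemma cmodX z n : cmod (z ^+ n) = cmod z ^+ n.
Proof. by elim: n => [|n ih]; rewrite ?expr0 ?cmod1 // !exprS cmodM ih. Qed.

Lemma cmodB z1 z2 : cmod (z1 - z2) <= cmod z1 + cmod z2.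
Proof. by rewrite (le_trans (cmodD _ _))// cmodN. Qed.

Lemma cmodBC z1 z2 : cmod (z1 - z2) = cmod (z2 - z1).
Proof. by rewrite -cmodN opprB. Qed.

Lemma cmodR r : cmod r%:C = `|r|.
Proof. by rewrite cmodE /= expr0n addr0 sqrtr_sqr. Qed.

Lemma Re_le_cmod z : `|complex.Re z| <= cmod z.
Proof. by rewrite cmodE -sqrtr_sqr ler_wsqrtr// lerDl sqr_ge0. Qed.

Lemma Im_le_cmod z : `|complex.Im z| <= cmod z.
Proof. by rewrite cmodE -sqrtr_sqr ler_wsqrtr// lerDr sqr_ge0. Qed.

Lemma cmod_le_ReIm z : cmod z <= `|complex.Re z| + `|complex.Im z|.
Proof.
rewrite cmodE -[leRHS]ger0_norm ?addr_ge0// -sqrtr_sqr ler_wsqrtr// sqrrD.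
by rewrite !real_normK ?num_real// addrAC lerDl mulrn_wge0// mulr_ge0.
Qed.

Lemma expiD r s : expi (r + s) = expi r * expi s.
Proof.
apply/eqP; rewrite eq_complex /= cosD sinD; apply/andP; split=> //.
by rewrite addrC [sin r * _]mulrC [X in _ + X == _]mulrC; apply/eqP; ring.
Qed.

Lemma expi0 : expi 0 = 1 :> C.
Proof. by rewrite /expi cos0 sin0. Qed.

Lemma cmod_expi r : cmod (expi r) = 1.
Proof. by rewrite cmodE /= cos2Dsin2 sqrtr1. Qed.

Lemma ReD z1 z2 : complex.Re (z1 + z2) = complex.Re z1 + complex.Re z2.
Proof. by case: z1 z2 => a b []. Qed.
Lemma ImD z1 z2 : complex.Im (z1 + z2) = complex.Im z1 + complex.Im z2.
Proof. by case: z1 z2 => a b []. Qed.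
Lemma ReM z1 z2 : complex.Re (z1 * z2) =
  complex.Re z1 * complex.Re z2 - complex.Im z1 * complex.Im z2.
Proof. by case: z1 z2 => a b []. Qed.
Lemma ImM z1 z2 : complex.Im (z1 * z2) =
  complex.Re z1 * complex.Im z2 + complex.Im z1 * complex.Re z2.
Proof. by case: z1 z2 => a b []. Qed.
Lemma ReN z : complex.Re (- z) = - complex.Re z. Proof. by case: z. Qed.
Lemma ImN z : complex.Im (- z) = - complex.Im z. Proof. by case: z. Qed.

Lemma complex_eq z1 z2 : complex.Re z1 = complex.Re z2 ->
  complex.Im z1 = complex.Im z2 -> z1 = z2.
Proof. by case: z1 z2 => a b [c d] /= -> ->. Qed.

End ComplexModulus.

(** * Translations and reflections of the line *)

Section LebesgueIsometries.
Context {R : realType}.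
Local Notation leb := (@lebesgue_measure R).
Implicit Types (s : R) (f : R -> \bar R).

Lemma measurable_shift s : measurable_fun setT (fun x : R => x + s).
Proof. by apply: measurable_funD. Qed.

Lemma measurable_refl s : measurable_fun setT (fun x : R => s - x).
Proof. by apply: measurable_funB. Qed.

Lemma lebesgue_measure_shift s (A : set R) : measurable A ->
  pushforward leb (fun x : R => x + s : measurableTypeR R) A = leb A.
Proof.
move=> mA; apply/esym/lebesgue_measure_unique => //=; first exact: measurable_shift.
move=> _ _ [[a b]] _ <-; rewrite /pushforward.
rewrite (_ : _ @^-1` _ = `]a - s, b - s]%classic); last first.
  by apply/seteqP; split => x /=; rewrite !in_itv/= ltrBlDr lerBrDr.
by rewrite !lebesgue_measure_itv/= !lte_fin ltrD2r; case: ifP => // _;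
  rewrite -!EFinB; congr EFin; ring.
Qed.

Lemma lebesgue_measure_refl s (A : set R) : measurable A ->
  pushforward leb (fun x : R => s - x : measurableTypeR R) A = leb A.
Proof.
move=> mA; apply/esym/lebesgue_measure_unique => //=; first exact: measurable_refl.
move=> _ _ [[a b]] _ <-; rewrite /pushforward.
rewrite (_ : _ @^-1` _ = `[s - b, s - a[%classic); last first.
  by apply/seteqP; split => x /=; rewrite !in_itv/= => /andP[h1 h2]; apply/andP; split; lra.
by rewrite !lebesgue_measure_itv/= !lte_fin ltrD2l ltrN2; case: ifP => // _;
  rewrite -!EFinB; congr EFin; ring.
Qed.

Section isometry.
Variable phi : R -> R.
Hypothesis mphi : measurable_fun setT phi.
Hypothesis phiP : forall A : set R, measurable A ->
  pushforward leb (phi : R -> measurableTypeR R) A = leb A.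

Lemma ge0_integral_isometry f : measurable_fun setT f -> (forall x, (0 <= f x)%E) ->
  (\int[leb]_x f (phi x) = \int[leb]_x f x)%E.
Proof.
move=> mf f0.
have <- := @ge0_integral_pushforward _ _ (measurableTypeR R) (measurableTypeR R) R
  phi mphi leb setT f measurableT mf (fun x _ => f0 x).
by apply: eq_measure_integral => //= A mA _; exact: phiP.
Qed.

Lemma integral_isometry f : measurable_fun setT f ->
  (\int[leb]_x f (phi x) = \int[leb]_x f x)%E.
Proof.
move=> mf; rewrite integralE [RHS]integralE.
congr (_ - _)%E.
- transitivity (\int[leb]_x (f^\+)%E (phi x))%E.
    by apply: eq_integral => x _; rewrite unlock.
  by apply: ge0_integral_isometry => //; exact: measurable_funepos.
- transitivity (\int[leb]_x (f^\-)%E (phi x))%E.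
    by apply: eq_integral => x _; rewrite unlock.
  by apply: ge0_integral_isometry => //; exact: measurable_funeneg.
Qed.

End isometry.

Lemma integral_shift s f : measurable_fun setT f ->
  (\int[leb]_x f (x + s)%R = \int[leb]_x f x)%E.
Proof.
by apply: integral_isometry; [exact: measurable_shift|exact: lebesgue_measure_shift].
Qed.

Lemma integral_refl s f : measurable_fun setT f ->
  (\int[leb]_x f (s - x)%R = \int[leb]_x f x)%E.
Proof.
by apply: integral_isometry; [exact: measurable_refl|exact: lebesgue_measure_refl].
Qed.

Lemma negligible_shift s (P : R -> Prop) :
  (\forall x \ae leb, P x) -> \forall x \ae leb, P (x + s).
Proof.
move=> [A [mA A0 PA]]; exists ((fun x => x + s) @^-1` A); split.
- by rewrite -[X in measurable X]setTI; exact: measurable_shift.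
- by rewrite -A0; exact: lebesgue_measure_shift.
- by move=> x /= nP; apply: PA.
Qed.

Lemma negligible_refl s (P : R -> Prop) :
  (\forall x \ae leb, P x) -> \forall x \ae leb, P (s - x).
Proof.
move=> [A [mA A0 PA]]; exists ((fun x => s - x) @^-1` A); split.
- by rewrite -[X in measurable X]setTI; exact: measurable_refl.
- by rewrite -A0; exact: lebesgue_measure_refl.
- by move=> x /= nP; apply: PA.
Qed.

End LebesgueIsometries.

(** * Integrals of complex functions *)

HB.lock Definition absint (R : realType) (f : R -> R[i]) : \bar R :=
  (\int[@lebesgue_measure R]_x (cmod (f x))%:E)%E.

Section ComplexFunctions.
Context {R : realType}.
Local Notation C := R[i].
Local Notation leb := (@lebesgue_measure R).
Implicit Types (D : set R) (f g : R -> C) (u v : R -> R).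

Lemma aeS (P Q : R -> Prop) : (forall x, P x -> Q x) ->
  (\forall x \ae leb, P x) -> \forall x \ae leb, Q x.
Proof. move=> PQ; apply: negligibleS => x /= nQ /PQ; exact: nQ. Qed.

Lemma aeI (P Q : R -> Prop) : (\forall x \ae leb, P x) -> (\forall x \ae leb, Q x) ->
  \forall x \ae leb, P x /\ Q x.
Proof.
move=> aP aQ; apply: negligibleS (negligibleU aP aQ) => x /= nPQ.
by have [Px|nPx] := pselect (P x); [right => Qx; apply: nPQ|left].
Qed.

Lemma aeT (P : R -> Prop) : (forall x, P x) -> \forall x \ae leb, P x.
Proof. move=> aP; apply: negligibleS (negligible_set0 _) => x /=; exact. Qed.

Lemma ae_forall (P : nat -> R -> Prop) : (forall n, \forall x \ae leb, P n x) ->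
  \forall x \ae leb, forall n, P n x.
Proof. exact: ae_foralln. Qed.

Lemma cmeas_real D u : measurable_fun D u -> cmeasurable D (fun x => (u x)%:C).
Proof. by move=> mu; split. Qed.

Lemma cmeas_cst D (c : C) : cmeasurable D (fun=> c).
Proof. by split. Qed.

Lemma cmeasD D f g : cmeasurable D f -> cmeasurable D g ->
  cmeasurable D (fun x => f x + g x).
Proof.
move=> [f1 f2] [g1 g2]; split; under eq_fun do rewrite ?ReD ?ImD;
  exact: measurable_funD.
Qed.

Lemma cmeasN D f : cmeasurable D f -> cmeasurable D (fun x => - f x).
Proof.
move=> [f1 f2]; split; under eq_fun do rewrite ?ReN ?ImN;
  exact: measurable_funN.
Qed.

Lemma cmeasB D f g : cmeasurable D f -> cmeasurable D g ->
  cmeasurable D (fun x => f x - g x).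
Proof. by move=> mf mg; apply: cmeasD => //; exact: cmeasN. Qed.

Lemma cmeasM D f g : cmeasurable D f -> cmeasurable D g ->
  cmeasurable D (fun x => f x * g x).
Proof.
move=> [f1 f2] [g1 g2]; split; under eq_fun do rewrite ?ReM ?ImM.
- by apply: measurable_funB; exact: measurable_funM.
- by apply: measurable_funD; exact: measurable_funM.
Qed.

Lemma cmeas_expi D u : measurable_fun D u -> cmeasurable D (fun x => expi (u x)).
Proof.
move=> mu; split => /=.
- by apply: measurableT_comp => //; apply: continuous_measurable_fun => x; exact: continuous_cos.
- by apply: measurableT_comp => //; apply: continuous_measurable_fun => x; exact: continuous_sin.
Qed.

Lemma cmeasS D D' f : measurable D -> D' `<=` D -> cmeasurable D f -> cmeasurable D' f.
Proof. by move=> mD sD [f1 f2]; split; exact: measurable_funS mD sD _. Qed.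

Lemma cmeas_comp u f : measurable_fun setT u -> cmeasurable setT f ->
  cmeasurable setT (fun x => f (u x)).
Proof.
move=> mu [f1 f2]; split.
- exact: (measurableT_comp f1 mu).
- exact: (measurableT_comp f2 mu).
Qed.

Lemma cmeas_if (b : R -> bool) f g : measurable_fun setT b ->
  cmeasurable setT f -> cmeasurable setT g ->
  cmeasurable setT (fun x => if b x then f x else g x).
Proof.
move=> mb [f1 f2] [g1 g2]; split.
- rewrite (_ : (fun x => _) = fun x => if b x then complex.Re (f x) else complex.Re (g x)).
    exact: measurable_fun_ifT.
  by apply/funext => x; case: ifP.
- rewrite (_ : (fun x => _) = fun x => if b x then complex.Im (f x) else complex.Im (g x)).
    exact: measurable_fun_ifT.
  by apply/funext => x; case: ifP.
Qed.

Lemma measurable_itvb (i : interval R) : measurable_fun setT (fun x : R => x \in i).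
Proof.
apply: (measurable_fun_bool true).
rewrite setTI (_ : _ @^-1` _ = [set` i]) //.
Qed.

Lemma measurable_geb (a : R) : measurable_fun setT (fun x : R => a <= x).
Proof. by apply: measurable_fun_ler. Qed.

Lemma measurable_ltb (a : R) : measurable_fun setT (fun x : R => x < a).
Proof. by apply: measurable_fun_ltr. Qed.

Lemma cmeas_restrict (b : R -> bool) f : measurable_fun setT b ->
  cmeasurable [set x | b x] f -> cmeasurable setT (fun x => if b x then f x else 0).
Proof.
move=> mb [f1 f2]; split.
- rewrite (_ : (fun x => _) = fun x => if b x then complex.Re (f x) else 0).
    apply: measurable_fun_if => //; rewrite setTI.
    + by apply: eq_measurable_fun f1.
  by apply/funext => x; case: ifP.
- rewrite (_ : (fun x => _) = fun x => if b x then complex.Im (f x) else 0).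
    apply: measurable_fun_if => //; rewrite setTI.
    + by apply: eq_measurable_fun f2.
  by apply/funext => x; case: ifP.
Qed.

Lemma measurable_cmod D f : cmeasurable D f -> measurable_fun D (fun x => cmod (f x)).
Proof.
move=> [f1 f2]; under eq_fun do rewrite cmodE.
apply: (measurableT_comp (f := @Num.sqrt R)).
  by apply: continuous_measurable_fun => x; exact: sqrt_continuous.
by apply: measurable_funD; exact: measurable_funX.
Qed.

Lemma measurable_cmodE D f : cmeasurable D f -> measurable_fun D (fun x => (cmod (f x))%:E).
Proof. by move=> mf; apply/measurable_EFinP; exact: measurable_cmod. Qed.

Lemma absintE f : absint f = (\int[leb]_x (cmod (f x))%:E)%E.
Proof. by rewrite absint.unlock. Qed.

Definition cintegrable f := cmeasurable setT f /\ (absint f < +oo)%E.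

Lemma absint_ge0 f : (0 <= absint f)%E.
Proof. by rewrite absintE; apply: integral_ge0 => x _; rewrite lee_fin cmod_ge0. Qed.

Lemma cintegrable_Re f : cintegrable f -> leb.-integrable setT (fun x => (complex.Re (f x))%:E).
Proof.
move=> [[f1 f2] fi]; apply/integrableP; split; first exact/measurable_EFinP.
rewrite absintE in fi; apply: le_lt_trans fi; apply: ge0_le_integral => //=.
- by apply/measurable_EFinP; apply: measurableT_comp.
- exact: measurable_cmodE.
- by move=> x _; rewrite lee_fin Re_le_cmod.
Qed.

Lemma cintegrable_Im f : cintegrable f -> leb.-integrable setT (fun x => (complex.Im (f x))%:E).
Proof.
move=> [[f1 f2] fi]; apply/integrableP; split; first exact/measurable_EFinP.
rewrite absintE in fi; apply: le_lt_trans fi; apply: ge0_le_integral => //=.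
- by apply/measurable_EFinP; apply: measurableT_comp.
- exact: measurable_cmodE.
- by move=> x _; rewrite lee_fin Im_le_cmod.
Qed.

Lemma absintZ (c : C) f : cmeasurable setT f ->
  (absint (fun x => (c * f x)%R) = (cmod c)%:E * absint f)%E.
Proof.
move=> mf; rewrite !absintE -ge0_integralZl_EFin//= ?cmod_ge0//.
- by apply: eq_integral => x _; rewrite cmodM.
- by move=> x _; rewrite lee_fin cmod_ge0.
- exact: measurable_cmodE.
Qed.

Lemma le_absint f g : cmeasurable setT f -> cmeasurable setT g ->
  (forall x, cmod (f x) <= cmod (g x)) -> (absint f <= absint g)%E.
Proof.
move=> mf mg fg; rewrite !absintE; apply: ge0_le_integral => //=.
- by move=> x _; rewrite lee_fin cmod_ge0.
- exact: measurable_cmodE.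
- exact: measurable_cmodE.
- by move=> x _; rewrite lee_fin.
Qed.

Lemma le_cintegrable f g : cmeasurable setT f ->
  (forall x, cmod (f x) <= cmod (g x)) -> cintegrable g -> cintegrable f.
Proof.
move=> mf fg [mg ig]; split => //; exact: le_lt_trans (le_absint mf mg fg) ig.
Qed.

Lemma cintegrableZ (c : C) f : cintegrable f -> cintegrable (fun x => c * f x).
Proof.
move=> [mf fi]; split; first by apply: cmeasM => //; exact: cmeas_cst.
rewrite absintZ// lte_mul_pinfty ?lee_fin ?cmod_ge0//.
Qed.

Lemma cintegrableN f : cintegrable f -> cintegrable (fun x => - f x).
Proof. by move=> /(cintegrableZ (-1)); under eq_fun do rewrite mulN1r. Qed.

Lemma cintegralD f g : cintegrable f -> cintegrable g ->
  cintegral (fun x => f x + g x) = cintegral f + cintegral g.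
Proof.
move=> fi gi; apply: complex_eq => /=.
- under [LHS]eq_Rintegral do rewrite ReD.
  by rewrite RintegralD//; exact: cintegrable_Re.
- under [LHS]eq_Rintegral do rewrite ImD.
  by rewrite RintegralD//; exact: cintegrable_Im.
Qed.

Lemma cintegralZ (c : C) f : cintegrable f ->
  cintegral (fun x => c * f x) = c * cintegral f.
Proof.
move=> fi; have fR := cintegrable_Re fi; have fI := cintegrable_Im fi.
have zl (r : R) u : leb.-integrable setT (EFin \o u) ->
    leb.-integrable setT (EFin \o (fun x => r * u x)).
  by move=> iu; have := integrableZl measurableT r iu.
apply: complex_eq => /=.
- under [LHS]eq_Rintegral do rewrite ReM.
  by rewrite RintegralB ?RintegralZl ?ReM//; exact: zl.
- under [LHS]eq_Rintegral do rewrite ImM.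
  by rewrite RintegralD ?RintegralZl ?ImM//; exact: zl.
Qed.

Lemma cintegralB f g : cintegrable f -> cintegrable g ->
  cintegral (fun x => f x - g x) = cintegral f - cintegral g.
Proof.
move=> fi gi; rewrite cintegralD//; last exact: cintegrableN.
congr (_ + _); have := cintegralZ (-1) gi; rewrite mulN1r => <-.
by congr cintegral; apply/funext => x; rewrite mulN1r.
Qed.

(** The factor 2 comes from bounding the real and the imaginary parts
    separately. It is harmless, since the bound serves in estimates where
    constants do not matter. *)
Lemma cintegral_le f (B : R) : cmeasurable setT f -> (absint f <= B%:E)%E ->
  cmod (cintegral f) <= 2 * B.
Proof.
move=> mf fB.
have fi : cintegrable f by split => //; exact: le_lt_trans fB (ltry _).
have aux u : measurable_fun setT u -> (forall x, `|u x| <= cmod (f x)) ->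
    `|\int[leb]_x u x| <= B.
  move=> mu ule.
  have iu : leb.-integrable setT (EFin \o u).
    apply/integrableP; split; first exact/measurable_EFinP.
    move: fi.2; rewrite absintE; apply: le_lt_trans; apply: ge0_le_integral => //=.
    - by apply/measurable_EFinP; apply: measurableT_comp.
    - exact: measurable_cmodE.
    - by move=> x _; rewrite lee_fin.
  apply: (le_trans (le_normr_Rintegral measurableT iu)).
  rewrite absintE in fB; rewrite -lee_fin; apply: le_trans fB; rewrite /Rintegral fineK; last first.
    move/integrableP : iu => [_ iu]; rewrite ge0_fin_numE//.
    by apply: integral_ge0 => x _; rewrite lee_fin.
  apply: ge0_le_integral => //=.
  - by apply/measurable_EFinP; apply: measurableT_comp.
  - exact: measurable_cmodE.
  - by move=> x _; rewrite lee_fin.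
rewrite (le_trans (cmod_le_ReIm _))// mulr_natl mulr2n lerD//=.
- by apply: aux; [exact: mf.1|move=> x; exact: Re_le_cmod].
- by apply: aux; [exact: mf.2|move=> x; exact: Im_le_cmod].
Qed.

Lemma eq_cintegral_ae f g : cmeasurable setT f -> cmeasurable setT g ->
  (\forall x \ae leb, f x = g x) -> cintegral f = cintegral g.
Proof.
move=> mf mg fg; rewrite /cintegral; congr (_ +i* _); congr fine.
- apply: ae_eq_integral => //.
  + by apply/measurable_EFinP; exact: mf.1.
  + by apply/measurable_EFinP; exact: mg.1.
  + by apply: aeS fg => x -> _.
- apply: ae_eq_integral => //.
  + by apply/measurable_EFinP; exact: mf.2.
  + by apply/measurable_EFinP; exact: mg.2.
  + by apply: aeS fg => x -> _.
Qed.

Lemma eq_absint_ae f g : cmeasurable setT f -> cmeasurable setT g ->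
  (\forall x \ae leb, f x = g x) -> absint f = absint g.
Proof.
move=> mf mg fg; rewrite !absintE; apply: ae_eq_integral => //.
- exact: measurable_cmodE.
- exact: measurable_cmodE.
- by apply: aeS fg => x -> _.
Qed.

Lemma cintegral_shift s f : cmeasurable setT f ->
  cintegral (fun x => f (x + s)) = cintegral f.
Proof.
move=> mf; rewrite /cintegral; congr (_ +i* _); rewrite /Rintegral; congr fine.
- by apply: (integral_shift s (f := fun x => (complex.Re (f x))%:E)); apply/measurable_EFinP; exact: mf.1.
- by apply: (integral_shift s (f := fun x => (complex.Im (f x))%:E)); apply/measurable_EFinP; exact: mf.2.
Qed.

Lemma cintegral_refl s f : cmeasurable setT f ->
  cintegral (fun x => f (s - x)) = cintegral f.
Proof.
move=> mf; rewrite /cintegral; congr (_ +i* _); rewrite /Rintegral; congr fine.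
- by apply: (integral_refl s (f := fun x => (complex.Re (f x))%:E)); apply/measurable_EFinP; exact: mf.1.
- by apply: (integral_refl s (f := fun x => (complex.Im (f x))%:E)); apply/measurable_EFinP; exact: mf.2.
Qed.

Lemma absint_refl s f : cmeasurable setT f -> absint (fun x => f (s - x)) = absint f.
Proof.
by move=> mf; rewrite !absintE; apply: (integral_refl s (f := fun x => (cmod (f x))%:E)); exact: measurable_cmodE.
Qed.

End ComplexFunctions.

(** * Convexity of powers *)

Section PowerInequalities.
Context {R : realType}.
Implicit Types (p t d a b s c : R).

Lemma powR_rescale p s c : 0 < s -> 0 <= c ->
  s * (c / s) `^ p = s `^ (1 - p) * c `^ p.
Proof.
move=> s0 c0.
rewrite powRM ?invr_ge0 ?(ltW s0)// -powR_inv1 ?(ltW s0)// -powRrM mulN1r.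
rewrite powRD ?powRr1 ?(ltW s0)// ?(gt_eqF s0) ?implybT//.
by rewrite mulrCA mulrC.
Qed.

(** Convexity at the points a / (1 - t) and b / t. The free parameter t
    replaces the inequality of Minkowski: t = 1 / 2 shows that energies stay
    finite under addition, and a fixed t < 1 sums geometric series. *)
Lemma powR_addle p t a b : 1 <= p -> 0 < t -> t < 1 -> 0 <= a -> 0 <= b ->
  (a + b) `^ p <= (1 - t) `^ (1 - p) * a `^ p + t `^ (1 - p) * b `^ p.
Proof.
move=> p1 t0 t1 a0 b0.
have t10 : 0 < 1 - t by rewrite subr_gt0.
pose T := Itv01 (ltW t0) (ltW t1).
have := @convex_powR R p p1 T (b / t) (a / (1 - t)).
rewrite !inE/= !in_itv/= !andbT !divr_ge0 ?(ltW t0) ?(ltW t10)// => /(_ isT isT).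
rewrite !convRE /= /unstable.onem !powR_rescale//.
have <- : t * (b / t) + (1 - t) * (a / (1 - t)) = a + b.
  by rewrite mulrCA divff ?(gt_eqF t0)// mulr1 mulrCA divff ?(gt_eqF t10)// mulr1 addrC.
by move=> h; rewrite [leRHS]addrC; exact: h.
Qed.

Lemma powR_add2 p a b : 1 <= p -> 0 <= a -> 0 <= b ->
  (a + b) `^ p <= 2 `^ p * (a `^ p + b `^ p).
Proof.
move=> p1 a0 b0.
have := @powR_addle p 2^-1 a b p1; rewrite invr_gt0 ltr0n invf_lt1// ltr1n.
move=> /(_ isT isT a0 b0) /le_trans; apply.
have -> : 1 - 2^-1 = 2^-1 :> R by lra.
rewrite -mulrDr ler_wpM2r ?addr_ge0 ?powR_ge0//.
rewrite -powR_inv1// -powRrM mulN1r opprB ler_powR ?ler1n// lerBlDr; lra.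
Qed.

(** Trivial when t <= d, and t = t^(1 - p) t^p <= d^(1 - p) t^p otherwise.
    With d free to choose, this replaces the inequality of Hoelder when an
    integral of |h| is compared with one of |h|^p. *)
Lemma powR_linear_le p d t : 1 <= p -> 0 < d -> 0 <= t ->
  t <= d + d `^ (1 - p) * t `^ p.
Proof.
move=> p1 d0 t0; have [td|dt] := leP t d.
  by rewrite (le_trans td)// lerDl mulr_ge0 ?powR_ge0.
rewrite -powR_rescale// ler_wpDl ?(ltW d0)//.
rewrite -[leLHS](@mulfVK _ d) ?gt_eqF// mulrC ler_pM2l//.
rewrite le1r_powR// ler_pdivlMr// mul1r ltW//.
Qed.

End PowerInequalities.

(** * Energies with respect to a density *)

Lemma EFin_mul_lty {R : realType} (k : R) (x : \bar R) :
  0 <= k -> (x < +oo)%E -> (k%:E * x < +oo)%E.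
Proof. by move=> k0 xoo; apply: lte_mul_pinfty. Qed.

(** The p-th power of a weighted norm. It is preferred to the norm because it
    is an integral, to which monotonicity, scaling and changes of variables
    apply directly. *)
HB.lock Definition pint (R : realType) (p : R) (v : R -> R) (f : R -> R[i]) : \bar R :=
  (\int[@lebesgue_measure R]_x (cmod (f x) `^ p * v x)%:E)%E.

Section Energy.
Context {R : realType}.
Local Notation C := R[i].
Local Notation leb := (@lebesgue_measure R).
Variable p : R.
Hypothesis hp : 1 <= p.
Implicit Types (f g : R -> C) (v : R -> R).

Let p0 : 0 < p. Proof. exact: lt_le_trans ltr01 hp. Qed.

Lemma pintE v f : pint p v f = (\int[leb]_x (cmod (f x) `^ p * v x)%:E)%E.
Proof. by rewrite pint.unlock. Qed.

Definition density v := measurable_fun setT v /\ forall x, 0 <= v x.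

Lemma measurable_pint v f : density v -> cmeasurable setT f ->
  measurable_fun setT (fun x => (cmod (f x) `^ p * v x)%:E).
Proof.
move=> [mv v0] mf; apply/measurable_EFinP; apply: measurable_funM => //.
apply: (measurableT_comp (f := fun x => x `^ p)); first exact: measurable_powR.
exact: measurable_cmod.
Qed.

Lemma pint_ge0 v f : density v -> (0 <= pint p v f)%E.
Proof. by move=> [_ v0]; rewrite pintE; apply: integral_ge0 => x _; rewrite lee_fin mulr_ge0 ?powR_ge0. Qed.

Lemma ae_le_pint v v' f g : density v -> density v' ->
  cmeasurable setT f -> cmeasurable setT g ->
  (\forall x \ae leb, cmod (f x) `^ p * v x <= cmod (g x) `^ p * v' x) ->
  (pint p v f <= pint p v' g)%E.
Proof.
move=> dv dv' mf mg fg; rewrite !pintE; apply: ae_ge0_le_integral => //=.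
- by move=> x _; rewrite lee_fin mulr_ge0 ?powR_ge0//; case: dv.
- exact: measurable_pint.
- by move=> x _; rewrite lee_fin mulr_ge0 ?powR_ge0//; case: dv'.
- exact: measurable_pint.
- by apply: aeS fg => x fgx _; rewrite lee_fin.
Qed.

Lemma le_pint v v' f g : density v -> density v' ->
  cmeasurable setT f -> cmeasurable setT g ->
  (forall x, cmod (f x) `^ p * v x <= cmod (g x) `^ p * v' x) ->
  (pint p v f <= pint p v' g)%E.
Proof. by move=> dv dv' mf mg fg; apply: ae_le_pint => //; exact: aeT. Qed.

Lemma le_powR_cmod f g x : cmod (f x) <= cmod (g x) -> cmod (f x) `^ p <= cmod (g x) `^ p.
Proof. by move=> fg; rewrite ge0_ler_powR// ?nnegrE ?cmod_ge0// ltW. Qed.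

Lemma eq_pint_ae v f g : density v -> cmeasurable setT f -> cmeasurable setT g ->
  (\forall x \ae leb, f x = g x) -> pint p v f = pint p v g.
Proof.
move=> dv mf mg fg; apply/eqP; rewrite eq_le; apply/andP; split.
- by apply: ae_le_pint => //; apply: aeS fg => x ->.
- by apply: ae_le_pint => //; apply: aeS fg => x ->.
Qed.

Lemma pint0 v : pint p v (fun=> 0) = 0%E.
Proof.
rewrite !pintE; under eq_integral do rewrite cmod0 powR0 ?gt_eqF// mul0r.
exact: integral0.
Qed.

Lemma pintZ v f (c : C) : density v -> cmeasurable setT f ->
  pint p v (fun x => c * f x) = ((cmod c `^ p)%:E * pint p v f)%E.
Proof.
move=> dv mf; rewrite !pintE -ge0_integralZl_EFin//= ?powR_ge0//.
- by apply: eq_integral => x _; rewrite cmodM powRM ?cmod_ge0// -EFinM mulrA.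
- by move=> x _; rewrite lee_fin mulr_ge0 ?powR_ge0//; case: dv.
- exact: measurable_pint.
Qed.

Lemma densityZ k v : 0 <= k -> density v -> density (fun x => k * v x).
Proof.
move=> k0 [mv v0]; split; first exact: measurable_funM.
by move=> x; rewrite mulr_ge0.
Qed.

Lemma pintZv k v f : 0 <= k -> density v -> cmeasurable setT f ->
  pint p (fun x => k * v x) f = (k%:E * pint p v f)%E.
Proof.
move=> k0 dv mf; rewrite !pintE -ge0_integralZl_EFin//=.
- by apply: eq_integral => x _; rewrite -EFinM mulrCA.
- by move=> x _; rewrite lee_fin mulr_ge0 ?powR_ge0//; case: dv.
- exact: measurable_pint.
Qed.

Lemma pintD2 v f g : density v ->
  cmeasurable setT f -> cmeasurable setT g ->
  (pint p v (fun x => (f x + g x)%R) <= (2 `^ p)%:E * (pint p v f + pint p v g))%E.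
Proof.
move=> dv mf mg.
have [c [c0 cE]] : exists c, 0 <= c /\ c = 2 `^ p by exists (2 `^ p); rewrite powR_ge0.
rewrite -cE; have d2 : density (fun x => c * v x) by exact: densityZ.
rewrite ge0_muleDr; [|exact: pint_ge0|exact: pint_ge0].
rewrite -(pintZv c0 dv mf) -(pintZv c0 dv mg) !pintE -ge0_integralD//=; last 4 first.
- by move=> x _; rewrite lee_fin mulr_ge0 ?powR_ge0//; case: d2.
- exact: measurable_pint.
- by move=> x _; rewrite lee_fin mulr_ge0 ?powR_ge0//; case: d2.
- exact: measurable_pint.
apply: ge0_le_integral => //=.
- by move=> x _; rewrite lee_fin mulr_ge0 ?powR_ge0//; case: dv.
- by apply: measurable_pint => //; exact: cmeasD.
- by apply: emeasurable_funD; exact: measurable_pint.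
- move=> x _; rewrite -EFinD lee_fin.
  rewrite [leRHS](_ : _ = c * (cmod (f x) `^ p + cmod (g x) `^ p) * v x); last by ring.
  rewrite ler_wpM2r//; first by case: dv.
  rewrite cE; apply: (le_trans _ (powR_add2 hp (cmod_ge0 (f x)) (cmod_ge0 (g x)))).
  by rewrite ge0_ler_powR ?nnegrE ?addr_ge0 ?cmod_ge0 ?(ltW p0)// cmodD.
Qed.

Lemma pintD_lty v f g : density v ->
  cmeasurable setT f -> cmeasurable setT g ->
  (pint p v f < +oo)%E -> (pint p v g < +oo)%E -> (pint p v (fun x => (f x + g x)%R) < +oo)%E.
Proof.
move=> dv mf mg fi gi; apply: (le_lt_trans (pintD2 dv mf mg)).
move: (powR_ge0 2 p); move: (2 `^ p) => c c0.
by apply: EFin_mul_lty; [exact: c0|apply: lte_add_pinfty; [exact: fi|exact: gi]].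
Qed.

Lemma pintZ_lty v f (c : C) : density v -> cmeasurable setT f ->
  (pint p v f < +oo)%E -> (pint p v (fun x => (c * f x)%R) < +oo)%E.
Proof.
by move=> dv mf fi; rewrite pintZ//; apply: EFin_mul_lty => //; exact: powR_ge0.
Qed.

Lemma pint0_ae v f : density v -> cmeasurable setT f -> pint p v f = 0%E ->
  \forall x \ae leb, v x != 0 -> f x = 0.
Proof.
move=> dv mf f0.
have : (\int[leb]_x `|(cmod (f x) `^ p * v x)%:E|)%E = 0%E.
  rewrite -[RHS]f0 pintE; apply: eq_integral => x _; rewrite gee0_abs// lee_fin mulr_ge0 ?powR_ge0//.
  by case: dv.
move/(ae_eq_integral_abs leb measurableT (measurable_pint dv mf)).
apply: aeS => x /(_ I) [] /eqP; rewrite mulf_eq0 powR_eq0 => /orP[/andP[/eqP/cmod_eq0//]|->//].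
Qed.

Lemma density_shift s v : density v -> density (fun x => v (x + s)).
Proof.
by move=> [mv v0]; split => //; exact: (measurableT_comp mv (measurable_shift s)).
Qed.

Lemma density_refl s v : density v -> density (fun x => v (s - x)).
Proof.
by move=> [mv v0]; split => //; exact: (measurableT_comp mv (measurable_refl s)).
Qed.

Lemma pint_shift s v f : density v -> cmeasurable setT f ->
  pint p (fun x => v (x + s)) (fun x => f (x + s)) = pint p v f.
Proof.
move=> dv mf; rewrite !pintE; apply: (integral_shift s (f := fun x => (cmod (f x) `^ p * v x)%:E)).
exact: measurable_pint.
Qed.

Lemma pint_refl s v f : density v -> cmeasurable setT f ->
  pint p (fun x => v (s - x)) (fun x => f (s - x)) = pint p v f.
Proof.
move=> dv mf; rewrite !pintE; apply: (integral_refl s (f := fun x => (cmod (f x) `^ p * v x)%:E)).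
exact: measurable_pint.
Qed.

End Energy.

(** * Vanishing of continuous functionals on an interval *)

Lemma ae_neq {R : realType} (a : R) : \forall x \ae @lebesgue_measure R, x != a.
Proof.
exists [set a]; split; [exact: measurable_set1|exact: lebesgue_measure_set1|].
by move=> x /=; case: eqP => [->//|_ /(_ isT)].
Qed.

Lemma measurable_cob {R : realType} (a b : R) : measurable_fun setT (fun x : R => a <= x < b).
Proof.
by have := measurable_itvb `[a, b[; under eq_fun do rewrite in_itv /=.
Qed.

Section FunctionalVanishing.
Import HBSimple HBNNSimple.
Context {R : realType}.
Local Notation C := R[i].
Local Notation leb := (@lebesgue_measure R).
Variable p : R.
Hypothesis hp : 1 <= p.
Implicit Types (f g : R -> C) (v : R -> R).

Let p0 : 0 < p. Proof. exact: lt_le_trans ltr01 hp. Qed.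

(** Dominated convergence: approximations that stay at distance at most |f|
    from f and converge pointwise converge in energy. *)
Lemma pint_dominated v (g_ : nat -> R -> C) f : density v -> cmeasurable setT f ->
  (forall n, cmeasurable setT (g_ n)) -> (pint p v f < +oo)%E ->
  (forall n x, cmod (f x - g_ n x) <= cmod (f x)) ->
  (forall x, cmod (f x - g_ n x) @[n --> \oo] --> 0) ->
  forall e : R, 0 < e -> exists n, (pint p v (fun x => (f x - g_ n x)%R) <= e%:E)%E.
Proof.
move=> dv mf mg fi fg gf e e0.
have mfg n : cmeasurable setT (fun x => f x - g_ n x) by exact: cmeasB.
have : pint p v (fun x => f x - g_ n x) @[n --> \oo] --> 0%E.
  have -> : 0%E = (\int[leb]_x (cst 0%E x))%E by rewrite integral0.
  under eq_fun do rewrite pintE.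
  apply: (@dominated_cvg _ _ _ leb setT measurableT
    (fun n x => (cmod (f x - g_ n x) `^ p * v x)%:E) (cst 0%E)
    (fun x => (cmod (f x) `^ p * v x)%:E)).
  - by move=> n; exact: measurable_pint.
  - move=> x _.
    apply: cvg_EFin; first exact: nearW.
    rewrite [X in _ --> X](_ : _ = 0 `^ p * v x); last by rewrite powR0 ?gt_eqF ?mul0r.
    apply: cvgM; last exact: cvg_cst.
    apply/cvgrPdist_le => /= d d0.
    have dp0 : 0 < d `^ p^-1 by rewrite powR_gt0.
    move/cvgrPdist_le : (gf x) => /(_ _ dp0); apply: filterS => n.
    rewrite sub0r normrN ger0_norm ?cmod_ge0// => hn.
    rewrite powR0 ?gt_eqF// sub0r normrN ger0_norm ?powR_ge0//.
    rewrite -[leRHS]powRr1 ?(ltW d0)// -(@mulVf _ p) ?gt_eqF//.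
    by rewrite powRrM ge0_ler_powR ?nnegrE ?powR_ge0 ?cmod_ge0// ltW.
  - by move=> x _.
  - apply/integrableP; split; first exact: measurable_pint.
    rewrite pintE in fi; apply: le_lt_trans fi; rewrite le_eqVlt; apply/orP; left; apply/eqP.
    by apply: eq_integral => x _; rewrite gee0_abs// lee_fin mulr_ge0 ?powR_ge0//; case: dv.
  - move=> n x _; have vx : 0 <= v x by case: dv.
    rewrite gee0_abs ?lee_fin ?mulr_ge0 ?powR_ge0// ler_wpM2r//.
    by rewrite ge0_ler_powR ?nnegrE ?cmod_ge0// ltW.
move/fine_cvgP => [fin /cvgrPdist_le/(_ _ e0) le].
have [n [fn ln]] : exists n, pint p v (fun x => f x - g_ n x) \is a fin_num /\
    `|0 - fine (pint p v (fun x => f x - g_ n x))| <= e.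
  near \oo => n; exists n; split; near: n; [exact: fin|exact: le].
exists n; rewrite -(fineK fn) lee_fin; apply: le_trans ln.
by rewrite sub0r normrN ler_norm.
Unshelve. all: by end_near. Qed.

Lemma density1 : density (cst 1 : R -> R).
Proof. by split => // x; rewrite ler01. Qed.
Hint Resolve density1 : core.

Variables (al be : R).
Hypothesis albe : al <= be.

Definition Lp_itv f := [/\ cmeasurable setT f,
  (forall x, ~~ (al <= x < be) -> f x = 0) & (pint p (cst 1%R) f < +oo)%E].

Definition chi (A : set R) : R -> C := fun x => (\1_(A `&` `[al, be[%classic) x : R)%:C.

Local Arguments chi : simpl never.

Lemma cmod_chi A x : cmod (chi A x) = \1_(A `&` `[al, be[%classic) x.
Proof. by rewrite cmodR ger0_norm ?indicE. Qed.

Lemma chi_in (A : set R) x : A x -> chi A x = if al <= x < be then 1 else 0.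
Proof.
move=> Ax; rewrite /chi indicE in_setI mem_set// mem_setE in_itv /=.
by case: ifP.
Qed.

Lemma chi_out (A : set R) x : ~ A x -> chi A x = 0.
Proof. by move=> Ax; rewrite /chi indicE in_setI memNset. Qed.

Lemma Lp_itv_le f g : Lp_itv g -> cmeasurable setT f ->
  (forall x, cmod (f x) <= cmod (g x)) -> Lp_itv f.
Proof.
move=> [mg g0 gi] mf fg; split => //.
- by move=> x /g0 gx; apply/cmod_eq0/eqP; rewrite eq_le cmod_ge0 andbT (le_trans (fg x))// gx cmod0.
- by apply: le_lt_trans gi; apply: le_pint => // x; rewrite !mulr1 le_powR_cmod.
Qed.

Lemma Lp_itvD c f g : Lp_itv f -> Lp_itv g -> Lp_itv (fun x => c * f x + g x).
Proof.
move=> [mf f0 fi] [mg g0 gi].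
have mcf : cmeasurable setT (fun x => c * f x) by apply: cmeasM => //; exact: cmeas_cst.
split; first exact: cmeasD.
- by move=> x xI; rewrite f0// g0// mulr0 addr0.
- by apply: (pintD_lty hp density1 mcf mg _ gi); apply: pintZ_lty.
Qed.

Lemma Lp_itv0 : Lp_itv (fun=> 0).
Proof. by split; [exact: cmeas_cst|by []|rewrite pint0]. Qed.

Lemma Lp_itvB f g : Lp_itv f -> Lp_itv g -> Lp_itv (fun x => f x - g x).
Proof.
by move=> Kf Kg; have := Lp_itvD (-1) Kg Kf; under eq_fun do rewrite mulN1r addrC.
Qed.

Lemma Lp_itv_chi A : measurable A -> Lp_itv (chi A).
Proof.
move=> mA; have mAI : measurable (A `&` `[al, be[%classic) by exact: measurableI.
split.
- by apply: cmeas_real; exact: measurable_indic.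
- by move=> x xI; rewrite /chi indicE memNset// => -[_]; rewrite /= in_itv/= (negbTE xI).
- have -> : pint p (cst 1%R) (chi A) = (\int[leb]_x (\1_(A `&` `[al, be[%classic) x)%:E)%E.
    rewrite pintE; apply: eq_integral => x _; rewrite mulr1 cmod_chi indicE.
    by case: (x \in _); rewrite ?powR1 ?powR0 ?gt_eqF.
  rewrite integral_indic// setIT; apply: (@le_lt_trans _ _ (leb (`[al, be[%classic))).
    by apply: le_measure; rewrite ?inE//; exact: subIsetr.
  by rewrite lebesgue_measure_itv; case: ifP => _; rewrite -?EFinB ltry.
Qed.

Variable D : (R -> C) -> C.
Hypothesis Dlin : forall c f g, Lp_itv f -> Lp_itv g ->
  D (fun x => c * f x + g x) = c * D f + D g.
Hypothesis Dcont : forall e : R, 0 < e -> exists2 d : R, 0 < d &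
  forall f, Lp_itv f -> (pint p (cst 1%R) f <= d%:E)%E -> cmod (D f) <= e.
Hypothesis Ditv : forall a b, al <= a -> a <= b -> b <= be ->
  D (fun x => if a <= x < b then 1 else 0) = 0.

Let D0 : D (fun=> 0) = 0.
Proof.
have := @Dlin 1 _ _ Lp_itv0 Lp_itv0.
rewrite (_ : (fun _ : R => 1 * 0 + 0) = fun=> 0) ?mul1r; last first.
  by apply/funext => x; rewrite addr0.
by move=> /(congr1 (fun z => z - D (fun=> 0))); rewrite subrr addrK.
Qed.

Let DZ c f : Lp_itv f -> D (fun x => c * f x) = c * D f.
Proof.
by move=> Kf; have := Dlin c Kf Lp_itv0; rewrite D0 addr0 => <-; congr D; apply/funext => x; rewrite addr0.
Qed.

Let DB f g : Lp_itv f -> Lp_itv g -> D (fun x => f x - g x) = D f - D g.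
Proof.
move=> Kf Kg; have := Dlin (-1) Kg Kf; rewrite mulN1r addrC => <-.
by congr D; apply/funext => x; rewrite mulN1r addrC.
Qed.

Let D_approx f : Lp_itv f ->
  (forall e : R, 0 < e -> exists g, [/\ Lp_itv g, D g = 0 &
     (pint p (cst 1%R) (fun x => (f x - g x)%R) <= e%:E)%E]) -> D f = 0.
Proof.
move=> Kf H; apply/cmod_eq0/eqP; rewrite eq_le cmod_ge0 andbT.
apply/ler_addgt0Pl => e e0; rewrite addr0.
have [d d0 dD] := Dcont e0; have [g [Kg Dg fg]] := H _ d0.
by have := dD _ (Lp_itvB Kf Kg) fg; rewrite DB// Dg subr0.
Qed.

Let D_ae f g : Lp_itv f -> Lp_itv g -> (\forall x \ae leb, f x = g x) -> D g = 0 -> D f = 0.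
Proof.
move=> Kf Kg fg Dg; apply: D_approx => // e e0; exists g; split => //.
rewrite (@eq_pint_ae _ p _ _ (fun=> 0))//; first by rewrite pint0// lee_fin ltW.
- by case: Kf => ? _ _; case: Kg => ? _ _; exact: cmeasB.
- by apply: aeS fg => x ->; rewrite subrr.
Qed.

Let H : set (set R) := [set A | measurable A /\ D (chi A) = 0].

Let H_itv a b : H `]a, b]%classic.
Proof.
split => //; pose a' := Num.max al (Num.min a be); pose b' := Num.max a' (Num.min b be).
have aa' : al <= a' by rewrite /a' le_max lexx.
have a'b' : a' <= b' by rewrite /b' le_max lexx.
have b'b : b' <= be by rewrite /b' /a' !ge_max albe !ge_min !lexx !orbT.
pose g x : C := if a' <= x < b' then 1 else 0.
have Kg : Lp_itv g.
  apply: (Lp_itv_le (Lp_itv_chi measurableT)).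
    apply: cmeas_if; [|exact: cmeas_cst|exact: cmeas_cst].
    exact: measurable_cob.
  move=> x; rewrite cmod_chi setTI indicE mem_setE /g in_itv /=.
  case: ifPn => [/andP[h1 h2]|_]; rewrite ?cmod1 ?cmod0 ?ler0n//.
  by rewrite (le_trans aa' h1) (lt_le_trans h2 b'b).
apply: (D_ae _ Kg) => //; last exact: Ditv.
  by apply: Lp_itv_chi.
apply: aeS (aeI (ae_neq a) (ae_neq b)) => x [/eqP xa /eqP xb].
rewrite /chi /g indicE in_setI !mem_setE !in_itv /=.
suff -> : (a < x <= b) && (al <= x < be) = (a' <= x < b') by case: ifP.
rewrite /a' /b' /a'.
by apply/idP/idP; rewrite !(le_max, ge_max, lt_max, gt_max, le_min, ge_min, lt_min, gt_min); lra.
Qed.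

Let H_measurable A : measurable A -> D (chi A) = 0.
Proof.
suff : @measurable _ (measurableTypeR R) `<=` H by move=> h /h [].
apply: (lambda_system_subset (@ocitvI R)) => //.
- split => //.
  + split => //; rewrite -[RHS](Ditv (lexx al) albe (lexx be)); congr D.
    by apply/funext => x; rewrite /chi setTI indicE mem_setE in_itv /=; case: ifP.
  + move=> A' B BA [mA DA] [mB DB']; split; first exact: measurableD.
    have -> : chi (A' `\` B) = fun x => chi A' x - chi B x.
      apply/funext => x; have [Bx|nBx] := pselect (B x).
        by rewrite chi_out ?(chi_in Bx) ?(chi_in (BA _ Bx)) ?subrr// => -[].
      rewrite [chi B x]chi_out// subr0; have [Ax|nAx] := pselect (A' x).
        by rewrite (chi_in Ax) chi_in.
      by rewrite !chi_out// => -[].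
    by rewrite DB; [rewrite DA DB' subrr|exact: Lp_itv_chi|exact: Lp_itv_chi].
  + move=> F ndF HF.
    have mF n : measurable (F n) by case: (HF n).
    have mUF : measurable (\bigcup_n F n) by exact: bigcupT_measurable.
    split => //; apply: D_approx; first exact: Lp_itv_chi.
    move=> e e0; have [_ _ ifin] := Lp_itv_chi mUF.
    have mchi A' : measurable A' -> cmeasurable setT (chi A') by case/Lp_itv_chi.
    have [||n nP] := @pint_dominated _ (fun n => chi (F n)) (chi (\bigcup_n F n)) density1
      (mchi _ mUF) (fun n => mchi _ (mF n)) ifin _ _ e e0.
    + move=> n x; have [Fx|nFx] := pselect (F n x); last by rewrite [chi (F n) x]chi_out// subr0.
      have Ux : (\bigcup_n F n) x by exists n.
      by rewrite (chi_in Fx) (chi_in Ux) subrr cmod0 cmod_ge0.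
    + move=> x; have [[n _ Fx]|nUx] := pselect ((\bigcup_n F n) x).
        apply: (@cvg_near_cst _ _ _ _ _ eventually_filter); exists n => // m /= nm.
        have Fmx : F m x by move/subsetPset: (ndF _ _ nm); exact.
        have Ux : (\bigcup_n F n) x by exists n.
        rewrite (chi_in Fmx) (chi_in Ux) subrr; exact: cmod0.
      apply: (@cvg_near_cst _ _ _ _ _ eventually_filter); apply: nearW => m.
      have nFx : ~ F m x by move=> Fx; apply: nUx; exists m.
      rewrite !chi_out// subrr; exact: cmod0.
    exists (chi (F n)); split; [exact: Lp_itv_chi|by case: (HF n)|exact: nP].
- by move=> _ [[a b] _ <-]; exact: H_itv.
Qed.

Let D_nnsfun (g : {nnsfun R >-> R}) : D (fun x => (g x)%:C * chi setT x) = 0.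
Proof.
pose s : seq R := finmap.enum_fset (fset_set (range g)).
have -> : (fun x => (g x)%:C * chi setT x) =
    (fun x => \sum_(y <- s) (y%:C * chi (g @^-1` [set y]) x)).
  apply/funext => x; rewrite [in LHS]fimfunE fsbig_finite//= rmorph_sum mulr_suml.
  apply: eq_bigr => y _; rewrite rmorphM -mulrA; congr (_ * _).
  have [gy|ngy] := pselect ((g @^-1` [set y]) x).
    by rewrite indicE mem_set// (chi_in gy) chi_in// mul1r.
  by rewrite [RHS]chi_out// indicE memNset// mulr0n rmorph0 mul0r.
have Ks (r : seq R) : Lp_itv (fun x => \sum_(y <- r) (y%:C * chi (g @^-1` [set y]) x)) /\
    D (fun x => \sum_(y <- r) (y%:C * chi (g @^-1` [set y]) x)) = 0.
  elim: r => [|y r [Kr Dr]].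
    by under eq_fun do rewrite big_nil; rewrite D0; split => //; exact: Lp_itv0.
  under eq_fun do rewrite big_cons.
  have Kmy : measurable (g @^-1` [set y]).
    by rewrite -[X in measurable X]setTI; exact: (measurable_funP g).
  have Ky : Lp_itv (chi (g @^-1` [set y])) by exact: Lp_itv_chi.
  split; first exact: Lp_itvD.
  by rewrite Dlin// Dr H_measurable// mulr0 addr0.
by have [] := Ks s.
Qed.

Let D_ge0 (u : R -> R) : (forall x, 0 <= u x) -> Lp_itv (fun x => (u x)%:C) ->
  D (fun x => (u x)%:C) = 0.
Proof.
move=> u0 Ku; have [mu uz ifin] := Ku.
have mu' : measurable_fun setT (fun x => (u x)%:E).
  by apply/measurable_EFinP; case: mu.
have u0' x : setT x -> (0 <= (u x)%:E)%E by rewrite lee_fin.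
apply: D_approx => // e e0.
pose g := nnsfun_approx (measurableT : measurable [set: R]) mu'.
have gu n x : g n x <= u x.
  rewrite -lee_fin; have cg := cvg_nnsfun_approx (measurableT : measurable [set: R]) mu' u0' (I : setT x).
  have nd : nondecreasing_seq (EFin \o (fun n => g n x)).
    by move=> i j ij; rewrite lee_fin; exact/lefP/nd_nnsfun_approx.
  rewrite -(cvg_lim _ cg)// (cvg_lim _ (ereal_nondecreasing_cvgn nd))//.
  by apply: ereal_sup_ubound; exists n.
have mg n : cmeasurable setT (fun x => (g n x)%:C * chi setT x).
  apply: cmeasM; first by apply: cmeas_real; exact: measurable_funP.
  by have [] := Lp_itv_chi measurableT.
have diff n x : cmod ((u x)%:C - (g n x)%:C * chi setT x) = if al <= x < be then u x - g n x else 0.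
  rewrite (chi_in (A := setT) I); case: ifPn => [_|/uz ->]; last by rewrite mulr0 subr0 cmod0.
  by rewrite mulr1 -rmorphB cmodR ger0_norm// subr_ge0.
have gn0 n x : 0 <= g n x by [].
have [||n nP] := @pint_dominated (cst 1) (fun n x => (g n x)%:C * chi setT x) (fun x => (u x)%:C)
  density1 mu mg ifin _ _ e e0.
- by move=> n x; rewrite diff cmodR ger0_norm//; case: ifP => // _; rewrite gerBl.
- move=> x; case xI : (al <= x < be); under eq_fun do rewrite diff xI; last exact: cvg_cst.
  have := cvg_nnsfun_approx (measurableT : measurable [set: R]) mu' u0' (I : setT x).
  move/fine_cvgP => [_ /= cg]; rewrite -(subrr (u x)).
  by apply: cvgB; [exact: cvg_cst|exact: cg].
exists (fun x => (g n x)%:C * chi setT x); split; [|exact: D_nnsfun|exact: nP].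
apply: (Lp_itv_le Ku (mg n)) => x; rewrite (chi_in (A := setT) I).
by case: ifP => _; rewrite ?mulr0 ?cmod0 ?cmod_ge0// mulr1 !cmodR !ger0_norm.
Qed.

Let Lp_itv_part (u : R -> R) f : Lp_itv f -> measurable_fun setT u ->
  (forall x, `|u x| <= cmod (f x)) -> D (fun x => (u x)%:C) = 0.
Proof.
move=> Kf mu uf.
have mp : measurable_fun setT (fun x => Num.max (u x) 0) by exact: measurable_maxr.
have mn : measurable_fun setT (fun x => Num.max (- u x) 0).
  by apply: measurable_maxr => //; exact: measurable_funN.
have part_le (x y : R) : `|Num.max x 0| <= `|x|.
  by rewrite maxEle; case: ifP => //; rewrite normr0.
have Kp : Lp_itv (fun x => (Num.max (u x) 0)%:C).
  by apply: (Lp_itv_le Kf) => [|x]; [exact: cmeas_real|rewrite cmodR (le_trans (part_le _ 0))].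
have Kn : Lp_itv (fun x => (Num.max (- u x) 0)%:C).
  apply: (Lp_itv_le Kf) => [|x]; first exact: cmeas_real.
  by rewrite cmodR (le_trans (part_le _ 0))// normrN.
have -> : (fun x => (u x)%:C) = (fun x => (Num.max (u x) 0)%:C - (Num.max (- u x) 0)%:C).
  apply/funext => x; rewrite -rmorphB; congr (_%:C); rewrite !maxEle oppr_le0.
  by case: (leP (u x) 0) => ux; case: (leP 0 (u x)) => ux'; lra.
by rewrite DB// !D_ge0 ?subrr// => x; rewrite le_max lexx orbT.
Qed.

(** The measurable sets whose indicator functions are annihilated form a
    Dynkin system that contains the intervals, hence contain all measurable
    sets; simple functions and their limits in energy follow, and so do the
    positive and negative parts of the real and the imaginary parts of f. *)
Theorem functional_eq0 f : Lp_itv f -> D f = 0.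
Proof.
move=> Kf; have [[mR mI] _ _] := Kf.
have KR : Lp_itv (fun x => (complex.Re (f x))%:C).
  by apply: (Lp_itv_le Kf) => [|x]; [exact: cmeas_real|rewrite cmodR Re_le_cmod].
have KI : Lp_itv (fun x => (complex.Im (f x))%:C).
  by apply: (Lp_itv_le Kf) => [|x]; [exact: cmeas_real|rewrite cmodR Im_le_cmod].
have -> : f = (fun x => 'i * (complex.Im (f x))%:C + (complex.Re (f x))%:C).
  by apply/funext => x; case: (f x) => a b; apply: complex_eq => /=; ring.
rewrite Dlin// (Lp_itv_part Kf mR) => [|x]; last exact: Re_le_cmod.
by rewrite (Lp_itv_part Kf mI) ?mulr0 ?addr0// => x; exact: Im_le_cmod.
Qed.

End FunctionalVanishing.

(** * Characters of local operators *)

Section FatouEnergy.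
Context {R : realType}.
Local Notation C := R[i].
Local Notation leb := (@lebesgue_measure R).
Variable p : R.
Implicit Types (f : R -> C) (v : R -> R).

Lemma pint_lim_le (v_ : nat -> R -> R) v f (B : \bar R) :
  (forall n, density (v_ n)) -> density v -> cmeasurable setT f ->
  (forall x, \forall n \near \oo, v_ n x = v x) ->
  (forall n, (pint p (v_ n) f <= B)%E) -> (pint p v f <= B)%E.
Proof.
move=> dv_ dv mf vv fB.
have := @fatou _ _ _ leb setT measurableT (fun n x => (cmod (f x) `^ p * v_ n x)%:E)
  (fun n => measurable_pint p (dv_ n) mf).
have pos : forall n x, setT x -> (0 <= (cmod (f x) `^ p * v_ n x)%:E)%E.
  by move=> n x _; rewrite lee_fin mulr_ge0 ?powR_ge0//; case: (dv_ n).
move=> /(_ pos) fat; rewrite pintE.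
have -> : (\int[leb]_x (cmod (f x) `^ p * v x)%:E =
   \int[leb]_x limn_einf (fun n => (cmod (f x) `^ p * v_ n x)%:E))%E.
  apply: eq_integral => x _; apply/esym.
  have cv : (cmod (f x) `^ p * v_ n x)%:E @[n --> \oo] --> (cmod (f x) `^ p * v x)%:E.
    by apply: (@cvg_near_cst _ _ _ _ _ eventually_filter); apply: filterS (vv x) => n ->.
  have [+ _] := cvg_limn_einf_sup cv; exact.
apply: (le_trans fat); rewrite limn_einf_lim; apply: lime_le; first exact: is_cvg_einfs.
apply: nearW => n; apply: le_trans (fB n); rewrite pintE.
by apply: ereal_inf_lbound; exists n => /=.
Qed.
End FatouEnergy.

Section ExpIntegral.
Context {R : realType}.
Local Notation leb := (@lebesgue_measure R).

Lemma integral_exp_tail (c X : R) : 0 < c ->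
  (\int[leb]_x (if X <= x then expR (- c * (x - X)) else 0)%:E = (c^-1)%:E)%E.
Proof.
move=> c0.
pose F (x : R) : \bar R := (c^-1%:E * (exponential_pdf c x)%:E)%E.
have mF : measurable_fun setT F.
  by apply: measurable_funeM; apply/measurable_EFinP; exact: measurable_exponential_pdf.
transitivity (\int[leb]_x F (x - X)%R)%E.
  apply: eq_integral => x _; rewrite /F -EFinM; congr EFin.
  have [Xx|xX] := leP X x.
    by rewrite exponential_pdfE ?subr_ge0// mulrA mulVf ?mul1r ?gt_eqF.
  by rewrite lt0_exponential_pdf ?subr_lt0 ?mulr0.
rewrite integral_shift// /F ge0_integralZl_EFin//=; last 3 first.
- by move=> x _; rewrite lee_fin exponential_pdf_ge0// ltW.
- by apply/measurable_EFinP; exact: measurable_exponential_pdf.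
- by rewrite invr_ge0 ltW.
by rewrite integral_exponential_pdf ?mule1.
Qed.

End ExpIntegral.

Section LocalOperators.
Context {R : realType}.
Local Notation C := R[i].
Local Notation leb := (@lebesgue_measure R).
Variable p : R.
Hypothesis hp : 1 <= p.
Implicit Types (f g h : R -> C) (T U : (R -> C) -> (R -> C)).

Let p0 : 0 < p. Proof. exact: lt_le_trans ltr01 hp. Qed.

Definition win (n : nat) (x : R) : R := if 0 <= x < n%:R then 1 else 0.

Lemma density_win n : density (win n).
Proof.
split; last by move=> x; rewrite /win; case: ifP.
by apply: measurable_fun_ifT => //; exact: measurable_cob.
Qed.

(** Vanishing on the negative axis is required pointwise, so that translating
    to the right needs no truncation. *)
Definition Lploc h := [/\ cmeasurable setT h, (forall x, x < 0 -> h x = 0) &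
  forall n, (pint p (win n) h < +oo)%E].

Variables (V : nat -> R -> R) (a' : R).
Hypothesis dV : forall n, density (V n).
Hypothesis V_out : forall n x, ~~ (0 <= x < n%:R) -> V n x = 0.
Hypothesis V_ge : forall n x, 0 <= x < n%:R -> expR (p * a' * x) <= V n x.
Hypothesis V_le : forall N : nat, exists2 K : R, 0 <= K &
  forall n x, 0 <= x < N%:R -> V n x <= K.

Lemma Lploc_comb c f g : Lploc f -> Lploc g -> Lploc (fun x => c * f x + g x).
Proof.
move=> [mf f0 fi] [mg g0 gi].
have mcf : cmeasurable setT (fun x => c * f x) by apply: cmeasM => //; exact: cmeas_cst.
split; first exact: cmeasD.
- by move=> x x0; rewrite f0// g0// mulr0 addr0.
- move=> n; apply: (pintD_lty hp (density_win n) mcf mg _ (gi n)).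
  by apply: pintZ_lty => //; exact: density_win.
Qed.

Lemma Lploc_le f g : Lploc g -> cmeasurable setT f ->
  (forall x, cmod (f x) <= cmod (g x)) -> Lploc f.
Proof.
move=> [mg g0 gi] mf fg; split => //.
- by move=> x /g0 gx; apply/cmod_eq0/eqP; rewrite eq_le cmod_ge0 andbT (le_trans (fg x))// gx cmod0.
- move=> n; apply: le_lt_trans (gi n); apply: le_pint => //; [exact: density_win|exact: density_win|].
  move=> x; apply: ler_wpM2r; first by case: (density_win n).
  exact: le_powR_cmod.
Qed.

Lemma Lploc_cut (b : R -> bool) f : measurable_fun setT b -> Lploc f ->
  Lploc (fun x => if b x then f x else 0).
Proof.
move=> mb Lf; have [mf _ _] := Lf; apply: (Lploc_le Lf).
  by apply: cmeas_if => //; exact: cmeas_cst.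
by move=> x; case: ifP => // _; rewrite cmod0 cmod_ge0.
Qed.

Lemma Lploc_shift t f : 0 <= t -> Lploc f -> Lploc (fun x => f (x - t)).
Proof.
move=> t0 [mf f0 fi]; split.
- exact: (cmeas_comp (measurable_shift (- t)) mf).
- by move=> x x0; rewrite f0//; lra.
- move=> n; apply: le_lt_trans (fi n).
  rewrite -(pint_shift p (- t) (density_win n) mf); apply: le_pint => //.
  + exact: density_win.
  + exact: density_shift (density_win n).
  + exact: (cmeas_comp (measurable_shift (- t)) mf).
  + exact: (cmeas_comp (measurable_shift (- t)) mf).
  + move=> x; have [xt|tx] := ltP x t.
      by rewrite f0 ?subr_lt0// cmod0 powR0 ?gt_eqF// !mul0r.
    rewrite ler_wpM2l ?powR_ge0// /win; case: ifP => [/andP[h1 h2]|_].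
      by rewrite subr_ge0 tx /= (_ : x - t < n%:R)//; lra.
    by case: ifP.
Qed.

Lemma Lploc_pullback (N : nat) f : Lploc f ->
  Lploc (fun x => if 0 <= x then f (x + N%:R) else 0).
Proof.
move=> [mf f0 fi].
have mfN : cmeasurable setT (fun x => f (x + N%:R)).
  exact: (cmeas_comp (measurable_shift N%:R) mf).
have mfN' : cmeasurable setT (fun x => if 0 <= x then f (x + N%:R) else 0).
  by apply: cmeas_if => //; exact: measurable_geb.
split => //; first by move=> x x0; rewrite leNgt x0.
move=> n; apply: le_lt_trans (fi (n + N)%N).
rewrite -(pint_shift p N%:R (density_win _) mf); apply: le_pint => //.
- exact: density_win.
- exact: density_shift (density_win _).
- move=> x; rewrite /win; have [x0|x0] := leP 0 x; last by rewrite /= mulr0 mulr_ge0 ?powR_ge0//; case: ifP.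
  rewrite ler_wpM2l ?powR_ge0//= natrD ltrD2r; case: ifP => // _; last by case: ifP.
  by rewrite addr_ge0// ler0n.
Qed.

Lemma V_bounded N f : Lploc f -> (forall x, N%:R <= x -> f x = 0) ->
  exists2 B : R, 0 <= B & forall n, (pint p (V n) f <= B%:E)%E.
Proof.
move=> [mf f0 fi] fN; have [K K0 VK] := V_le N.
have pN : (0 <= pint p (win N) f)%E by apply: pint_ge0; exact: density_win.
have pNfin : pint p (win N) f \is a fin_num by rewrite ge0_fin_numE.
exists (K * fine (pint p (win N) f)); first by rewrite mulr_ge0// fine_ge0.
move=> n; rewrite EFinM fineK//.
rewrite -(pintZv p K0 (density_win N) mf); apply: le_pint => //.
  by apply: densityZ => //; exact: density_win.
move=> x; rewrite /win; case: ifPn => xN.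
  by rewrite ler_wpM2l ?powR_ge0// mulr1 VK.
rewrite (_ : f x = 0); first by rewrite cmod0 powR0 ?gt_eqF// !mul0r.
by move: xN; rewrite negb_and -ltNge -leNgt => /orP[/f0|/fN].
Qed.

Section ell.
Variables (x0 a : R).
Hypothesis aa' : a < a'.
Let ep := a' - a.
Let ep0 : 0 < ep. Proof. by rewrite subr_gt0. Qed.

Definition lker (x : R) : C := expi (- (x0 * x)) * (expR (a * x))%:C.

(** The Laplace functional of the half-line at z = x0 + i a: the kernel is
    e^(-izx). *)
Definition ell h : C := cintegral (fun x => h x * lker x).

Lemma lkerD x y : lker (x + y) = lker x * lker y.
Proof. by rewrite /lker !mulrDr opprD expiD expRD rmorphM; ring. Qed.

Lemma cmod_lker x : cmod (lker x) = expR (a * x).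
Proof. by rewrite cmodM cmod_expi mul1r cmodR ger0_norm ?expR_ge0. Qed.

Lemma cmeas_lker : cmeasurable setT lker.
Proof.
apply: cmeasM.
- by apply: cmeas_expi; apply: measurable_funN; exact: measurable_funM.
- by apply: cmeas_real; apply: measurableT_comp => //; exact: measurable_funM.
Qed.

Lemma cmeas_mulker h : cmeasurable setT h -> cmeasurable setT (fun x => h x * lker x).
Proof. by move=> mh; apply: cmeasM => //; exact: cmeas_lker. Qed.

(** The kernel has modulus e^(ax) = e^(- ep x) e^(a' x), and the second
    factor times |h| is controlled by the energies: y <= d + d^(1 - p) y^p
    splits the integral into an exponential tail and an energy. The parameter
    d, and the left end X of the support, make the bound small when needed. *)
Lemma absint_ker h (B X d : R) : 0 < d -> 0 <= X -> 0 <= B -> Lploc h ->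
  (\forall x \ae leb, x < X -> h x = 0) -> (forall n, (pint p (V n) h <= B%:E)%E) ->
  (absint (fun x => h x * lker x)%R <= (expR (- ep * X) * (d / ep + d `^ (1 - p) * B))%:E)%E.
Proof.
move=> d0 X0 B0 [mh h0 hi] hX hB.
pose v (x : R) : R := if 0 <= x then expR (p * a' * x) else 0.
have mexp (c : R) : measurable_fun setT (fun x : R => expR (c * x)).
  by apply: measurableT_comp => //; exact: measurable_funM.
have dv : density v.
  split; last by move=> x; rewrite /v; case: ifP => // _; rewrite expR_ge0.
  by apply: measurable_fun_ifT => //; exact: measurable_geb.
pose v_ (n : nat) (x : R) : R := if 0 <= x < n%:R then expR (p * a' * x) else 0.
have dv_ n : density (v_ n).
  split; last by move=> x; rewrite /v_; case: ifP => // _; rewrite expR_ge0.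
  by apply: measurable_fun_ifT => //; exact: measurable_cob.
have vB : (pint p v h <= B%:E)%E.
  apply: (pint_lim_le dv_ dv mh).
    move=> x; near=> n; rewrite /v_ /v; congr (if _ then _ else _).
    rewrite (_ : x < n%:R) ?andbT//; near: n; exact: nbhs_infty_gtr.
  move=> n; apply: le_trans (hB n); apply: le_pint => // x.
  rewrite ler_wpM2l ?powR_ge0// /v_; case: ifP => [xn|_]; first exact: V_ge.
  by case: (dV n).
pose e1 (x : R) : R := if X <= x then expR (- ep * (x - X)) else 0.
have me1 : measurable_fun setT e1.
  apply: measurable_fun_ifT => //; first exact: measurable_geb.
  by apply: measurableT_comp => //; apply: measurable_funM => //; exact: measurable_shift.
have e10 x : 0 <= e1 x by rewrite /e1; case: ifP => // _; exact: expR_ge0.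
have c0 : 0 <= d `^ (1 - p) by exact: powR_ge0.
have mhv := measurable_pint p dv mh.
have hv0 x : 0 <= cmod (h x) `^ p * v x.
  by rewrite mulr_ge0 ?powR_ge0//; case: dv.
have hd0 x : 0 <= d * e1 x by rewrite mulr_ge0// ltW.
have hc0 x : 0 <= d `^ (1 - p) * (cmod (h x) `^ p * v x) by rewrite mulr_ge0// hv0.
have hI x : 0 <= d * e1 x + d `^ (1 - p) * (cmod (h x) `^ p * v x) by rewrite addr_ge0.
rewrite absintE.
apply: (@le_trans _ _ (\int[leb]_x ((expR (- ep * X))%:E *
   (d%:E * (e1 x)%:E + (d `^ (1 - p))%:E * (cmod (h x) `^ p * v x)%:E)))%E).
  apply: ae_ge0_le_integral => //=.
  - by move=> x _; rewrite lee_fin cmod_ge0.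
  - by apply: measurable_cmodE; exact: cmeas_mulker.
  - by move=> x _; rewrite lee_fin; apply: mulr_ge0 (expR_ge0 _) (hI x).
  - apply: measurable_funeM; apply: emeasurable_funD; apply: measurable_funeM => //.
    exact/measurable_EFinP.
  - apply: aeS hX => x hX _; rewrite lee_fin.
    have [xX|Xx] := ltP x X.
      have -> : cmod (h x * lker x) = 0 by rewrite hX// mul0r cmod0.
      by apply: mulr_ge0 (expR_ge0 _) (hI x).
    have x0' : 0 <= x := le_trans X0 Xx.
    rewrite /e1 Xx /v x0' cmodM cmod_lker.
    have -> : expR (a * x) = expR (- ep * X) * expR (- ep * (x - X)) * expR (a' * x).
      by rewrite -!expRD; congr expR; rewrite /ep; ring.
    rewrite mulrC -!mulrA ler_wpM2l ?expR_ge0//.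
    have -> : expR (p * (a' * x)) = expR (a' * x) `^ p by rewrite -expRM mulrC.
    rewrite -powRM ?cmod_ge0 ?expR_ge0// [cmod _ * _]mulrC.
    have le1 : expR (- ep * (x - X)) <= 1.
      by rewrite -[leRHS]expR0 ler_expR mulNr oppr_le0 mulr_ge0 ?(ltW ep0)// subr_ge0.
    set y := expR (a' * x) * cmod (h x).
    have y0 : 0 <= y by rewrite mulr_ge0 ?expR_ge0 ?cmod_ge0.
    apply: (le_trans (ler_wpM2l (expR_ge0 _) (powR_linear_le hp d0 y0))).
    rewrite mulrDr [d * _]mulrC lerD2l -[leRHS]mul1r ler_wpM2r// mulr_ge0 ?powR_ge0//.
rewrite ge0_integralZl_EFin ?expR_ge0//; last 2 first.
- by move=> x _; rewrite lee_fin; exact: hI.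
- apply: emeasurable_funD; apply: measurable_funeM => //.
  exact/measurable_EFinP.
rewrite EFinM lee_pmul2l// ?lte_fin ?expR_gt0//.
rewrite ge0_integralD//=; last 4 first.
- by move=> x _; rewrite lee_fin.
- by apply: measurable_funeM; exact/measurable_EFinP.
- by move=> x _; rewrite lee_fin.
- exact: measurable_funeM.
rewrite EFinD leeD//.
- rewrite ge0_integralZl_EFin ?(ltW d0)//; last 2 first.
  + by move=> x _; rewrite lee_fin.
  + exact/measurable_EFinP.
  by rewrite integral_exp_tail.
- rewrite ge0_integralZl_EFin//; last by move=> x _; rewrite lee_fin.
  by rewrite EFinM lee_wpmul2l ?lee_fin// -pintE.
Unshelve. all: by end_near. Qed.

(** The energies for the densities V_n are not monotone in n; a bound that is
    uniform in n is what makes [ell] defined. *)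
Definition nbound (B : R) h := forall n, (pint p (V n) h <= B%:E)%E.

Lemma cintegrable_ker h (B : R) : 0 <= B -> Lploc h -> nbound B h ->
  cintegrable (fun x => h x * lker x).
Proof.
move=> B0 Lh hB; split; first by apply: cmeas_mulker; case: Lh.
have /(absint_ker ltr01 (lexx 0) B0 Lh)/(_ hB) : \forall x \ae leb, x < 0 -> h x = 0.
  by apply: aeT; case: Lh.
by move=> /le_lt_trans; apply; rewrite ltry.
Qed.

Lemma ell_tail h (B X d : R) : 0 < d -> 0 <= X -> 0 <= B -> Lploc h ->
  (\forall x \ae leb, x < X -> h x = 0) -> nbound B h ->
  cmod (ell h) <= 2 * (expR (- ep * X) * (d / ep + d `^ (1 - p) * B)).
Proof.
move=> d0 X0 B0 Lh hX hB; apply: cintegral_le; last exact: absint_ker.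
by apply: cmeas_mulker; case: Lh.
Qed.

Lemma ell_comb c f g (B1 B2 : R) : 0 <= B1 -> 0 <= B2 -> Lploc f -> Lploc g ->
  nbound B1 f -> nbound B2 g -> ell (fun x => c * f x + g x) = c * ell f + ell g.
Proof.
move=> B10 B20 Lf Lg fB gB.
have fi := cintegrable_ker B10 Lf fB; have gi := cintegrable_ker B20 Lg gB.
rewrite /ell -cintegralZ// -cintegralD//; last exact: cintegrableZ.
by congr cintegral; apply/funext => x; rewrite mulrDl mulrA.
Qed.

Lemma ell_shift s h (B : R) : 0 <= B -> Lploc h -> nbound B h ->
  ell (fun x => h (x - s)) = lker s * ell h.
Proof.
move=> B0 Lh hB; rewrite /ell -cintegralZ; last exact: cintegrable_ker hB.
rewrite -[LHS](cintegral_shift s); last first.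
  apply: cmeas_mulker; case: Lh => mh _ _.
  exact: (cmeas_comp (measurable_shift (- s)) mh).
by congr cintegral; apply/funext => x; rewrite addrK lkerD; ring.
Qed.

Lemma eq_ell_ae f g : Lploc f -> Lploc g -> (\forall x \ae leb, f x = g x) -> ell f = ell g.
Proof.
move=> [mf _ _] [mg _ _] fg; apply: eq_cintegral_ae; [exact: cmeas_mulker|exact: cmeas_mulker|].
by apply: aeS fg => x ->.
Qed.

(** The last condition also yields causality: if f vanishes on [0, N), so
    does T f, since the density V_N lives on [0, N) and is positive there. *)
Definition local_operator (M : R) T :=
  [/\ (forall f, Lploc f -> Lploc (T f)),
      (forall c f g, Lploc f -> Lploc g ->
         \forall x \ae leb, T (fun y => c * f y + g y) x = c * T f x + T g x),
      (forall t f, 0 <= t -> Lploc f ->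
         \forall x \ae leb, T (fun y => f (y - t)) x = T f (x - t)) &
      (forall n f, Lploc f -> (pint p (V n) (T f) <= (M `^ p)%:E * pint p (V n) f)%E)].

Lemma local_operator_id : local_operator 1 id.
Proof.
split => //; do ?by move=> *; exact: aeT.
by move=> n f _; rewrite powR1 mul1e.
Qed.

Lemma local_operator_nbound M T f (B : R) : local_operator M T -> Lploc f ->
  nbound B f -> nbound (M `^ p * B) (T f).
Proof.
move=> [_ _ _ TM] Lf fB n; apply: (le_trans (TM _ _ Lf)).
by rewrite EFinM lee_wpmul2l ?lee_fin ?powR_ge0.
Qed.

Lemma local_operator_causal M T f (N : nat) : local_operator M T -> Lploc f ->
  (forall x, x < N%:R -> f x = 0) -> \forall x \ae leb, x < N%:R -> T f x = 0.
Proof.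
move=> [TL _ TS _] Lf fN.
pose f' (x : R) := if 0 <= x then f (x + N%:R) else 0.
have Lf' : Lploc f' by exact: Lploc_pullback.
have -> : f = (fun y => f' (y - N%:R)).
  apply/funext => x; rewrite /f' subr_ge0 subrK; case: leP => // xN; exact: fN.
have [_ Tf'0 _] := TL _ Lf'.
by apply: aeS (TS N%:R f' (ler0n _ _) Lf') => x -> xN; rewrite Tf'0// subr_lt0.
Qed.

Definition step (s x : R) : C := if 0 <= x < s then 1 else 0.

Lemma Lploc_step s : Lploc (step s).
Proof.
have ms : cmeasurable setT (step s).
  by apply: cmeas_if; [exact: measurable_cob|exact: cmeas_cst|exact: cmeas_cst].
split => //; first by move=> x x0'; rewrite /step leNgt x0'.
move=> n; rewrite pintE.
apply: (@le_lt_trans _ _ (leb `[0, n%:R[%classic)); last first.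
  by rewrite lebesgue_measure_itv /=; case: ifP => _; rewrite -?EFinB ltry.
have -> : leb `[0, n%:R[%classic = (\int[leb]_x (\1_(`[0, n%:R[%classic) x)%:E)%E.
  by rewrite integral_indic// setIT.
apply: ge0_le_integral => //=.
- by move=> x _; rewrite lee_fin mulr_ge0 ?powR_ge0//; case: (density_win n).
- by apply: measurable_pint => //; exact: density_win.
- by apply/measurable_EFinP; exact: measurable_indic.
- move=> x _; rewrite lee_fin indicE mem_setE in_itv /= /win.
  case: ifP => _; last by rewrite mulr0.
  rewrite mulr1 /step; case: ifP => _; first by rewrite cmod1 powR1.
  by rewrite cmod0 powR0 ?gt_eqF// ler0n.
Qed.

Lemma step_out s x : s <= x -> step s x = 0.
Proof. by move=> sx; rewrite /step ltNge sx andbF. Qed.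

Lemma nbound_compact f X : Lploc f -> (forall x, X <= x -> f x = 0) ->
  exists2 B : R, 0 <= B & nbound B f.
Proof.
move=> Lf fX; apply: (V_bounded (N := `|Num.ceil X|.+1)) => // x sx.
apply: fX; apply: le_trans sx; rewrite (le_trans (ceil_ge X))// -natr1 -[leLHS]addr0 lerD//.
by rewrite natr_absz ler_int ler_norm.
Qed.

Lemma step_add s t : 0 <= s -> 0 <= t ->
  step (s + t) = (fun x => 1 * step t (x - s) + step s x).
Proof.
move=> s0 t0; apply/funext => x; rewrite /step mul1r subr_ge0 ltrBlDl.
have [xs|sx] := ltP x s.
  by rewrite (lt_le_trans xs) ?lerDl// !andbT add0r.
by rewrite (le_trans s0 sx) /= addr0.
Qed.

Lemma ell_T_step_add M T s t : local_operator M T -> 0 <= s -> 0 <= t ->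
  ell (T (step (s + t))) = ell (T (step s)) + lker s * ell (T (step t)).
Proof.
move=> LT s0 t0; have [TL Tlin TS _] := LT.
have Ls := Lploc_step s; have Lt := Lploc_step t.
have Lsh : Lploc (fun x => step t (x - s)) by exact: Lploc_shift.
have [B1 B10 sB] := nbound_compact Ls (@step_out s).
have [B2 B20 tB] := nbound_compact Lt (@step_out t).
have [|B3 B30 shB] := @nbound_compact _ (t + s) Lsh.
  by move=> x tx; rewrite step_out// lerBrDr.
have LTs := TL _ Ls; have LTt := TL _ Lt; have LTsh := TL _ Lsh.
have pos B : 0 <= B -> 0 <= M `^ p * B by move=> ?; rewrite mulr_ge0 ?powR_ge0.
have bTs := local_operator_nbound LT Ls sB; have bTt := local_operator_nbound LT Lt tB.
have bTsh := local_operator_nbound LT Lsh shB.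
rewrite -(ell_shift s (pos _ B20) LTt bTt).
rewrite -(eq_ell_ae LTsh (Lploc_shift s0 LTt) (TS s _ s0 Lt)).
rewrite [RHS]addrC -[X in _ = X + _]mul1r -(ell_comb 1 (pos _ B30) (pos _ B10) LTsh LTs bTsh bTs).
apply: eq_ell_ae; [exact: TL _ (Lploc_step _)|exact: Lploc_comb|].
by rewrite step_add//; exact: Tlin.
Qed.

(** Evaluating the identity of [ell_T_step_add] at s + t = t + s in both
    orders. *)
Lemma step_comm M T s t : local_operator M T -> 0 <= s -> 0 <= t ->
  ell (T (step s)) * (1 - lker t) = ell (T (step t)) * (1 - lker s).
Proof.
move=> LT s0 t0.
have := ell_T_step_add LT t0 s0; rewrite [t + s]addrC (ell_T_step_add LT s0 t0) => e.
apply/eqP; rewrite -subr_eq0.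
rewrite (_ : _ - _ = (ell (T (step s)) + lker s * ell (T (step t))) -
  (ell (T (step t)) + lker t * ell (T (step s)))); last by ring.
by rewrite e subrr.
Qed.

Hypothesis z0 : (x0 != 0) || (a != 0).

Let s0 : R := (2 * (1 + `|x0|))^-1.
Let s00 : 0 < s0. Proof. by rewrite invr_gt0 mulr_gt0// ltr_pwDl. Qed.
Let x0s0 y : 0 <= y <= s0 -> `|x0 * y| <= 2^-1.
Proof.
move=> /andP[y0 ys]; rewrite normrM (ger0_norm y0).
apply: (le_trans (ler_wpM2l (normr_ge0 _) ys)).
have n0 : 0 < 1 + `|x0| by rewrite ltr_pwDl.
rewrite /s0 invfM mulrCA -[leRHS]mulr1 ler_pM2l ?invr_gt0//.
by rewrite ler_pdivrMr// mul1r lerDr.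
Qed.
Let half_pi : 2^-1 < pi / 2 :> R.
Proof. by apply: lt_le_trans (pihalf_ge1 R); rewrite invf_lt1// ltr1n. Qed.

(** The length s0 of the reference interval is too short for x0 s0 to reach a
    period of the exponential, so the kernel takes the value 1 at s0 only
    when z vanishes. *)
Lemma lker_neq1 : 1 - lker s0 != 0.
Proof.
rewrite subr_eq0; apply/eqP => k1.
have a0 : a = 0.
  have := congr1 (@cmod R) k1; rewrite cmod1 cmod_lker -[LHS]expR0 => /expR_inj/esym/eqP.
  by rewrite mulf_eq0 (gt_eqF s00) orbF => /eqP.
move: z0; rewrite a0 eqxx orbF => x00.
have := congr1 (@complex.Im R) k1; rewrite /lker a0 mul0r expR0 rmorph1 mulr1 /= => /esym/eqP.
rewrite sinN oppr_eq0 => /eqP sx.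
have xs1 : `|x0 * s0| < pi / 2 by apply: le_lt_trans half_pi; rewrite x0s0// (ltW s00) lexx.
have : sin `|x0 * s0| != 0.
  by rewrite gt_eqF// sin_gt0_pihalf// xs1 andbT normr_gt0 mulf_neq0// gt_eqF.
by case: (ler0P (x0 * s0)) => _; rewrite ?sinN sx ?oppr0 eqxx.
Qed.

(** On [0, s0) the real part of the kernel is bounded below by a positive
    constant. *)
Lemma ell_step_neq0 : ell (step s0) != 0.
Proof.
pose c : R := cos 2^-1 * expR (- (`|a| * s0)).
have c0 : 0 < c.
  rewrite mulr_gt0 ?expR_gt0// cos_gt0_pihalf// half_pi andbT.
  by have := half_pi; lra.
have Ls := Lploc_step s0; have [B B0 sB] := nbound_compact Ls (@step_out s0).
have iRe := cintegrable_Re (cintegrable_ker B0 Ls sB).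
apply/negP => /eqP/(congr1 (@complex.Re R)) /=.
suff : c * s0 <= \int[leb]_x complex.Re (step s0 x * lker x).
  by move=> + e0; rewrite e0 leNgt mulr_gt0.
have i1 : leb.-integrable setT (EFin \o (\1_(`[0, s0[%classic) : R -> R)).
  apply/integrableP; split; first by apply/measurable_EFinP; exact: measurable_indic.
  apply: (@le_lt_trans _ _ (\int[leb]_x (\1_(`[0, s0[%classic) x)%:E)%E).
    rewrite le_eqVlt; apply/orP; left; apply/eqP.
    by apply: eq_integral => x _; rewrite /= ger0_norm// indicE.
  rewrite integral_indic// setIT.
  have fin : (leb `[0%R, s0[%classic < +oo)%E.
    by rewrite lebesgue_measure_itv /=; case: ifP => _; rewrite -?EFinB ltry.
  exact: fin.
have ci : leb.-integrable setT (EFin \o (fun x => c * \1_(`[0, s0[%classic) x)).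
  by have := integrableZl measurableT c i1.
have -> : c * s0 = \int[leb]_x (c * \1_(`[0, s0[%classic) x).
  have es : leb `[0%R, s0[%classic = s0%:E.
    by rewrite lebesgue_measure_itv /= lte_fin s00 -EFinB subr0.
  rewrite RintegralZl// /Rintegral integral_indic// setIT; congr (_ * _).
  by rewrite -[LHS]/(fine s0%:E) -es.
apply: le_Rintegral => // x _.
rewrite indicE mem_setE in_itv /= /step; case: ifP => [/andP[h1 h2]|_]; last by rewrite mul0r mulr0.
have hx : 0 <= x <= s0 by rewrite h1 ltW.
have hc : cos 2^-1 <= cos (x0 * x).
  have -> : cos (x0 * x) = cos `|x0 * x| by case: (ler0P (x0 * x)) => _; rewrite ?cosN.
  have := x0s0 hx; rewrite le_eqVlt => /orP[/eqP ->//|lt_half]; apply/ltW.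
  have pi2 := half_pi; have := pi_gt0 R => pi0.
  by rewrite ltr_cos// ?in_itv /=; apply/andP; split; rewrite ?normr_ge0//; lra.
rewrite mulr1 mul1r /lker ReM /= mulr0 subr0 cosN.
have he : expR (- (`|a| * s0)) <= expR (a * x).
  rewrite ler_expR lerNl -mulNr (le_trans (ler_norm _))// normrM normrN (ger0_norm h1).
  by rewrite ler_wpM2l ?normr_ge0// ltW.
have c1 : 0 <= cos (2^-1 : R) by apply: ltW; rewrite cos_gt0_pihalf//; have := half_pi; lra.
by rewrite /c ler_pM ?expR_ge0.
Qed.

(** The function s |-> ell (T 1_[0,s)) and its analogue for T = id satisfy
    the same relation [step_comm], whose solutions are the multiples of
    1-e^(-izs). *)
Lemma char_exists M T : local_operator M T -> exists m, forall s, 0 <= s ->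
  ell (T (step s)) = m * ell (step s).
Proof.
move=> LT; exists (ell (T (step s0)) / ell (step s0)) => s sge0.
have e1 := step_comm LT sge0 (ltW s00).
have e2 : ell (step s) * (1 - lker s0) = ell (step s0) * (1 - lker s).
  exact: (step_comm local_operator_id sge0 (ltW s00)).
apply: (mulIf lker_neq1); rewrite e1 -[RHS]mulrA e2.
by rewrite mulrA divfK// ell_step_neq0.
Qed.

Definition has_char T m := forall s, 0 <= s -> ell (T (step s)) = m * ell (step s).

Lemma Lp_itv_Lploc (N : nat) f : Lp_itv p 0 N%:R f -> Lploc f.
Proof.
move=> [mf f0 fi]; split => //; first by move=> x x0'; rewrite f0// leNgt x0'.
move=> n; apply: le_lt_trans fi; apply: (le_pint (density_win n) density1 mf mf) => x.
by rewrite ler_wpM2l ?powR_ge0// /win; case: ifP.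
Qed.

Lemma Lploc_Lp_itv (N : nat) f : Lploc f -> (forall x, N%:R <= x -> f x = 0) ->
  Lp_itv p 0 N%:R f.
Proof.
move=> [mf f0 fi] fN.
have fout x : ~~ (0 <= x < N%:R) -> f x = 0.
  by rewrite negb_and -ltNge -leNgt => /orP[/f0|/fN].
split => //; apply: le_lt_trans (fi N); apply: (le_pint density1 (density_win N) mf mf) => x.
rewrite /win; case: ifPn => [|/fout ->]; first by rewrite ler_wpM2l ?powR_ge0.
by rewrite cmod0 powR0 ?gt_eqF// !mul0r.
Qed.

Lemma Lp_itv_nbound (N : nat) : exists2 K : R, 0 < K &
  forall f (d : R), Lp_itv p 0 N%:R f -> (pint p (cst 1%R) f <= d%:E)%E -> nbound (K * d) f.
Proof.
have [K K0 VK] := V_le N; exists (K + 1); first by rewrite ltr_wpDl.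
have K10 : 0 <= K + 1 by rewrite addr_ge0.
move=> f d [mf f0 fi] fd n.
apply: (@le_trans _ _ ((K + 1)%:E * pint p (cst 1%R) f)%E); last first.
  by rewrite EFinM lee_wpmul2l ?lee_fin.
rewrite -(pintZv p K10 density1 mf).
apply: (le_pint (dV n) (densityZ K10 density1) mf mf) => x.
 case xN: (0 <= x < N%:R); last by rewrite f0 ?xN// cmod0 powR0 ?gt_eqF// !mul0r.
by rewrite ler_wpM2l ?powR_ge0// mulr1 (le_trans (VK _ _ xN))// lerDl.
Qed.

(** The defect D g = ell (T g) - m ell g is linear, continuous for the energy
    on [0, N), and vanishes on intervals. *)
Lemma char_compact M T m (N : nat) f : local_operator M T -> has_char T m ->
  Lp_itv p 0 N%:R f -> ell (T f) = m * ell f.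
Proof.
move=> LT mT Kf; have [TL Tlin TS TM] := LT.
have [K K0 VK] := Lp_itv_nbound N.
have finb g : Lp_itv p 0 N%:R g -> exists2 B : R, 0 <= B & nbound B g.
  move=> Kg; apply: (nbound_compact (Lp_itv_Lploc Kg) (X := N%:R)).
  by case: Kg => _ g0 _ x xN; rewrite g0// ltNge xN andbF.
apply/eqP; rewrite -subr_eq0; apply/eqP.
pose D g := ell (T g) - m * ell g.
have Dlin c g h : Lp_itv p 0 N%:R g -> Lp_itv p 0 N%:R h ->
    D (fun x => c * g x + h x) = c * D g + D h.
  move=> Kg Kh.
  have [Bg Bg0 gB] := finb _ Kg; have [Bh Bh0 hB] := finb _ Kh.
  have Lg := Lp_itv_Lploc Kg; have Lh := Lp_itv_Lploc Kh.
  have pos B : 0 <= B -> 0 <= M `^ p * B by move=> ?; rewrite mulr_ge0 ?powR_ge0.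
  rewrite /D (ell_comb c Bg0 Bh0 Lg Lh gB hB).
  rewrite (eq_ell_ae (TL _ (Lploc_comb c Lg Lh)) (Lploc_comb c (TL _ Lg) (TL _ Lh)) (Tlin c _ _ Lg Lh)).
  rewrite (ell_comb c (pos _ Bg0) (pos _ Bh0) (TL _ Lg) (TL _ Lh)
    (local_operator_nbound LT Lg gB) (local_operator_nbound LT Lh hB)).
  ring.
apply: (@functional_eq0 R p hp 0 N%:R _ D) => //.
- move=> e e0.
  (* In [ell_tail] first d is chosen small with respect to e, then the
     energy eta with respect to the factor d^(1 - p). *)
  pose q := 1 + cmod m; have q0 : 0 < q by rewrite ltr_pwDl// cmod_ge0.
  pose d := e * ep / (4 * q).
  have d0 : 0 < d by rewrite divr_gt0 ?mulr_gt0.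
  pose r := d `^ (1 - p) * K * (M `^ p + q).
  have r0 : 0 < r.
    by apply: mulr_gt0; [apply: mulr_gt0 => //; exact: powR_gt0|apply: ltr_wpDl => //; exact: powR_ge0].
  pose eta := e / (4 * r).
  have eta0 : 0 < eta by apply: divr_gt0 => //; apply: mulr_gt0.
  exists eta => //.
  move=> g Kg /(VK _ _ Kg) gB; have Lg := Lp_itv_Lploc Kg.
  have Keta : 0 <= K * eta by rewrite mulr_ge0 ?ltW.
  have neg0 h : Lploc h -> \forall x \ae leb, x < 0 -> h x = 0.
    by move=> [_ h0 _]; exact: aeT.
  have TgB := local_operator_nbound LT Lg gB.
  have hg := ell_tail d0 (lexx 0) Keta Lg (neg0 _ Lg) gB.
  have hT := ell_tail d0 (lexx 0) (mulr_ge0 (powR_ge0 M p) Keta) (TL _ Lg) (neg0 _ (TL _ Lg)) TgB.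
  rewrite mulr0 expR0 mul1r in hg hT.
  rewrite /D (le_trans (cmodB _ _))// cmodM.
  apply: (le_trans (lerD hT (ler_wpM2l (cmod_ge0 m) hg))).
  rewrite [leLHS](_ : _ = 2 * q * (d / ep) + 2 * eta * (d `^ (1 - p) * K * (M `^ p + cmod m))); last first.
    by rewrite /q; ring.
  have -> : 2 * q * (d / ep) = e / 2.
    by rewrite /d; field; rewrite !gt_eqF//= .
  have : 2 * eta * (d `^ (1 - p) * K * (M `^ p + cmod m)) <= 2 * eta * r.
    apply: ler_wpM2l; first by apply: mulr_ge0 => //; exact: ltW.
    apply: ler_wpM2l; first by apply: mulr_ge0; [exact: powR_ge0|exact: ltW].
    by rewrite lerD2l lerDr.
  have -> : 2 * eta * r = e / 2 by rewrite /eta; field; rewrite gt_eqF.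
  by move=> h; rewrite [leRHS]splitr lerD2l.
- move=> b c b0 bc cN.
  have Ks s : s <= N%:R -> Lp_itv p 0 N%:R (step s).
    by move=> sN; apply: Lploc_Lp_itv (Lploc_step s) _ => x Nx; apply: step_out; exact: le_trans Nx.
  have Ds s : 0 <= s -> D (step s) = 0 by move=> s0'; rewrite /D mT// subrr.
  rewrite (_ : (fun x => _) = (fun x => (-1) * step b x + step c x)); last first.
    apply/funext => x; rewrite /step mulN1r; have [xb|bx] := ltP x b.
      by rewrite andbT (lt_le_trans xb bc) andbT /=; case: ifP => _; rewrite addNr.
    by rewrite andbF (le_trans b0 bx) oppr0 add0r.
  rewrite (Dlin _ _ _ (Ks _ (le_trans bc cN)) (Ks _ cN)) (Ds _ b0) (Ds _ (le_trans b0 bc)).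
  by rewrite mulr0 addr0.
Qed.

(** The part of h beyond N vanishes on [0, N), and so does its image, by
    causality; the tail estimate [ell_tail] shows that both contribute
    O(e^(-ep*N)). *)
Lemma char_bounded M T m h (B : R) : local_operator M T -> has_char T m ->
  Lploc h -> 0 <= B -> nbound B h -> ell (T h) = m * ell h.
Proof.
move=> LT mT Lh B0 hB; have [TL Tlin TS TM] := LT.
have MB : 0 <= M `^ p * B by rewrite mulr_ge0 ?powR_ge0.
pose K := 2 * (1 / ep + 1 `^ (1 - p) * (M `^ p * B)) +
  cmod m * (2 * (1 / ep + 1 `^ (1 - p) * B)).
have bound (N : nat) : cmod (ell (T h) - m * ell h) <= expR (- ep * N%:R) * K.
  pose h1 (x : R) : C := if x < N%:R then h x else 0.
  pose h2 (x : R) : C := if N%:R <= x then h x else 0.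
  have L1 : Lploc h1 by apply: Lploc_cut => //; exact: measurable_ltb.
  have L2 : Lploc h2 by apply: Lploc_cut => //; exact: measurable_geb.
  have [mh _ _] := Lh; have [mh1 _ _] := L1; have [mh2 _ _] := L2.
  have B1 : nbound B h1.
    move=> n; apply: le_trans (hB n); apply: (le_pint (dV n) (dV n) mh1 mh) => x.
    rewrite ler_wpM2r//; first by case: (dV n).
    by apply: le_powR_cmod => //; rewrite /h1; case: ifP => // _; rewrite cmod0 cmod_ge0.
  have B2 : nbound B h2.
    move=> n; apply: le_trans (hB n); apply: (le_pint (dV n) (dV n) mh2 mh) => x.
    rewrite ler_wpM2r//; first by case: (dV n).
    by apply: le_powR_cmod => //; rewrite /h2; case: ifP => // _; rewrite cmod0 cmod_ge0.
  have hE : h = (fun x => 1 * h1 x + h2 x).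
    by apply/funext => x; rewrite /h1 /h2 mul1r; case: leP => _; rewrite ?add0r ?addr0.
  have K1 : Lp_itv p 0 N%:R h1.
    by apply: Lploc_Lp_itv => // x Nx; rewrite /h1 ltNge Nx.
  have TB1 := local_operator_nbound LT L1 B1; have TB2 := local_operator_nbound LT L2 B2.
  have -> : ell (T h) - m * ell h = ell (T h2) - m * ell h2.
    have -> : ell (T h) = ell (T h1) + ell (T h2).
      rewrite [in LHS]hE (eq_ell_ae (TL _ (Lploc_comb 1 L1 L2)) (Lploc_comb 1 (TL _ L1) (TL _ L2))
        (Tlin 1 _ _ L1 L2)).
      by rewrite (ell_comb 1 MB MB (TL _ L1) (TL _ L2) TB1 TB2) mul1r.
    have -> : ell h = ell h1 + ell h2.
      by rewrite [in LHS]hE (ell_comb 1 B0 B0 L1 L2 B1 B2) mul1r.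
    by rewrite (char_compact LT mT K1); ring.
  have h2N x : x < N%:R -> h2 x = 0 by move=> xN; rewrite /h2 leNgt xN.
  have t1 := ell_tail ltr01 (ler0n _ N) MB (TL _ L2) (local_operator_causal LT L2 h2N) TB2.
  have t2 := ell_tail ltr01 (ler0n _ N) B0 L2 (aeT h2N) B2.
  rewrite (le_trans (cmodB _ _))// cmodM (le_trans (lerD t1 (ler_wpM2l (cmod_ge0 m) t2)))//.
  rewrite le_eqVlt; apply/orP; left; apply/eqP; rewrite /K; ring.
apply/eqP; rewrite -subr_eq0; apply/eqP/cmod_eq0/eqP; rewrite eq_le cmod_ge0 andbT.
have cv : (expR (- ep) ^+ N) * K @[N --> \oo] --> 0 * K.
  apply: cvgMl; apply: cvg_expr; rewrite ger0_norm ?expR_ge0//.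
  by rewrite -expR0 ltr_expR oppr_lt0.
rewrite mul0r in cv; rewrite -(cvg_lim _ cv)//; apply: limr_ge; first by apply/cvg_ex; exists 0.
apply: nearW => N; apply: (le_trans (bound N)).
by rewrite expRM_natr.
Qed.

(** Iterating the inverse on an indicator function h: (m - l)^k ell (U^k h) =
    ell h, where the right-hand side is not zero and |ell (U^k h)| is
    O(Mu^k). This forces |m - l| Mu >= 1. *)
Theorem resolvent_char T U (Mt Mu : R) m l : 0 < Mu ->
  local_operator Mt T -> local_operator Mu U -> has_char T m ->
  (forall f, Lploc f -> \forall x \ae leb, T (U f) x = l * U f x + f x) ->
  Mu^-1 <= cmod (m - l).
Proof.
move=> Mu0 LT LU mT TU; have [UL _ _ UM] := LU; have [TL Tlin TS TM] := LT.
pose h k := iter k U (step s0).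
have Lh k : Lploc (h k) by elim: k => [|k ih]; [exact: Lploc_step|exact: UL].
have [B B0 sB] := nbound_compact (Lploc_step s0) (@step_out s0).
have hB k : nbound ((Mu ^+ k) `^ p * B) (h k).
  elim: k => [|k ih]; first by rewrite expr0 powR1 mul1r.
  rewrite exprS powRM ?exprn_ge0 ?(ltW Mu0)// -mulrA.
  exact: (local_operator_nbound LU (Lh k) ih).
have pos k : 0 <= (Mu ^+ k) `^ p * B by rewrite mulr_ge0 ?powR_ge0.
pose K := 2 * (ep^-1 + B).
have bound k : cmod (ell (h k)) <= Mu ^+ k * K.
  have Mk : 0 < Mu ^+ k by rewrite exprn_gt0.
  have neg0 : \forall x \ae leb, x < 0 -> h k x = 0 by apply: aeT; case: (Lh k).
  (* The choice d = Mu^k balances the two terms of [ell_tail]: d^(1 - p)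
     (Mu^k)^p = Mu^k. *)
  have := ell_tail Mk (lexx 0) (pos k) (Lh k) neg0 (hB k).
  rewrite mulr0 expR0 mul1r => /le_trans; apply.
  rewrite [_ `^ (1 - p) * _]mulrA -powRD ?(gt_eqF Mk) ?implybT// subrK powRr1 ?(ltW Mk)//.
  by rewrite /K le_eqVlt; apply/orP; left; apply/eqP; ring.
have step_eq k : (m - l) * ell (h k.+1) = ell (h k).
  rewrite mulrBl -(char_bounded LT mT (Lh k.+1) (pos k.+1) (hB k.+1)).
  rewrite (eq_ell_ae (TL _ (Lh k.+1)) (Lploc_comb l (Lh k.+1) (Lh k)) (TU _ (Lh k))).
  by rewrite (ell_comb l (pos k.+1) (pos k) (Lh _) (Lh _) (hB _) (hB _)) addrAC subrr add0r.
have pow k : (m - l) ^+ k * ell (h k) = ell (step s0).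
  elim: k => [|k ih]; first by rewrite expr0 mul1r.
  by rewrite exprSr -mulrA step_eq.
rewrite leNgt; apply/negP => lt1.
have r1 : `|cmod (m - l) * Mu| < 1.
  by rewrite ger0_norm ?mulr_ge0 ?cmod_ge0 ?(ltW Mu0)// -ltr_pdivlMr// mul1r.
have cv : (cmod (m - l) * Mu) ^+ k * K @[k --> \oo] --> 0 * K.
  by apply: cvgMl; exact: cvg_expr.
have : cmod (ell (step s0)) <= 0.
  rewrite mul0r in cv; rewrite -(cvg_lim _ cv)//; apply: limr_ge; first by apply/cvg_ex; exists 0.
  apply: nearW => k; rewrite -(pow k) cmodM cmodX exprMn -mulrA ler_wpM2l ?exprn_ge0 ?cmod_ge0//.
by rewrite leNgt cmod_gt0// ell_step_neq0.
Qed.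

End ell.

End LocalOperators.

(** * Exponential bounds for a weight *)

Section WeightBounds.
Context {R : realType}.
Variable w : R -> R.
Hypothesis hw : weight w.

Lemma weight_gt0 x : 0 <= x -> 0 < w x.
Proof. by case: hw => _ w0 _; exact: w0. Qed.

Lemma continuous_weight_norm : continuous (fun x : R => w `|x|).
Proof.
move=> x; have [wc _ _] := hw.
have wx : w y @[y --> within Rplus (nbhs `|x|)] --> w `|x|.
  by move/subspace_continuousP : wc; apply; rewrite /Rplus /= in_itv /= normr_ge0.
apply: (@cvg_comp _ _ _ (fun y : R => `|y|) w _ _ _ _ wx).
move=> A /= wA.
have nc : (fun y : R => `|y|) @ x --> `|x| by exact: norm_continuous.
have : \forall y \near x, Rplus `|y| -> A `|y| := nc _ wA.
by apply: filterS => y; apply; rewrite /Rplus /= in_itv /= normr_ge0.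
Qed.

Lemma weight_pointwise_bound t : 0 <= t -> exists n : nat,
  forall x, 0 <= x -> w (x + t) <= n.+1%:R * w x /\ w x <= n.+1%:R * w (x + t).
Proof.
move=> t0; have [_ w0 /(_ _ t0) [inf0 supoo]] := hw.
set A := [set _ | _ in _] in inf0 supoo.
have Aw x : 0 <= x -> A (w (x + t) / w x)%:E.
  by move=> x0; exists x => //; rewrite /Rplus /= in_itv /= x0.
have [B AB] : exists B : R, forall x, 0 <= x -> w (x + t) / w x <= B.
  have sup_fin : ereal_sup A \is a fin_num.
    rewrite fin_numE (lt_eqF supoo) andbT; apply/eqP => s.
    have := ereal_sup_ubound (Aw _ (lexx 0)); rewrite s leeNy_eq //.
  exists (fine (ereal_sup A)) => x x0; rewrite -lee_fin fineK//.
  exact: ereal_sup_ubound (Aw _ x0).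
have [b b0 Ab] : exists2 b : R, 0 < b & forall x, 0 <= x -> b <= w (x + t) / w x.
  have inf_fin : ereal_inf A \is a fin_num.
    rewrite fin_numE (gt_eqF (lt_trans _ inf0)) ?ltNy0//=; apply/eqP => s.
    by have := ereal_inf_lbound (Aw _ (lexx 0)); rewrite s leye_eq.
  exists (fine (ereal_inf A)).
    by rewrite -lte_fin fineK.
  by move=> x x0; rewrite -lee_fin fineK//; exact: ereal_inf_lbound (Aw _ x0).
exists (Num.truncn (Num.max B b^-1)) => x x0.
have wx := weight_gt0 x0; have wxt := weight_gt0 (addr_ge0 x0 t0).
have mB : B <= (Num.truncn (Num.max B b^-1)).+1%:R.
  by apply: (@le_trans _ _ (Num.max B b^-1)); rewrite ?le_max ?lexx// ltW// truncnS_gt.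
have mb : b^-1 <= (Num.truncn (Num.max B b^-1)).+1%:R.
  by apply: (@le_trans _ _ (Num.max B b^-1)); rewrite ?le_max ?lexx ?orbT// ltW// truncnS_gt.
split.
- by rewrite -ler_pdivrMr// (le_trans (AB _ x0)).
- have := Ab _ x0; rewrite ler_pdivlMr// mulrC -ler_pdivlMr// => /le_trans; apply.
  by rewrite mulrC ler_wpM2r// ltW.
Qed.

Let good n := [set t : R | forall x, 0 <= x ->
  w (x + `|t|) <= n.+1%:R * w x /\ w x <= n.+1%:R * w (x + `|t|)].

Let closed_good n : closed (good n).
Proof.
have -> : good n = \bigcap_(x in Rplus)
    ([set t : R | w `|x + `|t| | - n.+1%:R * w x <= 0] `&`
     [set t : R | w x - n.+1%:R * w `|x + `|t| | <= 0]).
  apply/seteqP; split => [t gt x|t gt x x0].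
    rewrite /Rplus /= in_itv /= andbT => x0; have [h1 h2] := gt _ x0.
    by rewrite !subr_le0 [`|x + _|]ger0_norm ?addr_ge0.
  have [|/=] := gt x; first by rewrite /Rplus /= in_itv /= x0.
  by rewrite !subr_le0 [`|x + _|]ger0_norm ?addr_ge0.
have cw x : continuous (fun t : R => w `|x + `|t| |).
  move=> t; apply: (@continuous_comp _ _ _ (fun t : R => x + `|t|) (fun y : R => w `|y|)).
    by apply: cvgD; [exact: cvg_cst|exact: norm_continuous].
  exact: continuous_weight_norm.
apply: closed_bigI => x _; apply: closedI.
- apply: (@closed_comp _ _ (fun t => w `|x + `|t| | - n.+1%:R * w x) [set y | y <= 0]).
    by move=> t _; apply: cvgB; [exact: cw|exact: cvg_cst].
  exact: closed_le.
- apply: (@closed_comp _ _ (fun t => w x - n.+1%:R * w `|x + `|t| |) [set y | y <= 0]).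
    by move=> t _; apply: cvgB; [exact: cvg_cst|apply: cvgM; [exact: cvg_cst|exact: cw]].
  exact: closed_le.
Qed.

Let good_ball : exists n t r, 0 < r /\ ball t r `<=` good n.
Proof.
apply: contrapT => H.
have dO n : open (~` good n) /\ dense (~` good n).
  split; first by rewrite openC; exact: closed_good.
  move=> O [t Ot] oO; apply: contrapT => e.
  have /nbhs_ballP [r r0 rO] : nbhs t O by exact: open_nbhs_nbhs.
  apply: H; exists n, t, r; split => //.
  move=> y /rO Oy; apply: contrapT => ng; apply: e; exists y; split => //.
have [|t [_ tn]] := @Baire R R^o (fun n => ~` good n) dO setT _ openT; first by exists 0.
have [n nP] := weight_pointwise_bound (normr_ge0 t).
by apply: (tn n I) => x x0; exact: nP.
Qed.

(** The hypothesis on a weight bounds the ratios w (x + t) / w x for each t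
    separately. The closed sets of those t for which n + 1 is a bound cover
    the line, so by the theorem of Baire one of them contains an interval;
    differences of elements of this interval give a uniform bound for small
    translations, up to a compact set of x on which continuity suffices. *)
Lemma weight_local_bound : exists2 h : R, 0 < h & exists2 K : R, 1 <= K &
  forall x s, 0 <= x -> 0 <= s <= h -> w (x + s) <= K * w x /\ w x <= K * w (x + s).
Proof.
have [n [t0 [r [r0 rgood]]]] := good_ball.
pose al := `|t0|; pose h := r / 2.
have h0 : 0 < h by rewrite divr_gt0.
have al0 : 0 <= al by exact: normr_ge0.
have shift_good s x : 0 <= s <= h -> 0 <= x ->
    w (x + (al + s)) <= n.+1%:R * w x /\ w x <= n.+1%:R * w (x + (al + s)).
  move=> /andP[s0 sh] x0.
  have hr : h < r by rewrite /h ltr_pdivrMr// ltr_pMr// ltr1n.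
  have [t00|t00] := leP 0 t0.
    have : good n (t0 + s).
      by apply: rgood; rewrite /ball /= opprD addrA subrr sub0r normrN ger0_norm//; exact: le_lt_trans hr.
    by move=> /(_ x x0); rewrite /al !ger0_norm// addr_ge0.
  have : good n (t0 - s).
    by apply: rgood; rewrite /ball /= opprB addrCA subrr addr0 ger0_norm//; exact: le_lt_trans hr.
  move=> /(_ x x0); rewrite /al (ltr0_norm t00).
  by rewrite ler0_norm ?opprB ?[s - t0]addrC// subr_le0 (le_trans (ltW t00)).
have n1 : 1 <= n.+1%:R :> R by rewrite ler1n.
have cw : {within `[0, al + h], continuous (fun x => w `|x|)}.
  by apply: continuous_subspaceT => x; exact: continuous_weight_norm.
have alh : 0 <= al + h by rewrite addr_ge0// ltW.
have [xM xMI xMP] := EVT_max alh cw.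
have [xm xmI xmP] := EVT_min alh cw.
have wm : 0 < w `|xm| by apply: weight_gt0; exact: normr_ge0.
pose K : R := Num.max (n.+1%:R ^+ 2) (w `|xM| / w `|xm|).
exists h => //; exists K.
  by rewrite /K le_max exprn_ege1.
move=> x s x0 /[dup] sI /andP[s0 sh].
have xs0 : 0 <= x + s by rewrite addr_ge0.
(* For x <= al both points lie in a compact interval. For x > al, they are
   the translates of x - al by al and by al + s. *)
have [xal|alx] := leP x al.
  have KR : w `|xM| / w `|xm| <= K by rewrite /K le_max lexx orbT.
  have i1 : x \in `[0, al + h] by rewrite in_itv /= x0 (le_trans xal)// lerDl ltW.
  have i2 : x + s \in `[0, al + h] by rewrite in_itv /= xs0 lerD.
  have := xMP _ i1; have := xMP _ i2; have := xmP _ i1; have := xmP _ i2.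
  rewrite !(ger0_norm x0) !(ger0_norm xs0) => m2 m1 M2 M1.
  have aux u v : u <= w `|xM| -> w `|xm| <= v -> u <= K * v.
    move=> uM mv; rewrite (le_trans uM)//.
    have v0 : 0 < v := lt_le_trans wm mv.
    rewrite (@le_trans _ _ (w `|xM| / w `|xm| * v))//; last by rewrite ler_wpM2r// ltW.
    rewrite mulrAC ler_pdivlMr// ler_wpM2l// ltW// weight_gt0//; exact: normr_ge0.
  by split; exact: aux.
have y0 : 0 <= x - al by rewrite subr_ge0 ltW.
have [g1 g2] := shift_good s (x - al) sI y0.
have [g3 g4] : w (x - al + (al + 0)) <= n.+1%:R * w (x - al) /\
    w (x - al) <= n.+1%:R * w (x - al + (al + 0)).
  by apply: shift_good => //; rewrite lexx ltW.
move: g1 g2 g3 g4; rewrite addr0 subrK addrA subrK => g1 g2 g3 g4.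
have KR : n.+1%:R * n.+1%:R <= K by rewrite /K le_max -expr2 lexx.
have n0 : 0 <= n.+1%:R :> R by [].
split.
- apply: (le_trans g1); apply: (le_trans (ler_wpM2l n0 g4)).
  by rewrite mulrA ler_wpM2r// ltW// weight_gt0.
- apply: (le_trans g3); apply: (le_trans (ler_wpM2l n0 g2)).
  by rewrite mulrA ler_wpM2r// ltW// weight_gt0.
Qed.

(** Iterating the uniform bound for small translations. *)
Lemma weight_exp_bound : exists2 c : R, 0 <= c & forall x t, 0 <= x -> 0 <= t ->
  w (x + t) <= expR (c * (t + 1)) * w x /\ w x <= expR (c * (t + 1)) * w (x + t).
Proof.
have [h h0 [K K1 hK]] := weight_local_bound.
have K0 : 0 < K := lt_le_trans ltr01 K1.
have iter_bound k x s : 0 <= x -> 0 <= s <= h ->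
    w (x + (k%:R * h + s)) <= K ^+ k.+1 * w x /\ w x <= K ^+ k.+1 * w (x + (k%:R * h + s)).
  move=> x0 sI; have /andP[s0 sh] := sI.
  elim: k => [|k [ih1 ih2]]; first by rewrite mul0r add0r expr1; exact: hK.
  have y0 : 0 <= x + (k%:R * h + s) by rewrite addr_ge0// addr_ge0// mulr_ge0// ltW.
  have hI : 0 <= h <= h by rewrite lexx ltW.
  have [h1 h2] := hK _ _ y0 hI.
  rewrite (_ : x + (k.+1%:R * h + s) = x + (k%:R * h + s) + h); last by rewrite -natr1; ring.
  split.
  - by apply: (le_trans h1); rewrite exprS -mulrA ler_wpM2l// ltW.
  - apply: (le_trans ih2); rewrite [K ^+ k.+2]exprSr -mulrA.
    by apply: ler_wpM2l => //; rewrite exprn_ge0// ltW.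
have lnK0 : 0 <= ln K by rewrite ln_ge0.
exists (ln K * (h^-1 + 1)); first by rewrite mulr_ge0// addr_ge0// invr_ge0 ltW.
move=> x t x0 t0; pose k := Num.truncn (t / h).
have th0 : 0 <= t / h by rewrite divr_ge0// ltW.
have /andP[k1 k2] := truncn_itv th0.
have sI : 0 <= t - k%:R * h <= h.
  rewrite subr_ge0 -ler_pdivlMr// k1 /= lerBlDl.
  by move: k2; rewrite ltr_pdivrMr// -natr1 mulrDl mul1r => /ltW.
have [i1 i2] := iter_bound k x _ x0 sI.
move: i1 i2; rewrite addrC [k%:R * h + _]addrC subrK [t + x]addrC => i1 i2.
have KE : K ^+ k.+1 <= expR (ln K * (h^-1 + 1) * (t + 1)).
  rewrite -[leLHS]lnK ?posrE ?exprn_gt0// lnXn// ler_expR -mulr_natr -mulrA.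
  apply: ler_wpM2l => //; rewrite -natr1 mulrDl mulrDr mulr1 mul1r -addrA lerD//.
    by rewrite mulrC.
  by rewrite addrA lerDr addr_ge0// invr_ge0 ltW.
by split; [apply: (le_trans i1)|apply: (le_trans i2)]; rewrite ler_wpM2r// ltW// weight_gt0// addr_ge0.
Qed.

End WeightBounds.

(** * The weighted space in terms of energies *)

Section WeightedSpaceEnergy.
Context {R : realType}.
Local Notation C := R[i].
Local Notation leb := (@lebesgue_measure R).
Variables (p : R) (w : R -> R).
Hypothesis hp : 1 <= p.
Hypothesis hw : weight w.
Implicit Types (f g h : R -> C) (T U : (R -> C) -> (R -> C)).

Let p0 : 0 < p. Proof. exact: lt_le_trans ltr01 hp. Qed.

Definition cut f : R -> C := fun x => if 0 <= x then f x else 0.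

(** Zero on the negative axis, where the weight has no meaning, so that all
    integrals can be taken over the whole line. *)
Definition wt (x : R) : R := if 0 <= x then w x `^ p else 0.

Lemma density_wt : density wt.
Proof.
split; last by move=> x; rewrite /wt; case: ifP => // _; exact: powR_ge0.
rewrite (_ : wt = fun x => if 0 <= x then w `|x| `^ p else 0); last first.
  by apply/funext => x; rewrite /wt; case: leP => // x0; rewrite ger0_norm.
apply: measurable_fun_ifT => //; first exact: measurable_geb.
apply: (measurableT_comp (f := fun y : R => y `^ p)); first exact: measurable_powR.
by apply: continuous_measurable_fun; exact: continuous_weight_norm.
Qed.

Lemma RplusE : Rplus = [set x : R | 0 <= x].
Proof. by apply/seteqP; split => x; rewrite /Rplus /= in_itv /= andbT. Qed.

Lemma cut_id f x : 0 <= x -> cut f x = f x.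
Proof. by rewrite /cut => ->. Qed.

Lemma cut_lt0 f x : x < 0 -> cut f x = 0.
Proof. by rewrite /cut leNgt => ->. Qed.

Lemma cut_cut f : cut (cut f) = cut f.
Proof. by apply/funext => x; rewrite /cut; case: (0 <= x). Qed.

Lemma cut_measurable f : cmeasurable Rplus f <-> cmeasurable setT (cut f).
Proof.
rewrite RplusE; split => [mf|mf].
  by apply: cmeas_restrict => //; exact: measurable_geb.
have mR : measurable [set x : R | 0 <= x] by rewrite -RplusE; exact: measurable_itv.
have [m1 m2] := cmeasS measurableT (@subsetT _ [set x : R | 0 <= x]) mf.
split.
- by apply: eq_measurable_fun m1 => x; rewrite inE /= => x0; rewrite cut_id.
- by apply: eq_measurable_fun m2 => x; rewrite inE /= => x0; rewrite cut_id.
Qed.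

Definition energy f : \bar R := pint p wt (cut f).

Lemma energy_ge0 f : (0 <= energy f)%E.
Proof. exact: pint_ge0 density_wt. Qed.

Lemma EnormE f : Enorm p w f = (energy f `^ p^-1)%E.
Proof.
rewrite /Enorm /wnorm /energy pintE integral_mkcond; congr (_ `^ _)%E.
apply: eq_integral => x _; rewrite patchE RplusE /wt /cut; have [x0|x0] := leP 0 x; first by rewrite mem_set.
by rewrite memNset ?mulr0 //= leNgt x0.
Qed.

Lemma poweR_inv_lty (x : \bar R) : (x `^ p^-1 < +oo)%E <-> (x < +oo)%E.
Proof.
by split; [apply: lty_poweRy; rewrite invr_eq0 gt_eqF|exact: poweR_lty].
Qed.

Lemma E_P f : E p w f <-> cmeasurable setT (cut f) /\ (energy f < +oo)%E.
Proof.
have := EnormE f; rewrite /Enorm => e.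
rewrite /E /wLp /= e; split => -[mf fi]; split.
- exact/cut_measurable.
- exact/poweR_inv_lty.
- exact/cut_measurable.
- exact/poweR_inv_lty.
Qed.

Lemma energy_fin f : E p w f -> energy f \is a fin_num.
Proof. by move=> /E_P[_]; rewrite ge0_fin_numE// energy_ge0. Qed.

Lemma powR_invK (r : R) : 0 <= r -> (r `^ p^-1) `^ p = r.
Proof. by move=> r0; rewrite -powRrM mulVf ?gt_eqF// powRr1. Qed.

Lemma powR_Kinv (r : R) : 0 <= r -> (r `^ p) `^ p^-1 = r.
Proof. by move=> r0; rewrite -powRrM mulfV ?gt_eqF// powRr1. Qed.

Lemma Enorm_energy f g (M : R) : 0 <= M -> E p w f ->
  (Enorm p w g <= M%:E * Enorm p w f)%E <-> (energy g <= (M `^ p)%:E * energy f)%E.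
Proof.
move=> M0 /energy_fin; rewrite !EnormE; have := energy_ge0 f; have := energy_ge0 g.
case: (energy f) => [r| |]//; case: (energy g) => [s| |]// s0 r0 _; last first.
  by rewrite poweRyr ?invr_eq0 ?gt_eqF// !leye_eq.
rewrite !poweR_EFin -!EFinM !lee_fin in s0 r0 *; split => h.
- rewrite -(powR_invK s0) -(powR_invK r0) -powRM ?powR_ge0//.
  by rewrite ge0_ler_powR ?nnegrE ?mulr_ge0 ?powR_ge0// ltW.
- rewrite -(powR_Kinv M0) -powRM ?powR_ge0//.
  by rewrite ge0_ler_powR ?nnegrE ?mulr_ge0 ?powR_ge0 ?invr_ge0// ltW.
Qed.

Lemma EeqP f g : Eeq f g <-> \forall x \ae leb, cut f x = cut g x.
Proof.
split; apply: aeS => x.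
- by move=> h; rewrite /cut; case: ifP => // x0; apply: h; rewrite RplusE.
- by move=> h; rewrite RplusE /= => x0; move: h; rewrite !cut_id.
Qed.

Lemma Eeq_refl f : Eeq f f.
Proof. by apply/EeqP; exact: aeT. Qed.

Lemma Eeq_sym f g : Eeq f g -> Eeq g f.
Proof. by move=> /EeqP fg; apply/EeqP; apply: aeS fg. Qed.

Lemma Eeq_trans f g h : Eeq f g -> Eeq g h -> Eeq f h.
Proof.
by move=> /EeqP fg /EeqP gh; apply/EeqP; apply: aeS (aeI fg gh) => x [-> ->].
Qed.

Lemma energy0_Eeq f : cmeasurable setT (cut f) -> energy f = 0%E -> Eeq f (fun=> 0).
Proof.
move=> mf f0; apply/EeqP; apply: aeS (pint0_ae density_wt mf f0) => x h.
rewrite [RHS]/cut if_same; have [x0|x0] := ltP x 0; first by rewrite cut_lt0.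
by apply: h; rewrite /wt x0 gt_eqF// powR_gt0// weight_gt0.
Qed.

Lemma Eeq_energy f g : cmeasurable setT (cut f) -> cmeasurable setT (cut g) ->
  Eeq f g -> energy f = energy g.
Proof. by move=> mf mg /EeqP fg; apply: eq_pint_ae => //; exact: density_wt. Qed.

Lemma cutD c f g : cut (fun x => c * f x + g x) = (fun x => c * cut f x + cut g x).
Proof. by apply/funext => x; rewrite /cut; case: ifP => //; rewrite mulr0 addr0. Qed.

Lemma E_comb c f g : E p w f -> E p w g -> E p w (fun x => c * f x + g x).
Proof.
move=> /E_P[mf fi] /E_P[mg gi]; apply/E_P; rewrite /energy cutD.
have mcf : cmeasurable setT (fun x => c * cut f x) by apply: cmeasM => //; exact: cmeas_cst.
split; first exact: cmeasD.
by apply: (pintD_lty hp density_wt mcf mg _ gi); apply: pintZ_lty => //; exact: density_wt.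
Qed.

Lemma E0 : E p w (fun=> 0).
Proof.
apply/E_P; rewrite /energy (_ : cut _ = fun=> 0); last first.
  by apply/funext => x; rewrite /cut if_same.
by rewrite pint0//; split => //; exact: cmeas_cst.
Qed.

Lemma EB f g : E p w f -> E p w g -> E p w (fun x => f x - g x).
Proof.
by move=> Ef Eg; have := E_comb (-1) Eg Ef; under eq_fun do rewrite mulN1r addrC.
Qed.

(** The constant is taken positive, so that its inverse can appear in
    estimates of the resolvent. *)
Lemma bounded_energy T : bounded_operator p w T -> exists2 M : R, 0 < M &
  forall f, E p w f -> (energy (T f) <= (M `^ p)%:E * energy f)%E.
Proof.
move=> [_ _ [M TM]]; pose M' := Num.max M 1.
have M'0 : 0 < M' by rewrite lt_max ltr01 orbT.
exists M' => // f Ef; apply/(Enorm_energy _ (ltW M'0) Ef); apply: (le_trans (TM _ Ef)).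
by rewrite lee_wpmul2r ?lee_fin ?le_max ?lexx// EnormE poweR_ge0.
Qed.

Lemma bounded_operatorP T (M : R) : 0 <= M ->
  (forall f, E p w f -> cmeasurable setT (cut (T f))) ->
  (forall c f g, E p w f -> E p w g -> Eeq (T (fun x => c * f x + g x)) (fun x => c * T f x + T g x)) ->
  (forall f, E p w f -> (energy (T f) <= (M `^ p)%:E * energy f)%E) ->
  bounded_operator p w T.
Proof.
move=> M0 mT linT TM; split; [|exact: linT|].
- move=> f Ef; apply/E_P; split; first exact: mT.
  apply: (le_lt_trans (TM _ Ef)); apply: EFin_mul_lty; first exact: powR_ge0.
  by have /E_P[] := Ef.
- by exists M => f Ef; apply/(Enorm_energy _ M0 Ef); exact: TM.
Qed.

(** The difference f - g has energy zero, and so has its image. *)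
Lemma bounded_Eeq T f g : bounded_operator p w T -> E p w f -> E p w g -> Eeq f g ->
  Eeq (T f) (T g).
Proof.
move=> bT Ef Eg fg; have [M M0 TM] := bounded_energy bT; have [ET linT _] := bT.
have Efg := EB Ef Eg.
have z : energy (fun x => f x - g x) = 0%E.
  have /E_P[m _] := Efg.
  rewrite (@Eeq_energy _ (fun=> 0))//; first by rewrite /energy (_ : cut _ = fun=> 0) ?pint0//; apply/funext => x; rewrite /cut if_same.
  - by have /E_P[] := E0.
  - move/EeqP : fg => fg; apply/EeqP; apply: aeS fg => x; rewrite /cut; case: ifP => // _ ->.
    by rewrite subrr.
have Tz : Eeq (T (fun x => f x - g x)) (fun=> 0).
  have /E_P[m _] := ET _ Efg.
  apply: energy0_Eeq => //; apply/eqP; rewrite eq_le energy_ge0 andbT.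
  by have := TM _ Efg; rewrite z mule0.
have := linT 1 _ _ Efg Eg.
rewrite (_ : (fun x => 1 * (f x - g x) + g x) = f); last first.
  by apply/funext => x; rewrite mul1r subrK.
move=> /EeqP l; move/EeqP : Tz => Tz; apply/EeqP; apply: aeS (aeI l Tz) => x [-> h].
by move: h; rewrite /cut; case: ifP => // _ ->; rewrite mulr0 add0r.
Qed.

End WeightedSpaceEnergy.

(** * Growth exponents *)

Section Fekete.
Context {R : realType}.
Variables (phi : R -> R) (c : R).
Hypothesis phi_sub : forall s t, 0 <= s -> 0 <= t -> phi (s + t) <= phi s + phi t.
Hypothesis phi_bd : forall t, 0 <= t -> `|phi t| <= c * (t + 1).

Let c0 : 0 <= c.
Proof. by have := phi_bd (lexx 0); rewrite add0r mulr1; apply: le_trans. Qed.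

Lemma subadditive_iter n t : 0 <= t -> phi (n.+1%:R * t) <= n.+1%:R * phi t.
Proof.
move=> t0; elim: n => [|n ih]; first by rewrite !mul1r.
rewrite -natr1 !mulrDl !mul1r (le_trans (phi_sub _ _))// ?mulr_ge0// lerD2r//.
Qed.

(** A subadditive function behaves linearly at infinity. The limit is the
    infimum of phi t / t over t >= 1, so it also bounds phi t / t from below
    for every t > 0; the linear bound on phi takes care of the remainder of
    the division of t by a fixed period. *)
Lemma fekete : exists L, (forall t, 0 < t -> L * t <= phi t) /\
  (t^-1 * phi t @[t --> +oo%R] --> L).
Proof.
pose A := [set phi t / t | t in [set t | 1 <= t]].
have A0 : A !=set0 by exists (phi 1 / 1); exists 1 => //=.
have lbA : lbound A (- (2 * c)).
  move=> _ [t /= t1 <-]; have t0 : 0 < t := lt_le_trans ltr01 t1.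
  rewrite ler_pdivlMr// mulNr lerNl (le_trans (ler_norm _))// normrN (le_trans (phi_bd (ltW t0)))//.
  by rewrite -mulrA mulrCA ler_wpM2l//; lra.
have hA : has_inf A by split => //; exists (- (2 * c)).
pose L := inf A.
have L1 t : 1 <= t -> L * t <= phi t.
  move=> t1; have t0 : 0 < t := lt_le_trans ltr01 t1.
  by rewrite -ler_pdivlMr//; apply: ge_inf; [case: hA|exists t].
exists L; split.
  move=> t t0; pose n := Num.truncn t^-1.
  have tn : 1 <= n.+1%:R * t by rewrite -ler_pdivrMr// mul1r ltW// truncnS_gt.
  have := le_trans (L1 _ tn) (subadditive_iter n (ltW t0)).
  by rewrite mulrCA ler_pM2l.
apply/cvgrPdist_le => e e0.
have [_ [t0 /= t01 <-] ht0] := inf_adherent (divr_gt0 e0 (ltr0Sn R 1)) hA.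
have t00 : 0 < t0 := lt_le_trans ltr01 t01.
pose q := phi t0 / t0; pose B := `|q| * t0 + c * (t0 + 1).
have B0 : 0 <= B by rewrite addr_ge0 ?mulr_ge0// ?(ltW t00)//; lra.
near=> t.
have t1 : 1 <= t by near: t; apply: nbhs_pinfty_ge; exact: num_real.
have tpos : 0 < t := lt_le_trans ltr01 t1.
have tt0 : t0 <= t by near: t; apply: nbhs_pinfty_ge; exact: num_real.
have eBt : (e / 2)^-1 * B <= t by near: t; apply: nbhs_pinfty_ge; exact: num_real.
have Bt' : B <= e / 2 * t by rewrite -ler_pdivrMl// divr_gt0.
have lo : L <= t^-1 * phi t by rewrite mulrC ler_pdivlMr// L1.
rewrite ler0_norm ?subr_le0// opprB lerBlDr.
have th0 : 0 <= t / t0 by rewrite divr_ge0 ?ltW.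
pose n := Num.truncn (t / t0).
have /andP[n1 n2] := truncn_itv th0.
pose r := t - n%:R * t0.
have r0 : 0 <= r by rewrite subr_ge0 -ler_pdivlMr.
have rt0 : r <= t0.
  by rewrite lerBlDl; move: n2; rewrite ltr_pdivrMr// -natr1 mulrDl mul1r => /ltW.
have n_gt0 : (0 < n)%N.
  by rewrite -(ltr0n R) (lt_le_trans _ (_ : 1 <= _))// ler1n lt0n; apply/eqP => n0; move: n2; rewrite -/n n0 ltr_pdivrMr// mul1r ltNge tt0.
(* Write t = n t0 + r with 0 <= r <= t0, where t0 nearly attains the
   infimum. *)
have phit : phi t <= n%:R * phi t0 + c * (t0 + 1).
  have -> : phi t = phi (n.-1.+1%:R * t0 + r) by rewrite prednK// /r addrC subrK.
  rewrite (le_trans (phi_sub _ r0)) ?mulr_ge0 ?(ltW t00)// lerD//.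
    by rewrite (le_trans (subadditive_iter _ (ltW t00)))// prednK.
  rewrite (le_trans (ler_norm _))// (le_trans (phi_bd r0))// ler_wpM2l// lerD2r//.
rewrite mulrC ler_pdivrMr//; apply: (le_trans phit).
have qE : phi t0 = q * t0 by rewrite /q divfK// gt_eqF.
have -> : n%:R * phi t0 = q * t - q * r by rewrite qE /r; ring.
have qr : - (q * r) <= `|q| * t0.
  rewrite -mulNr (le_trans (ler_norm _))// normrM normrN (ger0_norm r0) ler_wpM2l//.
have qL : q * t <= (L + e / 2) * t by rewrite ler_wpM2r ?(ltW tpos)// ltW.
have -> : (e + L) * t = (L + e / 2) * t + e / 2 * t by rewrite -mulrDl -addrA -splitr addrC.
rewrite -addrA lerD// (le_trans _ Bt')// /B lerD2r//.
Unshelve. all: by end_near. Qed.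

End Fekete.

Section OperatorNorm.
Context {R : realType}.
Local Notation C := R[i].
Local Notation leb := (@lebesgue_measure R).
Variables (p : R) (w : R -> R).
Hypothesis hp : 1 <= p.
Hypothesis hw : weight w.
Implicit Types (f g h : R -> C) (T : (R -> C) -> (R -> C)).

Let p0 : 0 < p. Proof. exact: lt_le_trans ltr01 hp. Qed.

Lemma EnormZ (c : C) f : E p w f ->
  Enorm p w (fun x => c * f x) = ((cmod c)%:E * Enorm p w f)%E.
Proof.
move=> Ef; have /(E_P w hp) [mf fi] := Ef.
rewrite !EnormE /energy (_ : cut _ = fun x => c * cut f x); last first.
  by apply/funext => x; rewrite /cut; case: ifP => //; rewrite mulr0.
rewrite pintZ//; last exact: density_wt.
rewrite poweRM ?lee_fin ?powR_ge0//; last exact: energy_ge0.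
by rewrite poweR_EFin powR_Kinv// cmod_ge0.
Qed.

Lemma EZ (c : C) f : E p w f -> E p w (fun x => c * f x).
Proof.
move=> Ef; have := E_comb hp hw c Ef (E0 w hp).
by congr (E p w); apply/funext => x; rewrite addr0.
Qed.

Lemma Enorm_fin f : E p w f -> exists2 r : R, 0 <= r & Enorm p w f = r%:E.
Proof.
move=> /(E_P w hp) [_ fi]; have := EnormE p w f.
have := energy_ge0 p hw f; case: (energy p w f) fi => [r| |]// _ r0 ->.
by exists (r `^ p^-1); rewrite ?powR_ge0// poweR_EFin.
Qed.

(** The operator norm is a supremum in the extended reals, read as a real
    number; it has its usual meaning as soon as some bound is finite. *)
Lemma opnormP T (M : R) : 0 <= M ->
  (forall f, E p w f -> E p w (T f)) ->
  (forall c f, T (fun x => c * f x) = (fun x => c * T f x)) ->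
  (forall f, E p w f -> (Enorm p w (T f) <= M%:E * Enorm p w f)%E) ->
  [/\ 0 <= opnorm p w T, opnorm p w T <= M &
   forall f, E p w f -> (Enorm p w (T f) <= (opnorm p w T)%:E * Enorm p w f)%E].
Proof.
move=> M0 ET TZ TM; rewrite /opnorm; set S := [set _ | _ in _].
have SM : (ereal_sup S <= M%:E)%E.
  apply: ge_ereal_sup => _ [f [/TM fM f1] <-]; apply: (le_trans fM).
  by rewrite -[leRHS]mule1 lee_wpmul2l ?lee_fin.
have S0 : (0 <= ereal_sup S)%E.
  apply: (@le_trans _ _ (Enorm p w (T (fun=> 0)))); last first.
    apply: ereal_sup_ubound; exists (fun=> 0) => //; split; first exact: E0.
    rewrite EnormE /energy (_ : cut _ = fun=> 0); last first.
      by apply/funext => x; rewrite /cut if_same.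
    by rewrite pint0// poweR0r ?lee_fin ?ler01// invr_eq0 gt_eqF.
  by rewrite EnormE poweR_ge0.
have Sfin : ereal_sup S \is a fin_num.
  by rewrite ge0_fin_numE// (le_lt_trans SM)// ltry.
split; first by rewrite fine_ge0.
  by rewrite -lee_fin fineK.
move=> f Ef; rewrite fineK//; have [r r0 fr] := Enorm_fin Ef.
have [r_eq0|rn0] := eqVneq r 0.
  by have := TM _ Ef; rewrite fr r_eq0 !mule0.
have rpos : 0 < r by rewrite lt_neqAle eq_sym rn0.
pose g x := (r^-1)%:C * f x.
have Eg : E p w g by exact: EZ.
have := EnormZ (r^-1)%:C Ef; rewrite cmodR ger0_norm ?invr_ge0// fr -EFinM mulVf// => n1.
have : (Enorm p w (T g) <= ereal_sup S)%E.
  by apply: ereal_sup_ubound; exists g => //; split => //; rewrite n1.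
rewrite /g TZ EnormZ; last exact: ET.
rewrite cmodR ger0_norm ?invr_ge0//; have [s s0 ->] := Enorm_fin (ET _ Ef).
rewrite -(fineK Sfin) -!EFinM !lee_fin => h.
by rewrite -ler_pdivrMr// mulrC.
Qed.

End OperatorNorm.

Section Growth.
#[local] Opaque opnorm Enorm.
Context {R : realType}.
Local Notation C := R[i].
Variables (p : R) (w : R -> R).
Hypothesis hp : 1 <= p.
Hypothesis hw : weight w.
Implicit Types (f g h : R -> C).

Let p0 : 0 < p. Proof. exact: lt_le_trans ltr01 hp. Qed.

Variables (V : R -> (R -> C) -> (R -> C)) (c : R).
Hypothesis VE : forall t f, 0 <= t -> E p w f -> E p w (V t f).
Hypothesis VZ : forall t a f, V t (fun x => a * f x) = (fun x => a * V t f x).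
Hypothesis VD : forall s t f, 0 <= s -> 0 <= t -> V (s + t) f = V s (V t f).
Hypothesis V_hi : forall t f, 0 <= t -> E p w f ->
  (energy p w (V t f) <= (expR (c * (t + 1)) `^ p)%:E * energy p w f)%E.
Hypothesis V_lo : forall t, 0 <= t -> exists f, [/\ E p w f, (0 < energy p w f)%E &
  (energy p w f <= (expR (c * (t + 1)) `^ p)%:E * energy p w (V t f))%E].

Let N t := opnorm p w (V t).

Let NP t : 0 <= t -> [/\ 0 <= N t, N t <= expR (c * (t + 1)) &
   forall f, E p w f -> (Enorm p w (V t f) <= (N t)%:E * Enorm p w f)%E].
Proof.
move=> t0; apply: opnormP; [exact: hp|exact: hw|exact: expR_ge0| | |].
- by move=> f; exact: VE.
- by move=> a f; exact: VZ.
- by move=> f Ef; apply/(Enorm_energy hp hw); rewrite ?expR_ge0//; exact: V_hi.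
Qed.

Let N_lo t : 0 <= t -> expR (- (c * (t + 1))) <= N t.
Proof.
move=> t0; have [N0 _ NV] := NP t0; have [f [Ef ef fV]] := V_lo t0.
have EVf := VE t0 Ef.
have h1 : (Enorm p w f <= (expR (c * (t + 1)))%:E * Enorm p w (V t f))%E.
  by apply/(Enorm_energy hp hw) => //; exact: expR_ge0.
have h2 := NV _ Ef.
have [r r0 fr] := Enorm_fin hp hw Ef.
have [s s0 fs] := Enorm_fin hp hw EVf.
have rpos : 0 < r.
  rewrite lt_neqAle r0 andbT eq_sym; apply/eqP => re.
  have := EnormE p w f; rewrite fr re => /esym/eqP.
  rewrite poweR_eq0 ?energy_ge0// => /andP[/eqP e0 _].
  by move: ef; rewrite e0 ltxx.
move: h1 h2; rewrite fr fs -!EFinM !lee_fin => h1 h2.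
have K0 : 0 < expR (c * (t + 1)) by exact: expR_gt0.
have : r <= expR (c * (t + 1)) * (N t * r) by apply: (le_trans h1); rewrite ler_pM2l.
by rewrite mulrA -[leLHS]mul1r ler_pM2r// expRN -ler_pdivrMl// mulr1.
Qed.

Let N_gt0 t : 0 <= t -> 0 < N t.
Proof. by move=> /N_lo; apply: lt_le_trans; exact: expR_gt0. Qed.

Let N_sub s t : 0 <= s -> 0 <= t -> N (s + t) <= N s * N t.
Proof.
move=> s0 t0; have [Ns0 _ Ns] := NP s0; have [Nt0 _ Nt] := NP t0.
have [| | | |_ h _] := @opnormP R p w hp hw (V (s + t)) (N s * N t); last exact: h.
- by apply: mulr_ge0; [exact: Ns0|exact: Nt0].
- by move=> f; apply: VE; exact: addr_ge0.
- by move=> a f; exact: VZ.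
- move=> f Ef; rewrite VD//; apply: (le_trans (Ns _ (VE t0 Ef))).
  rewrite [(N s * N t)%:E]EFinM.
  rewrite -muleA.
  apply: lee_wpmul2l.
    rewrite lee_fin.
    exact: Ns0.
  exact: (Nt _ Ef).
Qed.

Let phi t := ln (N t).

(** The logarithms of the norms of a semigroup are subadditive. The lower
    bound on each norm keeps them finite. *)
Lemma growth_cvg : exists L, [/\ growth p w V = L, (forall t, 0 < t -> L * t <= phi t) &
  (t^-1 * phi t @[t --> +oo%R] --> L)].
Proof.
have psub s t : 0 <= s -> 0 <= t -> phi (s + t) <= phi s + phi t.
  move=> s0 t0; rewrite /phi -lnM ?posrE ?N_gt0//.
  by rewrite ler_ln ?posrE ?mulr_gt0 ?N_gt0 ?addr_ge0// N_sub.
have pbd t : 0 <= t -> `|phi t| <= c * (t + 1).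
  move=> t0; have [_ Nhi _] := NP t0; have Nt0 := N_gt0 t0.
  rewrite ler_norml /phi; apply/andP; split.
    by rewrite -[leLHS]expRK ler_ln ?posrE ?expR_gt0//; exact: N_lo.
  by rewrite -[leRHS]expRK ler_ln ?posrE ?expR_gt0.
have [L [L1 L2]] := fekete psub pbd; exists L; split => //.
rewrite /growth; apply: cvg_lim => //.
by under eq_fun do rewrite ln_powR.
Qed.

(** For large t the norm is at most e^(rt), because r exceeds the limit; for
    small t it is bounded. *)
Lemma growth_upper r : growth p w V < r -> exists2 K : R, 0 < K & forall t f,
  0 <= t -> E p w f ->
  (energy p w (V t f) <= ((K * expR (r * t)) `^ p)%:E * energy p w f)%E.
Proof.
have [L [-> _ Lc]] := growth_cvg => Lr.
have [T0 [T00 hT]] : exists T0 : R, 0 <= T0 /\ forall t, T0 < t -> t^-1 * phi t < r.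
  have := cvgr_lt _ Lc _ Lr.
  move=> [M [_ MP]]; exists (Num.max 0 M); split; first by rewrite le_max lexx.
  by move=> t; rewrite gt_max => /andP[_ Mt]; exact: MP.
have cT0 : 0 <= `|c| * (T0 + 1) + `|r| * T0 by rewrite addr_ge0// mulr_ge0//; lra.
exists (expR (`|c| * (T0 + 1) + `|r| * T0)); first exact: expR_gt0.
move=> t f t0 Ef; have [_ Nhi NV] := NP t0.
have K0 : 0 <= expR (`|c| * (T0 + 1) + `|r| * T0) * expR (r * t) by rewrite mulr_ge0 ?expR_ge0.
apply/(Enorm_energy hp hw) => //; apply: (le_trans (NV _ Ef)).
rewrite lee_wpmul2r ?EnormE ?poweR_ge0// lee_fin.
have [tT|Tt] := leP t T0.
  apply: (le_trans Nhi); rewrite -expRD ler_expR.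
  have h1 : c * (t + 1) <= `|c| * (T0 + 1).
    apply: (@le_trans _ _ (`|c| * (t + 1))); first by rewrite ler_wpM2r ?ler_norm//; lra.
    by rewrite ler_wpM2l// lerD2r.
  have : - (r * t) <= `|r| * T0.
    by rewrite -mulNr (le_trans (ler_norm _))// normrM normrN (ger0_norm t0) ler_wpM2l.
  by move=> h2; lra.
have tpos : 0 < t := le_lt_trans T00 Tt.
have := hT _ Tt; rewrite mulrC ltr_pdivrMr// => h.
rewrite -[N t]lnK ?posrE ?N_gt0// -expRD ler_expR (le_trans (ltW h))// lerDr//.
Qed.

(** By subadditivity e^(growth t) is at most the norm of V t, for every t; a
    constant K cannot make up for a larger exponent as t grows. *)
Lemma growth_le r (K : R) : 0 < K ->
  (forall t f, 0 <= t -> E p w f ->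
     (energy p w (V t f) <= ((K * expR (r * t)) `^ p)%:E * energy p w f)%E) ->
  growth p w V <= r.
Proof.
move=> K0 VK; have [L [-> L1 _]] := growth_cvg.
have NK t : 0 < t -> L * t <= ln K + r * t.
  move=> t0; apply: (le_trans (L1 _ t0)).
  have Kt : 0 < K * expR (r * t) by rewrite mulr_gt0 ?expR_gt0.
  have -> : ln K + r * t = ln (K * expR (r * t)) by rewrite lnM ?posrE ?expR_gt0// expRK.
  rewrite ler_ln ?posrE //; last exact: N_gt0 (ltW t0).
  have [| | | |_ h _] := @opnormP R p w hp hw (V t) (K * expR (r * t)); last exact: h.
  - exact: ltW.
  - by move=> f; apply: VE; exact: ltW.
  - by move=> a f; exact: VZ.
  - by move=> f Ef; apply/(Enorm_energy hp hw _ (ltW Kt) Ef); exact: VK (ltW t0) Ef.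
rewrite leNgt; apply/negP => rL.
have d0 : 0 < L - r by rewrite subr_gt0.
pose t := (`|ln K| + 1) / (L - r).
have t0 : 0 < t by rewrite divr_gt0// ltr_wpDl.
have := NK _ t0; rewrite -lerBlDr -mulrBl /t mulrC divfK ?gt_eqF// leNgt.
by rewrite (le_lt_trans (ler_norm _))// ltrDl.
Qed.

End Growth.

(** * The two shifts and the growth of the weight *)

Section Shifts.
Context {R : realType}.
Local Notation C := R[i].
Local Notation leb := (@lebesgue_measure R).
Variables (p : R) (w : R -> R).
Hypothesis hp : 1 <= p.
Hypothesis hw : weight w.
Implicit Types (f g h : R -> C) (T : (R -> C) -> (R -> C)).
#[local] Opaque opnorm Enorm.

Let p0 : 0 < p. Proof. exact: lt_le_trans ltr01 hp. Qed.

Lemma cut_right t f : 0 <= t -> cut (right_shift t f) = fun x => cut f (x - t).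
Proof.
move=> t0; apply/funext => x; rewrite /cut /right_shift subr_ge0.
by case: ifP => // x0; case: ifP => // tx; move: x0; rewrite (le_trans t0 tx).
Qed.

Lemma cut_left t f : 0 <= t -> cut (left_shift t f) = fun x => if 0 <= x then cut f (x + t) else 0.
Proof.
move=> t0; apply/funext => x; rewrite /cut /left_shift.
by have [x0|//] := leP 0 x; rewrite addr_ge0.
Qed.

Lemma cmeas_cut_right t f : 0 <= t -> cmeasurable setT (cut f) ->
  cmeasurable setT (cut (right_shift t f)).
Proof. by move=> t0 mf; rewrite cut_right//; exact: (cmeas_comp (measurable_shift (- t)) mf). Qed.

Lemma cmeas_cut_left t f : 0 <= t -> cmeasurable setT (cut f) ->
  cmeasurable setT (cut (left_shift t f)).
Proof.
move=> t0 mf; rewrite cut_left//; apply: cmeas_if; last exact: cmeas_cst.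
  exact: measurable_geb.
exact: (cmeas_comp (measurable_shift t) mf).
Qed.

Lemma wt_ge0 x : 0 <= x -> wt p w x = w x `^ p.
Proof. by rewrite /wt => ->. Qed.

Lemma powR_le x y : 0 <= x -> x <= y -> x `^ p <= y `^ p.
Proof.
move=> x0 xy; apply: ge0_ler_powR; rewrite ?nnegrE ?(ltW p0)//.
exact: le_trans xy.
Qed.

Lemma energy_right_le t f (B : R) : 0 <= t -> 0 <= B -> cmeasurable setT (cut f) ->
  (forall x, 0 <= x -> w (x + t) <= B * w x) ->
  (energy p w (right_shift t f) <= (B `^ p)%:E * energy p w f)%E.
Proof.
move=> t0 B0 mf wB; rewrite /energy cut_right//.
rewrite -(pintZv p (powR_ge0 B p) (density_wt p hw) mf).
have ds := density_shift t (density_wt p hw).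
rewrite -[leLHS](pint_shift p t (density_wt p hw)); last first.
  exact: (cmeas_comp (measurable_shift (- t)) mf).
rewrite (_ : (fun x => cut f (x + t - t)) = cut f); last by apply/funext => x; rewrite addrK.
apply: (le_pint ds (densityZ (powR_ge0 B p) (density_wt p hw)) mf mf) => x.
have [x0|x0] := ltP x 0; first by rewrite cut_lt0// cmod0 powR0 ?gt_eqF// !mul0r.
rewrite ler_wpM2l ?powR_ge0// !wt_ge0 ?addr_ge0//.
rewrite -(powRM p B0 (ltW (weight_gt0 hw x0))); apply: powR_le; last exact: wB.
by apply: ltW; apply: weight_gt0 => //; exact: addr_ge0.
Qed.

Lemma energy_left_le t f (B : R) : 0 <= t -> 0 <= B -> cmeasurable setT (cut f) ->
  (forall x, 0 <= x -> w x <= B * w (x + t)) ->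
  (energy p w (left_shift t f) <= (B `^ p)%:E * energy p w f)%E.
Proof.
move=> t0 B0 mf wB; rewrite /energy cut_left//.
rewrite -(pintZv p (powR_ge0 B p) (density_wt p hw) mf).
have dB := densityZ (powR_ge0 B p) (density_wt p hw).
rewrite -[leRHS](pint_shift p t dB mf).
have mft := cmeas_comp (measurable_shift t) mf.
apply: (le_pint (density_wt p hw) (density_shift t dB)) => //.
  by have := cmeas_cut_left t0 mf; rewrite cut_left// cut_cut.
move=> x; have [x0|x0] := ltP x 0.
  rewrite cmod0 powR0 ?gt_eqF// mul0r mulr_ge0 ?powR_ge0//.
  by have [_ ] := density_shift t dB; apply.
rewrite ler_wpM2l ?powR_ge0// !wt_ge0 ?addr_ge0//.
rewrite -(powRM p B0 (ltW (weight_gt0 hw (addr_ge0 x0 t0)))).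
by apply: powR_le; [apply: ltW; exact: weight_gt0|exact: wB].
Qed.

Lemma left_right t f : 0 <= t -> cut (left_shift t (right_shift t f)) = cut f.
Proof.
move=> t0; rewrite cut_left// cut_right//; apply/funext => x; rewrite addrK.
by rewrite /cut; case: ifP => // ->.
Qed.

Lemma weight_window (N : nat) : exists2 K : R, 0 < K & forall x, 0 <= x <= N%:R ->
  w x <= K /\ K^-1 <= w x.
Proof.
have [c c0 hc] := weight_exp_bound hw.
have w0 := weight_gt0 hw (lexx 0).
pose B := expR (c * (N%:R + 1)).
have B0 : 0 < B by exact: expR_gt0.
exists (Num.max (B * w 0) (B / w 0)); first by rewrite lt_max mulr_gt0.
move=> x /andP[x0 xN]; have [h1 h2] := hc _ _ (lexx 0) x0.
rewrite add0r in h1 h2.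
have le : expR (c * (x + 1)) <= B by rewrite ler_expR ler_wpM2l// lerD2r.
have wx := weight_gt0 hw x0.
split; first by rewrite le_max (le_trans h1)// ler_wpM2r// ltW.
rewrite invf_ple ?posrE//; last by rewrite lt_max mulr_gt0.
rewrite le_max; apply/orP; right.
rewrite ler_pdivlMr// mulrC ler_pdivrMr//; apply: (le_trans h2).
by rewrite ler_wpM2r// ltW.
Qed.

Lemma Lploc_E f (X : R) : Lploc p f -> (forall x, X <= x -> f x = 0) -> E p w f.
Proof.
move=> [mf f0 fi] fX; apply/(E_P w hp).
have cf : cut f = f.
  by apply/funext => x; rewrite /cut; case: leP => // x0; rewrite f0.
rewrite /energy cf; split => //.
pose N := `|Num.ceil X|.+1.
have XN : X <= N%:R.
  by rewrite (le_trans (ceil_ge X))// -natr1 -[leLHS]addr0 lerD// natr_absz ler_int ler_norm.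
have [K K0 wK] := weight_window N.
apply: (@le_lt_trans _ _ ((K `^ p)%:E * pint p (win N) f)%E); last first.
  by apply: EFin_mul_lty; [exact: powR_ge0|exact: fi].
rewrite -(pintZv p (powR_ge0 K p) (density_win N) mf).
apply: (le_pint (density_wt p hw) (densityZ (powR_ge0 K p) (density_win N)) mf mf) => x.
rewrite /win; case: ifPn => [/andP[x0 xN]|].
  rewrite mulr1 ler_wpM2l ?powR_ge0// wt_ge0// powR_le ?(ltW (weight_gt0 hw x0))//.
  by have [] := wK x; first by rewrite x0 (ltW xN).
rewrite negb_and -ltNge -leNgt => /orP[/f0|xN]; first by move=> ->; rewrite cmod0 powR0 ?gt_eqF// !mul0r.
by rewrite fX ?(le_trans XN)// cmod0 powR0 ?gt_eqF// !mul0r.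
Qed.

Lemma E_Lploc f : E p w f -> Lploc p (cut f).
Proof.
move=> /(E_P w hp) [mf fi]; split => //; first by move=> x x0; rewrite cut_lt0.
move=> n; have [K K0 wK] := weight_window n.
apply: (@le_lt_trans _ _ ((K `^ p)%:E * energy p w f)%E); last first.
  by apply: EFin_mul_lty; [exact: powR_ge0|exact: fi].
rewrite -(pintZv p (powR_ge0 K p) (density_wt p hw) mf).
apply: (le_pint (density_win n) (densityZ (powR_ge0 K p) (density_wt p hw)) mf mf) => x.
rewrite ler_wpM2l ?powR_ge0// /win; case: ifPn => [/andP[x0 xn]|_]; last first.
  by rewrite mulr_ge0 ?powR_ge0//; case: (density_wt p hw).
rewrite wt_ge0// -powRM ?(ltW K0) ?(ltW (weight_gt0 hw x0))//.
have <- : 1 `^ p = 1 :> R by rewrite powR1.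
apply: powR_le => //; have [|_] := wK x; first by rewrite x0 ltW.
by rewrite -[K^-1]mulr1 ler_pdivrMl.
Qed.

Lemma energy_step_gt0 : (0 < energy p w (step 1))%E.
Proof.
rewrite lt_neqAle energy_ge0// andbT; apply/eqP => e.
have /(E_P w hp) [ms _] : E p w (step 1).
  by apply: (@Lploc_E _ 1) (Lploc_step hp 1) _ => x; exact: step_out.
have /EeqP := energy0_Eeq hw ms (esym e).
move=> [A [mA A0 sA]].
have I01 : `[0, 1[%classic `<=` A.
  move=> x; rewrite /= in_itv /= => /andP[x0 x1]; apply: sA => /=.
  by rewrite /cut x0 /step x0 x1 => /eqP; rewrite oner_eq0.
have : (leb `[0%R, 1%R[%classic <= leb A)%E by apply: le_measure => //; rewrite inE.
rewrite [X in (_ <= X)%E -> _]A0 lebesgue_measure_itv /= lte_fin ltr01 -EFinB subr0.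
by rewrite lee_fin ler10.
Qed.

Lemma right_shiftZ t a f :
  right_shift t (fun x => a * f x) = (fun x => a * right_shift t f x).
Proof. by apply/funext => x; rewrite /right_shift; case: ifP => //; rewrite mulr0. Qed.

Lemma left_shiftZ t a f : left_shift t (fun x => a * f x) = (fun x => a * left_shift t f x).
Proof. by apply/funext => x; rewrite /left_shift; case: ifP => //; rewrite mulr0. Qed.

Lemma right_shiftD s t f : 0 <= s -> 0 <= t ->
  right_shift (s + t) f = right_shift s (right_shift t f).
Proof.
move=> s0 t0; apply/funext => x; rewrite /right_shift lerBrDl opprD addrA.
by have [sx|sx] := leP s x => //; rewrite leNgt (lt_le_trans sx) ?lerDl.
Qed.

Lemma left_shiftD s t f : 0 <= s -> 0 <= t ->
  left_shift (s + t) f = left_shift s (left_shift t f).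
Proof.
move=> s0 t0; apply/funext => x; rewrite /left_shift addrA.
by have [x0|//] := leP 0 x; rewrite addr_ge0.
Qed.

Lemma right_bound : exists2 c : R, 0 <= c & forall t f, 0 <= t -> E p w f ->
  (energy p w (right_shift t f) <= (expR (c * (t + 1)) `^ p)%:E * energy p w f)%E /\
  (energy p w (left_shift t f) <= (expR (c * (t + 1)) `^ p)%:E * energy p w f)%E.
Proof.
have [c c0 hc] := weight_exp_bound hw; exists c => // t f t0 /(E_P w hp) [mf _].
split.
- by apply: energy_right_le; rewrite ?expR_ge0// => x x0; have [] := hc x t x0 t0.
- by apply: energy_left_le; rewrite ?expR_ge0// => x x0; have [] := hc x t x0 t0.
Qed.

Lemma E_right t f : 0 <= t -> E p w f -> E p w (right_shift t f).
Proof.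
move=> t0 Ef; have /(E_P w hp) [mf fi] := Ef; have [c c0 hc] := right_bound.
apply/(E_P w hp); split; first exact: cmeas_cut_right.
have [h _] := hc t f t0 Ef; apply: (le_lt_trans h).
by apply: EFin_mul_lty; [exact: powR_ge0|exact: fi].
Qed.

Lemma E_left t f : 0 <= t -> E p w f -> E p w (left_shift t f).
Proof.
move=> t0 Ef; have /(E_P w hp) [mf fi] := Ef; have [c c0 hc] := right_bound.
apply/(E_P w hp); split; first exact: cmeas_cut_left.
have [_ h] := hc t f t0 Ef; apply: (le_lt_trans h).
by apply: EFin_mul_lty; [exact: powR_ge0|exact: fi].
Qed.

Lemma E_step s : E p w (step s).
Proof. by apply: (@Lploc_E _ s) (Lploc_step hp s) _ => x; exact: step_out. Qed.

Lemma energy_cut f g : cut f = cut g -> energy p w f = energy p w g.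
Proof. by rewrite /energy => ->. Qed.

Let c := sval (cid2 right_bound).
Let c_bound t f : 0 <= t -> E p w f ->
  (energy p w (right_shift t f) <= (expR (c * (t + 1)) `^ p)%:E * energy p w f)%E /\
  (energy p w (left_shift t f) <= (expR (c * (t + 1)) `^ p)%:E * energy p w f)%E.
Proof. by rewrite /c; case: cid2 => /= c' _; exact. Qed.

Let right_lo t : 0 <= t -> exists f, [/\ E p w f, (0 < energy p w f)%E &
  (energy p w f <= (expR (c * (t + 1)) `^ p)%:E * energy p w (right_shift t f))%E].
Proof.
move=> t0; exists (step 1); split; [exact: E_step|exact: energy_step_gt0|].
rewrite -(energy_cut (left_right (step 1) t0)).
by have [_] := c_bound t0 (E_right t0 (E_step 1)).
Qed.

Let left_lo t : 0 <= t -> exists f, [/\ E p w f, (0 < energy p w f)%E &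
  (energy p w f <= (expR (c * (t + 1)) `^ p)%:E * energy p w (left_shift t f))%E].
Proof.
move=> t0; exists (right_shift t (step 1)); split; first exact: E_right (E_step 1).
  rewrite lt_neqAle energy_ge0// andbT; apply/eqP => e.
  have [_] := c_bound t0 (E_right t0 (E_step 1)).
  rewrite -e mule0 (energy_cut (left_right (step 1) t0)) leNgt.
  by rewrite energy_step_gt0.
rewrite (energy_cut (left_right (step 1) t0)).
by have [] := c_bound t0 (E_step 1).
Qed.

Lemma right_growth_upper r : alpha0 p w < r -> exists2 K : R, 0 < K & forall t f,
  0 <= t -> E p w f ->
  (energy p w (right_shift t f) <= ((K * expR (r * t)) `^ p)%:E * energy p w f)%E.
Proof.
apply: (growth_upper hp hw (V := right_shift) (c := c)).
- by move=> t f; exact: E_right.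
- by move=> t a f; exact: right_shiftZ.
- by move=> s t f; exact: right_shiftD.
- by move=> t f t0 Ef; have [] := c_bound t0 Ef.
- exact: right_lo.
Qed.

Lemma left_growth_upper r : alpha1 p w < r -> exists2 K : R, 0 < K & forall t f,
  0 <= t -> E p w f ->
  (energy p w (left_shift t f) <= ((K * expR (r * t)) `^ p)%:E * energy p w f)%E.
Proof.
apply: (growth_upper hp hw (V := left_shift) (c := c)).
- by move=> t f; exact: E_left.
- by move=> t a f; exact: left_shiftZ.
- by move=> s t f; exact: left_shiftD.
- by move=> t f t0 Ef; have [] := c_bound t0 Ef.
- exact: left_lo.
Qed.

Lemma alpha0_le r (K : R) : 0 < K ->
  (forall x t, 0 <= x -> 0 <= t -> w (x + t) <= K * expR (r * t) * w x) -> alpha0 p w <= r.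
Proof.
move=> K0 wK; apply: (growth_le hp hw (V := right_shift) (c := c) _ _ _ _ _ K0).
- by move=> t f; exact: E_right.
- by move=> t a f; exact: right_shiftZ.
- by move=> s t f; exact: right_shiftD.
- by move=> t f t0 Ef; have [] := c_bound t0 Ef.
- exact: right_lo.
- move=> t f t0 /(E_P w hp) [mf _]; apply: energy_right_le => //.
    by rewrite mulr_ge0 ?expR_ge0 ?ltW.
  by move=> x x0; exact: wK.
Qed.

Lemma alpha1_le r (K : R) : 0 < K ->
  (forall x t, 0 <= x -> 0 <= t -> w x <= K * expR (r * t) * w (x + t)) -> alpha1 p w <= r.
Proof.
move=> K0 wK; apply: (growth_le hp hw (V := left_shift) (c := c) _ _ _ _ _ K0).
- by move=> t f; exact: E_left.
- by move=> t a f; exact: left_shiftZ.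
- by move=> s t f; exact: left_shiftD.
- by move=> t f t0 Ef; have [] := c_bound t0 Ef.
- exact: left_lo.
- move=> t f t0 /(E_P w hp) [mf _]; apply: energy_left_le => //.
    by rewrite mulr_ge0 ?expR_ge0 ?ltW.
  by move=> x x0; exact: wK.
Qed.

(** Otherwise, from every point s some step x <= n takes w (s) e^(- a s) to a
    smaller value. Then the minimum of this function on [s, s + t] is
    attained within n of s + t, which bounds w (s + t) / w s by a constant
    times e^(at) and makes alpha0 <= a. *)
Lemma right_stretch a (n : nat) : a < alpha0 p w ->
  exists2 s, 0 <= s & forall x, 0 <= x <= n%:R -> expR (a * x) * w s <= w (s + x).
Proof.
move=> aa; apply: contrapT => H.
have {}H s : 0 <= s -> exists2 x, 0 <= x <= n%:R & w (s + x) < expR (a * x) * w s.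
  move=> s0; apply: contrapT => Hs; apply: H; exists s => // x xn.
  by rewrite leNgt; apply/negP => lt; apply: Hs; exists x.
have [d d0 hd] := weight_exp_bound hw.
move: aa; apply/negP; rewrite -leNgt.
apply: (@alpha0_le _ (expR (d * (n%:R + 1)) * expR (`|a| * n%:R))).
  by rewrite mulr_gt0 ?expR_gt0.
move=> s t s0 t0.
pose g (y : R) := w `|y| * expR (- a * y).
have cg : continuous g.
  move=> y; apply: cvgM; first exact: continuous_weight_norm.
  apply: (@continuous_comp _ _ _ (fun y => - a * y) expR); last exact: continuous_expR.
  by apply: cvgM; [exact: cvg_cst|exact: cvg_id].
have st : s <= s + t by rewrite lerDl.
have [y + ymin] := EVT_min st (continuous_subspaceT cg); rewrite in_itv /= => /andP[sy yt].
have y0 : 0 <= y := le_trans s0 sy.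
(* The minimum y of g on [s, s + t] is close to s + t: another step x <= n
   would lower g. *)
have ys : s + t - n%:R < y.
  rewrite ltNge; apply/negP => yn; have [x /andP[x0 xn] xlt] := H _ y0.
  have := ymin (y + x); rewrite in_itv /= (le_trans sy) ?lerDl//=.
  have -> : y + x <= s + t by lra.
  move=> /(_ isT); rewrite /g !ger0_norm ?addr_ge0// leNgt => /negP; apply.
  have -> : expR (- a * (y + x)) = expR (- a * y) * expR (- a * x) by rewrite -expRD; congr expR; ring.
  rewrite mulrCA [w y * _]mulrC ltr_pM2l ?expR_gt0//.
  by rewrite mulNr expRN ltr_pdivrMr ?expR_gt0// mulrC.
have gmin : g y <= g s by apply: ymin; rewrite in_itv /= lexx st.
have wy : w y <= expR (`|a| * n%:R) * expR (a * t) * w s.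
  have : w y <= w s * expR (a * (y - s)).
    move: gmin; rewrite /g !ger0_norm// -ler_pdivlMr ?expR_gt0// -mulrA -expRN -expRD => /le_trans; apply.
    by rewrite le_eqVlt; apply/orP; left; apply/eqP; congr (_ * expR _); ring.
  move=> /le_trans; apply; rewrite mulrC; apply: ler_wpM2r; first by rewrite ltW// weight_gt0.
  rewrite -expRD ler_expR.
  have -> : a * (y - s) = a * t - a * (s + t - y) by ring.
  rewrite addrC lerD2r -mulNr (le_trans (ler_norm _))// normrM normrN ler_wpM2l//.
  by rewrite ger0_norm; lra.
have yst : 0 <= s + t - y by rewrite subr_ge0.
have [h _] := hd y (s + t - y) y0 yst.
rewrite addrC subrK in h; apply: (le_trans h).
rewrite -[X in _ <= X]mulrA -[X in _ <= X]mulrA; apply: ler_pM; rewrite ?expR_ge0 ?(ltW (weight_gt0 hw y0))//.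
  by rewrite ler_expR ler_wpM2l// lerD2r; lra.
by rewrite mulrA.
Qed.

(** As for [right_stretch], stepping to the left: now the function w (x)
    e^(ax) would be smallest near the left end of each interval. *)
Lemma left_stretch a (n : nat) : a < alpha1 p w ->
  exists2 s, n%:R <= s & forall x, 0 <= x <= n%:R -> expR (a * x) * w s <= w (s - x).
Proof.
move=> aa; apply: contrapT => H.
have {}H s : n%:R <= s -> exists2 x, 0 <= x <= n%:R & w (s - x) < expR (a * x) * w s.
  move=> s0; apply: contrapT => Hs; apply: H; exists s => // x xn.
  by rewrite leNgt; apply/negP => lt; apply: Hs; exists x.
have [d d0 hd] := weight_exp_bound hw.
move: aa; apply/negP; rewrite -leNgt.
apply: (@alpha1_le _ (expR (d * (n%:R + 1)) * expR (`|a| * n%:R))).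
  by rewrite mulr_gt0 ?expR_gt0.
move=> s t s0 t0.
pose g (y : R) := w `|y| * expR (a * y).
have cg : continuous g.
  move=> y; apply: cvgM; first exact: continuous_weight_norm.
  apply: (@continuous_comp _ _ _ (fun y => a * y) expR); last exact: continuous_expR.
  by apply: cvgM; [exact: cvg_cst|exact: cvg_id].
have st : s <= s + t by rewrite lerDl.
have [y + ymin] := EVT_min st (continuous_subspaceT cg); rewrite in_itv /= => /andP[sy yt].
have y0 : 0 <= y := le_trans s0 sy.
have ys : y < s + n%:R.
  rewrite ltNge; apply/negP => yn.
  have ny : n%:R <= y by apply: le_trans yn; rewrite lerDr.
  have [x /andP[x0 xn] xlt] := H _ ny.
  have yx0 : 0 <= y - x by lra.
  have := ymin (y - x); rewrite in_itv /=.
  have -> : (s <= y - x) && (y - x <= s + t) by apply/andP; split; lra.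
  move=> /(_ isT); rewrite /g !ger0_norm// leNgt => /negP; apply.
  have -> : expR (a * (y - x)) = expR (a * y) * (expR (a * x))^-1.
    by rewrite -expRN -expRD; congr expR; ring.
  rewrite mulrCA [w y * _]mulrC ltr_pM2l ?expR_gt0//.
  by rewrite ltr_pdivrMr ?expR_gt0// mulrC.
have gmin : g y <= g (s + t) by apply: ymin; rewrite in_itv /= lexx st.
have st0 : 0 <= s + t by rewrite addr_ge0.
have wy : w y <= expR (`|a| * n%:R) * expR (a * t) * w (s + t).
  have : w y <= w (s + t) * expR (a * (s + t - y)).
    move: gmin; rewrite /g !ger0_norm// -ler_pdivlMr ?expR_gt0// -mulrA -expRN -expRD => /le_trans; apply.
    by rewrite le_eqVlt; apply/orP; left; apply/eqP; congr (_ * expR _); ring.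
  move=> /le_trans; apply; rewrite mulrC; apply: ler_wpM2r; first by rewrite ltW// weight_gt0.
  rewrite -expRD ler_expR.
  have -> : a * (s + t - y) = a * t - a * (y - s) by ring.
  rewrite addrC lerD2r -mulNr (le_trans (ler_norm _))// normrM normrN ler_wpM2l//.
  by rewrite ger0_norm; lra.
have ysub : 0 <= y - s by rewrite subr_ge0.
have [_ h] := hd s (y - s) s0 ysub.
rewrite (_ : s + (y - s) = y) in h; last by ring.
apply: (le_trans h).
rewrite -[X in _ <= X]mulrA -[X in _ <= X]mulrA; apply: ler_pM; rewrite ?expR_ge0 ?(ltW (weight_gt0 hw y0))//.
  by rewrite ler_expR ler_wpM2l// lerD2r; lra.
by rewrite mulrA.
Qed.

End Shifts.

(** * Gluing operators on windows *)

Section Glue.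
Context {R : realType}.
Local Notation C := R[i].
Local Notation leb := (@lebesgue_measure R).
Variable p : R.
Hypothesis hp : 1 <= p.
Implicit Types (f g h : R -> C).

Lemma cmeas_piecewise (F : nat -> R -> C) : (forall N, cmeasurable setT (F N)) ->
  cmeasurable setT (fun x => if 0 <= x then F (Num.truncn x) x else 0).
Proof.
move=> mF; pose I (n : nat) : set R := if n is k.+1 then `[k%:R, k.+1%:R[%classic else `]-oo, 0[%classic.
have mI n : measurable (I n) by case: n => [|k]; exact: measurable_itv.
have IT : \bigcup_n I n = setT.
  apply/seteqP; split => // x _; have [x0|x0] := ltP x 0.
    by exists 0 => //; rewrite /I /= in_itv.
  by exists (Num.truncn x).+1 => //; rewrite /I /= in_itv /= truncn_itv.
have FI n x : I n x -> (if 0 <= x then F (Num.truncn x) x else 0) =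
    (if n is k.+1 then F k x else 0).
  case: n => [|k]; rewrite /I /= in_itv /=; first by rewrite leNgt => ->.
  move=> /andP[kx xk]; have x0 : 0 <= x by apply: le_trans kx; rewrite ler0n.
  rewrite x0; congr (F _ x); apply/eqP; rewrite truncn_eq// kx xk //.
split; rewrite -IT; apply/measurable_fun_bigcup => // n.
- apply: (eq_measurable_fun (fun x => complex.Re (if n is k.+1 then F k x else 0))).
    by move=> x /set_mem /FI ->.
  case: n {mI FI} => [|k]; first exact: measurable_cst.
  by apply: measurable_funS (mF k).1.
- apply: (eq_measurable_fun (fun x => complex.Im (if n is k.+1 then F k x else 0))).
    by move=> x /set_mem /FI ->.
  case: n {mI FI} => [|k]; first exact: measurable_cst.
  by apply: measurable_funS (mF k).2.
Qed.

Variables (V : nat -> R -> R) (M : R) (A : nat -> (R -> C) -> (R -> C)).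
Hypothesis dV : forall n, density (V n).
Hypothesis V_out : forall n x, ~~ (0 <= x < n%:R) -> V n x = 0.
Let AN N f x : C := if 0 <= x < N%:R then A N f x else 0.
Hypothesis A_meas : forall N f, Lploc p f -> cmeasurable setT (AN N f).
Hypothesis A_fin : forall N f, Lploc p f -> (pint p (win N) (AN N f) < +oo)%E.
Hypothesis A_mono : forall N N' f, (N <= N')%N -> Lploc p f ->
  \forall x \ae leb, 0 <= x < N%:R -> A N f x = A N' f x.
Hypothesis A_lin : forall N c f g, Lploc p f -> Lploc p g ->
  \forall x \ae leb, 0 <= x < N%:R -> A N (fun y => c * f y + g y) x = c * A N f x + A N g x.
Hypothesis A_shift : forall N t f, 0 <= t -> Lploc p f ->
  \forall x \ae leb, 0 <= x < N%:R ->
    A N (fun y => f (y - t)) x = if t <= x then A N f (x - t) else 0.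
Hypothesis A_bound : forall n f, Lploc p f ->
  (pint p (V n) (AN n f) <= (M `^ p)%:E * pint p (V n) f)%E.

(** At x the piece of the first integer window that contains x is used. *)
Definition glue f x : C := if 0 <= x then A (Num.truncn x).+1 f x else 0.

Lemma in_trunc (x : R) : 0 <= x -> 0 <= x < (Num.truncn x).+1%:R.
Proof. by move=> x0; rewrite x0 /= truncnS_gt. Qed.

Lemma glueE N f : Lploc p f -> \forall x \ae leb, 0 <= x < N%:R -> glue f x = A N f x.
Proof.
move=> Lf.
have H (k : nat) : \forall x \ae leb, (k < N)%N -> 0 <= x < k.+1%:R -> A k.+1 f x = A N f x.
  have [kN|kN] := ltnP k N; last by apply: aeT => x.
  by apply: aeS (A_mono kN Lf) => x h _.
apply: aeS (ae_forall H) => x h /andP[x0 xN]; rewrite /glue x0; apply: h; last exact: in_trunc.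
rewrite -(ltr_nat R); apply: le_lt_trans xN.
by have /andP[] := truncn_itv x0.
Qed.

Lemma glue_lt0 f x : x < 0 -> glue f x = 0.
Proof. by rewrite /glue leNgt => ->. Qed.

Lemma cmeas_glue f : Lploc p f -> cmeasurable setT (glue f).
Proof.
move=> Lf; have -> : glue f = fun x => if 0 <= x then AN (Num.truncn x).+1 f x else 0.
  apply/funext => x; rewrite /glue /AN; have [x0|//] := leP 0 x; by rewrite truncnS_gt.
by apply: (cmeas_piecewise (F := fun n => AN n.+1 f)) => N; exact: A_meas.
Qed.

Let glueAN N v f : density v -> (forall x, ~~ (0 <= x < N%:R) -> v x = 0) -> Lploc p f ->
  pint p v (glue f) = pint p v (AN N f).
Proof.
move=> dv vout Lf; have e : \forall x \ae leb,
    cmod (glue f x) `^ p * v x = cmod (AN N f x) `^ p * v x.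
  apply: aeS (glueE N Lf) => x h; rewrite /AN; move: h (vout x); case: ifP => [_ /(_ isT) -> //|_ _ h].
  by rewrite (h isT) !mulr0.
apply/eqP; rewrite eq_le; apply/andP; split.
- by apply: (ae_le_pint dv dv (cmeas_glue Lf) (A_meas N Lf)); apply: aeS e => x ->.
- by apply: (ae_le_pint dv dv (A_meas N Lf) (cmeas_glue Lf)); apply: aeS e => x ->.
Qed.

Lemma win_out n x : ~~ (0 <= x < n%:R) -> win n x = 0 :> R.
Proof. by rewrite /win => /negbTE ->. Qed.

Lemma Lploc_glue f : Lploc p f -> Lploc p (glue f).
Proof.
move=> Lf; split; [exact: cmeas_glue|by move=> x; exact: glue_lt0|].
by move=> n; rewrite (glueAN (density_win n) (@win_out n) Lf); exact: A_fin.
Qed.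

Lemma ae_Rplus (P : R -> Prop) : (forall N : nat, \forall x \ae leb, 0 <= x < N%:R -> P x) ->
  (forall x, x < 0 -> P x) -> \forall x \ae leb, P x.
Proof.
move=> HN H0; apply: aeS (ae_forall HN) => x h; have [x0|x0] := ltP x 0; first exact: H0.
by apply: (h (Num.truncn x).+1); exact: in_trunc.
Qed.

(** The pieces A N agree on common windows, so each property of the glued
    operator is checked window by window. *)
Theorem local_operator_glue : local_operator p V M glue.
Proof.
split.
- exact: Lploc_glue.
- move=> c f g Lf Lg; have Lfg := Lploc_comb hp c Lf Lg.
  apply: ae_Rplus => [N|x x0]; last by rewrite !glue_lt0// mulr0 addr0.
  apply: aeS (aeI (aeI (glueE N Lfg) (glueE N Lf)) (aeI (glueE N Lg) (A_lin N c Lf Lg))).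
  by move=> x [[h1 h2] [h3 h4]] xN; rewrite h1// h2// h3// h4.
- move=> t f t0 Lf; have Lft := Lploc_shift hp t0 Lf.
  apply: ae_Rplus => [N|x x0]; last by rewrite !glue_lt0//; lra.
  have hs := negligible_shift (- t) (glueE N Lf).
  apply: aeS (aeI (aeI (glueE N Lft) hs) (A_shift N t0 Lf)) => x [[h1 h2] h3] xN.
  rewrite h1// h3//; case: leP => tx; last by rewrite glue_lt0// subr_lt0.
  by rewrite h2// subr_ge0 tx /=; move: xN => /andP[]; lra.
- move=> n f Lf; rewrite (glueAN (dV n) (@V_out n) Lf); exact: A_bound.
Qed.

End Glue.

(** * Causality and time reversal *)

Section WindowWeight.
Context {R : realType}.
Local Notation C := R[i].
Local Notation leb := (@lebesgue_measure R).
Variable p : R.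
Hypothesis hp : 1 <= p.
Implicit Types (f g h : R -> C).
Let p0 : 0 < p. Proof. exact: lt_le_trans ltr01 hp. Qed.

(** The constant c normalises the weight at the start of a stretch. *)
Definition wwin (n : nat) (c : R) (v : R -> R) (x : R) : R :=
  if 0 <= x < n%:R then c * v x else 0.

Lemma density_wwin n c v : 0 <= c -> density v -> density (wwin n c v).
Proof.
move=> c0 dv; have [mv v0] := densityZ c0 dv; split.
  by apply: measurable_fun_ifT => //; exact: measurable_cob.
by move=> x; rewrite /wwin; case: ifP.
Qed.

Lemma wwin_out n c v x : ~~ (0 <= x < n%:R) -> wwin n c v x = 0.
Proof. by rewrite /wwin => /negbTE ->. Qed.

Lemma pint_wwin n c v h : 0 <= c -> density v -> cmeasurable setT h ->
  (forall x, ~~ (0 <= x < n%:R) -> h x = 0) ->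
  pint p (wwin n c v) h = (c%:E * pint p v h)%E.
Proof.
move=> c0 dv mh h0; rewrite -(pintZv p c0 dv mh) !pintE; apply: eq_integral => x _.
rewrite /wwin; case: ifPn => // /h0 ->; by rewrite cmod0 powR0 ?gt_eqF// !mul0r.
Qed.

Definition trunc (N : nat) f : R -> C := fun x => if x < N%:R then f x else 0.

Lemma Lploc_trunc N f : Lploc p f -> Lploc p (trunc N f).
Proof. by apply: (Lploc_cut hp); exact: measurable_ltb. Qed.

Lemma trunc_out N f x : N%:R <= x -> trunc N f x = 0.
Proof. by rewrite /trunc ltNge => ->. Qed.

Lemma trunc_lt N f x : x < N%:R -> trunc N f x = f x.
Proof. by rewrite /trunc => ->. Qed.

Lemma trunc_win N f x : Lploc p f -> ~~ (0 <= x < N%:R) -> trunc N f x = 0.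
Proof.
move=> [_ f0 _]; rewrite negb_and -ltNge -leNgt => /orP[x0|]; last exact: trunc_out.
by rewrite /trunc f0// if_same.
Qed.

Lemma pint_wwin_trunc n c v f : pint p (wwin n c v) f = pint p (wwin n c v) (trunc n f).
Proof.
rewrite !pintE; apply: eq_integral => x _; rewrite /wwin /trunc.
by case: ifP => [/andP[_ ->]|]//; rewrite !mulr0.
Qed.

Lemma Lploc_refl (N : nat) s f : 0 <= s -> s <= N%:R -> Lploc p f ->
  Lploc p (cut (fun y => f (s - y))).
Proof.
move=> s0 sN [mf f0 fi].
have mr : cmeasurable setT (fun y => f (s - y)) := cmeas_comp (measurable_refl s) mf.
have mc : cmeasurable setT (cut (fun y => f (s - y))).
  apply: cmeas_if; [exact: measurable_geb|exact: mr|exact: cmeas_cst].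
split => // [x x0|n]; first exact: cut_lt0.
apply: le_lt_trans (fi N.+1); rewrite -(pint_refl p s (density_win _) mf).
apply: (le_pint (density_win n) (density_refl s (density_win _)) mc mr) => x.
have [x0|x0] := ltP x 0.
  by rewrite cut_lt0// cmod0 powR0 ?gt_eqF// mul0r mulr_ge0 ?powR_ge0//; case: (@density_win R N.+1).
rewrite cut_id//; have [xs|xs] := leP x s; last by rewrite f0 ?subr_lt0// cmod0 powR0 ?gt_eqF// !mul0r.
rewrite ler_wpM2l ?powR_ge0// {2}/win subr_ge0 xs /=.
have -> : s - x < N.+1%:R by rewrite -natr1; lra.
by rewrite /win; case: ifP.
Qed.

End WindowWeight.

Section Embedding.
Context {R : realType}.
Local Notation C := R[i].
Local Notation leb := (@lebesgue_measure R).
Variables (p : R) (w : R -> R).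
Hypothesis hp : 1 <= p.
Hypothesis hw : weight w.
Implicit Types (f g h : R -> C) (T U : (R -> C) -> (R -> C)).
#[local] Opaque opnorm Enorm.
Let p0 : 0 < p. Proof. exact: lt_le_trans ltr01 hp. Qed.

Lemma E_trunc N f : Lploc p f -> E p w (trunc N f).
Proof.
move=> Lf; apply: (@Lploc_E _ _ _ hp hw _ N%:R); first exact: Lploc_trunc.
by move=> x; exact: trunc_out.
Qed.

Lemma bounded_lin T c f g : bounded_operator p w T -> E p w f -> E p w g ->
  \forall x \ae leb, 0 <= x -> T (fun y => c * f y + g y) x = c * T f x + T g x.
Proof.
move=> [_ linT _] Ef Eg; have /EeqP := linT c f g Ef Eg.
by apply: aeS => x h x0; move: h; rewrite !cut_id.
Qed.

Lemma EeqR f g : Eeq f g <-> \forall x \ae leb, 0 <= x -> f x = g x.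
Proof.
rewrite EeqP; split; apply: aeS => x h.
- by move=> x0; move: h; rewrite !cut_id.
- by rewrite /cut; case: ifP.
Qed.

Lemma bounded_T0 T : bounded_operator p w T -> Eeq (T (fun=> 0)) (fun=> 0).
Proof.
move=> bT; have [M M0 TM] := bounded_energy hp hw bT; have [ET _ _] := bT.
have E0 := E0 w hp.
have /(E_P w hp)[m0 _] := ET _ E0.
apply: (@energy0_Eeq _ p _ hw _ m0); apply/eqP; rewrite eq_le (energy_ge0 p hw) andbT.
apply: (le_trans (TM _ E0)).
have -> : energy p w (fun=> 0 : C) = 0%E.
  rewrite /energy (_ : cut _ = fun=> 0) ?pint0//.
  by apply/funext => x; rewrite /cut if_same.
by rewrite mule0.
Qed.

Lemma E_cmeas f : E p w f -> cmeasurable setT (cut f).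
Proof. by move=> /(E_P w hp)[]. Qed.

Lemma bounded_right t : 0 <= t -> bounded_operator p w (right_shift t).
Proof.
move=> t0; have [c c0 hc] := right_bound hp hw.
apply: (bounded_operatorP hp hw (expR_ge0 (c * (t + 1)))).
- by move=> f /E_cmeas mf; exact: cmeas_cut_right.
- move=> d f g _ _; rewrite (_ : right_shift t _ = fun x => d * right_shift t f x + right_shift t g x).
    exact: Eeq_refl.
  by apply/funext => x; rewrite /right_shift; case: ifP => // _; rewrite mulr0 addr0.
- by move=> f Ef; have [] := hc t f t0 Ef.
Qed.

Lemma bounded_left t : 0 <= t -> bounded_operator p w (left_shift t).
Proof.
move=> t0; have [c c0 hc] := right_bound hp hw.
apply: (bounded_operatorP hp hw (expR_ge0 (c * (t + 1)))).
- by move=> f /E_cmeas mf; exact: cmeas_cut_left.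
- move=> d f g _ _; rewrite (_ : left_shift t _ = fun x => d * left_shift t f x + left_shift t g x).
    exact: Eeq_refl.
  by apply/funext => x; rewrite /left_shift; case: ifP => // _; rewrite mulr0 addr0.
- by move=> f Ef; have [] := hc t f t0 Ef.
Qed.

Definition inverse_of T l U := [/\ bounded_operator p w U,
  (forall f, E p w f -> Eeq (U (fun x => T f x - l * f x)) f) &
  (forall f, E p w f -> Eeq (fun x => T (U f) x - l * U f x) f)].

(** The inverse commutes with whatever the operator commutes with:
    U V f = U V (T - l) U f = U (T - l) V U f = V U f. *)
Lemma inverse_commutes (V : R -> (R -> C) -> (R -> C)) T l U :
  (forall t, 0 <= t -> bounded_operator p w (V t)) ->
  bounded_operator p w T -> inverse_of T l U ->
  commutes_with p w V T -> commutes_with p w V U.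
Proof.
move=> bV bT [bU UT TU] cT t t0 f Ef.
have [EV linV _] := bV t t0; have [EU linU _] := bU; have [ET linT _] := bT.
pose r g x : C := - l * g x + T g x.
have rE g : r g = fun x => T g x - l * g x by apply/funext => x; rewrite /r mulNr addrC.
have Er g : E p w g -> E p w (r g) by move=> Eg; exact: (E_comb hp hw (- l) Eg (ET _ Eg)).
have EUf := EU _ Ef; have EVf := EV _ Ef; have EVU := EV _ EUf.
have h1 : Eeq f (r (U f)) by rewrite rE; apply: Eeq_sym; exact: TU.
have h2 := bounded_Eeq hp hw (bV t t0) Ef (Er _ EUf) h1.
have h3 : Eeq (V t (r (U f))) (r (V t (U f))).
  apply: (Eeq_trans (linV (- l) _ _ EUf (ET _ EUf))).
  have /EeqR c := cT t t0 _ EUf; apply/EeqR; apply: aeS c => x h x0.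
  by rewrite /r h.
have h4 := bounded_Eeq hp hw bU EVf (Er _ EVU) (Eeq_trans h2 h3).
by apply: (Eeq_trans h4); rewrite rE; exact: UT.
Qed.

Section Right.
Variable T : (R -> C) -> (R -> C).
Hypothesis bT : bounded_operator p w T.
Hypothesis cT : commutes_with p w right_shift T.

Let ET f : E p w f -> E p w (T f). Proof. by case: bT => + _ _; apply. Qed.

(** A function that vanishes on [0, X) is a right translate by X, and T
    commutes with this translation. *)
Lemma right_causal f g X : 0 <= X -> E p w f -> E p w g ->
  (\forall x \ae leb, 0 <= x < X -> f x = g x) ->
  \forall x \ae leb, 0 <= x < X -> T f x = T g x.
Proof.
move=> X0 Ef Eg fg; pose h x := f x - g x.
have Eh : E p w h := EB hp hw Ef Eg.
have Eh' := E_left hp hw X0 Eh.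
have hh : Eeq h (right_shift X (left_shift X h)).
  apply/EeqR; apply: aeS fg => x fg x0; rewrite /right_shift /left_shift subr_ge0 subrK.
  by case: leP => // xX; rewrite /h fg ?subrr// x0.
have /EeqR e1 := bounded_Eeq hp hw bT Eh (E_right hp hw X0 Eh') hh.
have /EeqR e2 := cT X0 Eh'.
have e3 := bounded_lin 1 bT Eh Eg.
have fE : f = fun y => 1 * h y + g y by apply/funext => x; rewrite /h mul1r subrK.
apply: aeS (aeI (aeI e1 e2) e3) => x [[h1 h2] h3] /andP[x0 xX].
by rewrite [in LHS]fE h3// mul1r h1// h2// /right_shift leNgt xX add0r.
Qed.

Definition rtrans N f : R -> C := T (trunc N f).

Lemma rtrans_mono N N' f : (N <= N')%N -> Lploc p f ->
  \forall x \ae leb, 0 <= x < N%:R -> rtrans N f x = rtrans N' f x.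
Proof.
move=> NN' Lf; apply: right_causal; [exact: ler0n|exact: E_trunc|exact: E_trunc|].
by apply: aeT => x /andP[_ xN]; rewrite !trunc_lt// (lt_le_trans xN)// ler_nat.
Qed.

Lemma rtrans_lin N c f g : Lploc p f -> Lploc p g -> \forall x \ae leb, 0 <= x < N%:R ->
  rtrans N (fun y => c * f y + g y) x = c * rtrans N f x + rtrans N g x.
Proof.
move=> Lf Lg; have := bounded_lin c bT (E_trunc N Lf) (E_trunc N Lg).
have <- : trunc N (fun y => c * f y + g y) = fun y => c * trunc N f y + trunc N g y.
  by apply/funext => x; rewrite /trunc; case: ifP => // _; rewrite mulr0 addr0.
by apply: aeS => x h /andP[x0 _]; exact: h.
Qed.

Lemma rtrans_shift N t f : 0 <= t -> Lploc p f -> \forall x \ae leb, 0 <= x < N%:R ->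
  rtrans N (fun y => f (y - t)) x = if t <= x then rtrans N f (x - t) else 0.
Proof.
move=> t0 Lf; have EN := E_trunc N Lf; have [_ f0 _] := Lf.
have h1 : \forall x \ae leb, 0 <= x < N%:R ->
    trunc N (fun y => f (y - t)) x = right_shift t (trunc N f) x.
  apply: aeT => x /andP[x0 xN]; rewrite trunc_lt// /right_shift; case: leP => tx.
    by rewrite trunc_lt// (le_lt_trans _ xN)// lerBlDr lerDl.
  by rewrite f0// subr_lt0.
have h2 := right_causal (ler0n _ N) (E_trunc N (Lploc_shift hp t0 Lf)) (E_right hp hw t0 EN) h1.
have /EeqR h3 := cT t0 EN.
by apply: aeS (aeI h2 h3) => x [e2 e3] xN; rewrite /rtrans e2// e3//; case/andP: xN.
Qed.

Lemma rtrans_meas N f : Lploc p f ->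
  cmeasurable setT (fun x => if 0 <= x < N%:R then rtrans N f x else 0).
Proof.
move=> Lf; have := E_cmeas (ET (E_trunc N Lf)) => m.
rewrite (_ : (fun x => _) = fun x => if 0 <= x < N%:R then cut (rtrans N f) x else 0).
  by apply: cmeas_if; [exact: measurable_cob|exact: m|exact: cmeas_cst].
by apply/funext => x; case: ifP => // /andP[x0 _]; rewrite cut_id.
Qed.

Lemma rtrans_fin N f : Lploc p f ->
  (pint p (win N) (fun x => if 0 <= x < N%:R then rtrans N f x else 0)%R < +oo)%E.
Proof.
move=> Lf; have [m _ fi] := E_Lploc hp hw (ET (E_trunc N Lf)).
apply: le_lt_trans (fi N); apply: (le_pint (density_win N) (density_win N) (rtrans_meas N Lf) m) => x.
rewrite /win; case: ifP => [/andP[x0 xN]|_]; last by rewrite !mulr0.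
by rewrite cut_id// lexx.
Qed.

Lemma energy_right s h : 0 <= s -> cmeasurable setT (cut h) ->
  energy p w (right_shift s h) = pint p (fun x => wt p w (x + s)) (cut h).
Proof.
move=> s0 mh; rewrite /energy cut_right// -[LHS](pint_shift p s (density_wt p hw)); last first.
  exact: (cmeas_comp (measurable_shift (- s)) mh).
by congr pint; apply/funext => x; rewrite addrK.
Qed.

(** The translate by s of the truncation of f is an element of the space
    whose energy is that of f for the translated density, and T commutes with
    the translation. *)
Lemma rtrans_bound (M : R) n s c f : 0 <= s -> 0 <= c ->
  (forall f, E p w f -> (energy p w (T f) <= (M `^ p)%:E * energy p w f)%E) -> Lploc p f ->
  (pint p (wwin n c (fun x => wt p w (x + s)%R))
      (fun x => if 0 <= x < n%:R then rtrans n f x else 0)%R <=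
   (M `^ p)%:E * pint p (wwin n c (fun x => wt p w (x + s)%R)) f)%E.
Proof.
move=> s0 c0 TM Lf; have EN := E_trunc n Lf; have Ln := Lploc_trunc hp n Lf.
have dv := density_shift s (density_wt p hw).
have mA := rtrans_meas n Lf; have [mN N0 _] := Ln.
have cN : cut (trunc n f) = trunc n f.
  by apply/funext => x; rewrite /cut; case: leP => // x0; rewrite N0.
rewrite [in leRHS]pint_wwin_trunc.
rewrite (pint_wwin hp c0 dv mA); last by move=> x /negbTE ->.
rewrite (pint_wwin hp c0 dv mN); last by move=> x; exact: (trunc_win Lf).
rewrite muleCA lee_wpmul2l ?lee_fin//.
have mT := E_cmeas (ET EN).
have -> : pint p (fun x => wt p w (x + s)) (trunc n f) = energy p w (right_shift s (trunc n f)).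
  by rewrite energy_right ?cN.
apply: le_trans (TM _ (E_right hp hw s0 EN)).
rewrite (Eeq_energy p hw (E_cmeas (ET (E_right hp hw s0 EN)))
   (E_cmeas (E_right hp hw s0 (ET EN))) (cT s0 EN)).
rewrite energy_right//; apply: (le_pint dv dv mA mT) => x.
apply: ler_wpM2r; first by case: dv.
apply: (powR_le hp (cmod_ge0 _)); case: ifP => [/andP[x0 _]|_]; first by rewrite cut_id.
by rewrite cmod0 cmod_ge0.
Qed.

End Right.

Section Left.
Variable T : (R -> C) -> (R -> C).
Hypothesis bT : bounded_operator p w T.
Hypothesis cT : commutes_with p w left_shift T.

Let ET f : E p w f -> E p w (T f). Proof. by case: bT => + _ _; apply. Qed.

(** Time reversal on [0, s]. The left shift by s - r turns the reversal on
    [0, s] into the one on [0, r] ([left_refl]), and so it relates the images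
    under T. *)
Definition refl s f : R -> C := cut (fun y => f (s - y)).

Lemma refl_out s f x : Lploc p f -> s < x -> refl s f x = 0.
Proof. by move=> [_ f0 _] sx; rewrite /refl /cut f0 ?if_same// subr_lt0. Qed.

Lemma E_refl s f : 0 <= s -> Lploc p f -> E p w (refl s f).
Proof.
move=> s0 Lf; have sN : s <= `|Num.ceil s|.+1%:R.
  by rewrite (le_trans (ceil_ge s))// -natr1 -[leLHS]addr0 lerD// natr_absz ler_int ler_norm.
apply: (@Lploc_E _ _ _ hp hw _ (s + 1)); first exact: (Lploc_refl hp s0 sN Lf).
by move=> x sx; apply: refl_out => //; apply: lt_le_trans sx; rewrite ltrDl.
Qed.

Lemma left_refl r s f : 0 <= r -> r <= s -> left_shift (s - r) (refl s f) = refl r f.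
Proof.
move=> r0 rs; apply/funext => y; rewrite /left_shift /refl /cut.
have [y0|//] := leP 0 y; have -> : 0 <= y + (s - r) by rewrite addr_ge0// subr_ge0.
by congr f; ring.
Qed.

Lemma T_refl r s f : 0 <= r -> r <= s -> Lploc p f ->
  \forall y \ae leb, 0 <= y -> T (refl r f) y = T (refl s f) (y + (s - r)).
Proof.
move=> r0 rs Lf; rewrite -(left_refl f r0 rs).
have sr : 0 <= s - r by rewrite subr_ge0.
have /EeqR := cT sr (E_refl (le_trans r0 rs) Lf).
by apply: aeS => y h y0; rewrite h// /left_shift y0.
Qed.

(** The left shift by s annihilates the reversal of f on [0, s] almost
    everywhere, hence its image. *)
Lemma T_refl_out s f : 0 <= s -> Lploc p f ->
  \forall y \ae leb, s < y -> T (refl s f) y = 0.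
Proof.
move=> s0 Lf; have Er := E_refl s0 Lf.
have h0 : Eeq (left_shift s (refl s f)) (fun=> 0).
  apply/EeqR; apply: aeS (ae_neq 0) => y y0 y0'; rewrite /left_shift y0'.
  by apply: refl_out => //; rewrite ltrDr lt_neqAle eq_sym y0 y0'.
have h1 := bounded_Eeq hp hw bT (E_left hp hw s0 Er) (E0 w hp) h0.
have h2 := Eeq_trans (Eeq_sym (cT s0 Er)) (Eeq_trans h1 (bounded_T0 bT)).
have /EeqR/(negligible_shift (- s)) := h2.
apply: aeS => y h sy; move: h; rewrite subr_ge0 => /(_ (ltW sy)).
by rewrite /left_shift subr_ge0 (ltW sy) subrK.
Qed.

Definition ltrans N f : R -> C := fun x => T (refl N%:R f) (N%:R - x).

(** The reversal window may be enlarged without changing the result, which is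
    what makes the pieces consistent and lets a window be moved onto a
    stretch. *)
Lemma ltransE N s f : N%:R <= s -> Lploc p f ->
  \forall x \ae leb, 0 <= x < N%:R -> ltrans N f x = T (refl s f) (s - x).
Proof.
move=> Ns Lf; have := negligible_refl N%:R (T_refl (ler0n _ N) Ns Lf).
apply: aeS => x h /andP[_ xN]; rewrite /ltrans h ?subr_ge0 ?ltW//; congr (T _ _); ring.
Qed.

Lemma ltrans_mono N N' f : (N <= N')%N -> Lploc p f ->
  \forall x \ae leb, 0 <= x < N%:R -> ltrans N f x = ltrans N' f x.
Proof. by move=> NN' Lf; apply: ltransE => //; rewrite ler_nat. Qed.

Lemma ltrans_lin N c f g : Lploc p f -> Lploc p g -> \forall x \ae leb, 0 <= x < N%:R ->
  ltrans N (fun y => c * f y + g y) x = c * ltrans N f x + ltrans N g x.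
Proof.
move=> Lf Lg; have Er h := E_refl (ler0n R N) (f := h).
have := negligible_refl N%:R (bounded_lin c bT (Er _ Lf) (Er _ Lg)).
have <- : refl N%:R (fun y => c * f y + g y) = fun y => c * refl N%:R f y + refl N%:R g y.
  by apply/funext => x; rewrite /refl /cut; case: ifP => // _; rewrite mulr0 addr0.
by apply: aeS => x h /andP[_ xN]; rewrite /ltrans h// subr_ge0 ltW.
Qed.

(** Translating f to the right by t amounts to reversing it on a window
    shorter by t. *)
Lemma ltrans_shift N t f : 0 <= t -> Lploc p f -> \forall x \ae leb, 0 <= x < N%:R ->
  ltrans N (fun y => f (y - t)) x = if t <= x then ltrans N f (x - t) else 0.
Proof.
move=> t0 Lf; have [_ f0 _] := Lf; have [tN|Nt] := leP t N%:R.
  have Nt0 : 0 <= N%:R - t by rewrite subr_ge0.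
  have e : refl N%:R (fun y => f (y - t)) = refl (N%:R - t) f.
    by apply/funext => y; rewrite /refl /cut; case: ifP => // _; congr f; ring.
  have NtN : N%:R - t <= N%:R by rewrite gerBl.
  have h1 := negligible_refl N%:R (T_refl Nt0 NtN Lf).
  have h2 := negligible_refl (N%:R + t) (T_refl_out (ler0n _ N) Lf).
  apply: aeS (aeI h1 h2) => x [e1 e2] /andP[x0 xN].
  rewrite /ltrans e e1 ?subr_ge0 ?(ltW xN)//.
  have -> : N%:R - x + (N%:R - (N%:R - t)) = N%:R + t - x by ring.
  have [tx|xt] := leP t x; first by congr (T _ _); ring.
  by apply: e2; lra.
have e : Eeq (refl N%:R (fun y => f (y - t))) (fun=> 0).
  apply/EeqR; apply: aeT => y y0; rewrite /refl cut_id// f0//; lra.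
have Er := E_refl (ler0n _ N) (Lploc_shift hp t0 Lf).
have /EeqR/(negligible_refl N%:R) := Eeq_trans (bounded_Eeq hp hw bT Er (E0 w hp) e) (bounded_T0 bT).
apply: aeS => x h /andP[x0 xN]; rewrite leNgt (lt_trans xN Nt) /=.
by rewrite /ltrans h// subr_ge0 ltW.
Qed.

Lemma ltrans_meas N f : Lploc p f ->
  cmeasurable setT (fun x => if 0 <= x < N%:R then ltrans N f x else 0).
Proof.
move=> Lf; have m := E_cmeas (ET (E_refl (ler0n _ N) Lf)).
rewrite (_ : (fun x => _) = fun x => if 0 <= x < N%:R then cut (T (refl N%:R f)) (N%:R - x) else 0).
  apply: cmeas_if; [exact: measurable_cob| |exact: cmeas_cst].
  exact: (cmeas_comp (measurable_refl N%:R) m).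
by apply/funext => x; case: ifP => // /andP[x0 xN]; rewrite cut_id ?subr_ge0 ?ltW.
Qed.

Lemma ltrans_fin N f : Lploc p f ->
  (pint p (win N) (fun x => if 0 <= x < N%:R then ltrans N f x else 0)%R < +oo)%E.
Proof.
move=> Lf; have [m _ fi] := E_Lploc hp hw (ET (E_refl (ler0n _ N) Lf)).
apply: le_lt_trans (fi N.+1); rewrite -(pint_refl p N%:R (density_win _) m).
have mr := cmeas_comp (measurable_refl N%:R) m.
apply: (le_pint (density_win N) (density_refl N%:R (density_win _)) (ltrans_meas N Lf) mr) => x.
have [_ w0] := @density_win R N.+1.
rewrite {1}/win; case: ifP => [/andP[x0 xN]|_]; last by rewrite mulr0 mulr_ge0 ?powR_ge0.
rewrite cut_id ?subr_ge0 ?(ltW xN)// /win subr_ge0 (ltW xN) /=.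
by have -> : N%:R - x < N.+1%:R by rewrite -natr1; lra.
Qed.

Lemma energy_refl s h : Lploc p h ->
  energy p w (refl s h) = pint p (fun x => wt p w (s - x)) h.
Proof.
move=> [mh _ _]; have dv := density_refl s (density_wt p hw).
rewrite /energy -[RHS](pint_refl p s dv mh) !pintE; apply: eq_integral => x _.
rewrite subKr /refl cut_cut /cut /wt; case: ifP => _ //.
by rewrite !mulr0.
Qed.

Lemma ltrans_bound (M : R) n s c f : n%:R <= s -> 0 <= c ->
  (forall f, E p w f -> (energy p w (T f) <= (M `^ p)%:E * energy p w f)%E) -> Lploc p f ->
  (pint p (wwin n c (fun x => wt p w (s - x)%R))
      (fun x => if 0 <= x < n%:R then ltrans n f x else 0)%R <=
   (M `^ p)%:E * pint p (wwin n c (fun x => wt p w (s - x)%R)) f)%E.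
Proof.
move=> ns c0 TM Lf; have Ln := Lploc_trunc hp n Lf.
have s0 : 0 <= s := le_trans (ler0n _ n) ns.
have dv := density_refl s (density_wt p hw).
have mA := ltrans_meas n Lf; have [mN N0 _] := Ln.
have Es := E_refl s0 Ln.
rewrite [in leRHS]pint_wwin_trunc.
rewrite (pint_wwin hp c0 dv mA); last by move=> x /negbTE ->.
rewrite (pint_wwin hp c0 dv mN); last by move=> x; exact: (trunc_win Lf).
rewrite muleCA lee_wpmul2l ?lee_fin// -(energy_refl s Ln).
apply: le_trans (TM _ Es); rewrite /energy.
have mT := E_cmeas (ET Es).
rewrite -[leRHS](pint_refl p s (density_wt p hw) mT).
have mr := cmeas_comp (measurable_refl s) mT.
apply: (ae_le_pint dv dv mA mr).
have h1 : \forall x \ae leb, 0 <= x < n%:R -> ltrans n f x = ltrans n (trunc n f) x.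
  have e : Eeq (refl n%:R f) (refl n%:R (trunc n f)).
    apply/EeqR; apply: aeS (ae_neq 0) => y y0 y0'; rewrite /refl !cut_id// trunc_lt//.
    by rewrite ltrBlDr ltrDl lt_neqAle eq_sym y0 y0'.
  have := bounded_Eeq hp hw bT (E_refl (ler0n _ n) Lf) (E_refl (ler0n _ n) Ln) e.
  move=> /EeqR/(negligible_refl n%:R); apply: aeS => x h /andP[_ xn].
  by rewrite /ltrans h// subr_ge0 ltW.
apply: aeS (aeI h1 (ltransE ns Ln)) => x [e1 e2].
apply: ler_wpM2r; first by case: dv.
apply: (powR_le hp (cmod_ge0 _)); case: ifP => [xn|_]; last by rewrite cmod0 cmod_ge0.
by rewrite e1// e2// cut_id// subr_ge0; case/andP: xn => _ /ltW xn; exact: le_trans ns.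
Qed.

End Left.

End Embedding.

(** * Characters of operators that commute with a shift *)

Section Characters.
Context {R : realType}.
Local Notation C := R[i].
Local Notation leb := (@lebesgue_measure R).
Variables (p : R) (w : R -> R).
Hypothesis hp : 1 <= p.
Hypothesis hw : weight w.
Implicit Types (f g h : R -> C) (T U : (R -> C) -> (R -> C)).
#[local] Opaque opnorm Enorm.
Let p0 : 0 < p. Proof. exact: lt_le_trans ltr01 hp. Qed.

Definition energy_bound T (M : R) :=
  forall f, E p w f -> (energy p w (T f) <= (M `^ p)%:E * energy p w f)%E.

Definition invariant (V : R -> (R -> C) -> (R -> C)) T :=
  bounded_operator p w T /\ commutes_with p w V T.

(** Through G every operator that commutes with the shifts S becomes a local
    operator with the same bound M. The densities V_n must not depend on the
    operator, since an operator and its resolvent are compared. *)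
Definition local_model (a : R) (S : R -> (R -> C) -> (R -> C))
    (G : ((R -> C) -> (R -> C)) -> (R -> C) -> (R -> C)) := exists (V : nat -> R -> R) (a' : R),
  [/\ a < a', (forall n, density (V n)) /\ (forall n x, ~~ (0 <= x < n%:R) -> V n x = 0),
      (forall n x, 0 <= x < n%:R -> expR (p * a' * x) <= V n x),
      (forall N : nat, exists2 K : R, 0 <= K & forall n x, 0 <= x < N%:R -> V n x <= K) &
      forall T M, invariant S T -> energy_bound T M -> local_operator p V M (G T)].

Lemma model_char a x0 S G T : local_model a S G -> invariant S T -> (x0 != 0) || (a != 0) ->
  exists m : C,
    (forall (N : nat) f, Lp_itv p 0 N%:R f ->
       cintegrable (fun x => G T f x * lker x0 a x) /\ ell x0 a (G T f) = m * ell x0 a f) /\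
    (forall l U (Mu : R), 0 < Mu -> invariant S U -> energy_bound U Mu ->
       (forall f, Lploc p f -> \forall x \ae leb, G T (G U f) x = l * G U f x + f x) ->
       Mu^-1 <= cmod (m - l)).
Proof.
move=> [V [a' [aa' [dV Vout] Vge Vle GV]]] iT z0.
have [M M0 TM] := bounded_energy hp hw iT.1.
have LT := GV T M iT TM.
have [m hm] := char_exists hp dV Vge Vle aa' z0 LT.
exists m; split => [N f Kf|l U Mu Mu0 iU UM TU].
  split; last exact: (char_compact hp dV Vge Vle aa' LT hm Kf).
  have Lf := Lp_itv_Lploc Kf; have fN x : N%:R <= x -> f x = 0.
    by case: Kf => _ f0 _ Nx; rewrite f0// ltNge Nx andbF.
  have [B B0 fB] := nbound_compact hp dV Vle Lf fN.
  have [TL _ _ _] := LT.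
  have MB : 0 <= M `^ p * B by rewrite mulr_ge0 ?powR_ge0.
  by have := cintegrable_ker hp dV Vge x0 aa' MB (TL _ Lf) (local_operator_nbound LT Lf fB).
by have := resolvent_char hp dV Vge Vle aa' Mu0 LT (GV U Mu iU UM) hm TU.
Qed.

Definition rglue T := glue (rtrans T).
Definition lglue T := glue (ltrans T).

Lemma wwin_ratio (s y : R) : 0 <= s -> 0 <= y -> (w s `^ p)^-1 * wt p w y = (w y / w s) `^ p.
Proof.
move=> s0 y0; have ws := weight_gt0 hw s0; have wy := weight_gt0 hw y0.
have e : w y `^ p = (w y / w s) `^ p * w s `^ p.
  by rewrite -powRM ?divr_ge0 ?(ltW ws) ?(ltW wy)// divfK// gt_eqF.
by rewrite wt_ge0// e mulrC mulfK// gt_eqF// powR_gt0.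
Qed.

Let pexp a x : expR (p * a * x) = expR (a * x) `^ p.
Proof. by rewrite -expRM; congr expR; ring. Qed.

(** The density V_n is the weight on a stretch of length n, normalised by its
    value at the start of the stretch. *)
Lemma right_model a : a < alpha0 p w -> local_model a right_shift rglue.
Proof.
move=> aa; pose a' := (a + alpha0 p w) / 2.
have [aa' a'a] : a < a' /\ a' < alpha0 p w by rewrite /a'; split; lra.
have /choice[s hs] n : exists s, 0 <= s /\
    forall x, 0 <= x <= n%:R -> expR (a' * x) * w s <= w (s + x).
  by have [s s0 sx] := right_stretch hp hw n a'a; exists s.
have s0 n : 0 <= s n by case: (hs n).
have ws n := weight_gt0 hw (s0 n).
have c0 n : 0 <= (w (s n) `^ p)^-1 by rewrite invr_ge0 powR_ge0.
have dv n := density_shift (s n) (density_wt p hw).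
exists (fun n => wwin n (w (s n) `^ p)^-1 (fun x => wt p w (x + s n))), a'; split => //.
- by split=> n => [|x xn]; [exact: density_wwin|exact: wwin_out].
- move=> n x xn; rewrite /wwin xn pexp; have /andP[x0 /ltW xn'] := xn.
  rewrite wwin_ratio ?addr_ge0//; apply: (powR_le hp (expR_ge0 _)).
  by rewrite ler_pdivlMr// addrC; have [_] := hs n; apply; rewrite x0.
- move=> N; have [c cge0 hc] := weight_exp_bound hw.
  exists (expR (c * (N%:R + 1)) `^ p); first exact: powR_ge0.
  move=> n x /andP[x0 xN]; rewrite /wwin; case: ifP => _; last exact: powR_ge0.
  rewrite wwin_ratio ?addr_ge0//; apply: (powR_le hp).
    by rewrite divr_ge0 ?ltW// weight_gt0// addr_ge0.
  rewrite ler_pdivrMr//; have [h _] := hc _ _ (s0 n) x0.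
  rewrite addrC (le_trans h)//; apply: ler_wpM2r; first exact: ltW.
  by rewrite ler_expR ler_wpM2l// lerD2r ltW.
- move=> T M [bT cT] TM; apply: (local_operator_glue hp).
  + by move=> n; exact: density_wwin.
  + by move=> n x; exact: wwin_out.
  + exact: (rtrans_meas hp hw bT).
  + exact: (rtrans_fin hp hw bT).
  + exact: (rtrans_mono hp hw bT cT).
  + exact: (rtrans_lin hp hw bT).
  + exact: (rtrans_shift hp hw bT cT).
  + by move=> n f Lf; exact: (rtrans_bound hp hw bT cT).
Qed.

Lemma left_model a : a < alpha1 p w -> local_model a left_shift lglue.
Proof.
move=> aa; pose a' := (a + alpha1 p w) / 2.
have [aa' a'a] : a < a' /\ a' < alpha1 p w by rewrite /a'; split; lra.
have /choice[s hs] n : exists s, n%:R <= s /\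
    forall x, 0 <= x <= n%:R -> expR (a' * x) * w s <= w (s - x).
  by have [s s0 sx] := left_stretch hp hw n a'a; exists s.
have sn n : n%:R <= s n by case: (hs n).
have s0 n : 0 <= s n := le_trans (ler0n _ n) (sn n).
have ws n := weight_gt0 hw (s0 n).
have c0 n : 0 <= (w (s n) `^ p)^-1 by rewrite invr_ge0 powR_ge0.
have dv n := density_refl (s n) (density_wt p hw).
exists (fun n => wwin n (w (s n) `^ p)^-1 (fun x => wt p w (s n - x))), a'; split => //.
- by split=> n => [|x xn]; [exact: density_wwin|exact: wwin_out].
- move=> n x xn; rewrite /wwin xn pexp; have /andP[x0 /ltW xn'] := xn.
  have sx : 0 <= s n - x by rewrite subr_ge0 (le_trans xn').
  rewrite wwin_ratio//; apply: (powR_le hp (expR_ge0 _)).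
  by rewrite ler_pdivlMr//; have [_] := hs n; apply; rewrite x0.
- move=> N; have [c cge0 hc] := weight_exp_bound hw.
  exists (expR (c * (N%:R + 1)) `^ p); first exact: powR_ge0.
  move=> n x /andP[x0 xN]; rewrite /wwin; case: ifP => [/andP[_ xn]|_]; last exact: powR_ge0.
  have sx : 0 <= s n - x by rewrite subr_ge0 (le_trans (ltW xn)).
  rewrite wwin_ratio//; apply: (powR_le hp).
    by rewrite divr_ge0 ?ltW// weight_gt0.
  rewrite ler_pdivrMr//; have [_ h] := hc _ _ sx x0.
  rewrite subrK in h; rewrite (le_trans h)//; apply: ler_wpM2r; first exact: ltW.
  by rewrite ler_expR ler_wpM2l// lerD2r ltW.
- move=> T M [bT cT] TM; apply: (local_operator_glue hp).
  + by move=> n; exact: density_wwin.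
  + by move=> n x; exact: wwin_out.
  + exact: (ltrans_meas hp hw bT).
  + exact: (ltrans_fin hp hw bT).
  + exact: (ltrans_mono hp hw cT).
  + exact: (ltrans_lin hp hw bT).
  + exact: (ltrans_shift hp hw bT cT).
  + by move=> n f Lf; exact: (ltrans_bound hp hw bT cT).
Qed.

Lemma bounded_ET T f : bounded_operator p w T -> E p w f -> E p w (T f).
Proof. by case=> + _ _; apply. Qed.

Lemma rglueE T N f : invariant right_shift T -> Lploc p f ->
  \forall x \ae leb, 0 <= x < N%:R -> rglue T f x = T (trunc N f) x.
Proof.
move=> [bT cT] Lf; have := glueE (rtrans_mono hp hw bT cT) N Lf.
by apply: aeS.
Qed.

Lemma lglueE T N f : invariant left_shift T -> Lploc p f ->
  \forall x \ae leb, 0 <= x < N%:R -> lglue T f x = T (refl N%:R f) (N%:R - x).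
Proof.
move=> [bT cT] Lf; have := glueE (ltrans_mono hp hw cT) N Lf.
by apply: aeS.
Qed.

Lemma Lploc_rglue T f : invariant right_shift T -> Lploc p f -> Lploc p (rglue T f).
Proof.
move=> [bT cT] Lf.
exact: (Lploc_glue (rtrans_meas hp hw bT) (rtrans_fin hp hw bT) (rtrans_mono hp hw bT cT) Lf).
Qed.

Lemma Lploc_lglue T f : invariant left_shift T -> Lploc p f -> Lploc p (lglue T f).
Proof.
move=> [bT cT] Lf.
exact: (Lploc_glue (ltrans_meas hp hw bT) (ltrans_fin hp hw bT) (ltrans_mono hp hw cT) Lf).
Qed.

Lemma rglue_inverse T l U f : invariant right_shift T -> inverse_of p w T l U -> Lploc p f ->
  \forall x \ae leb, rglue T (rglue U f) x = l * rglue U f x + f x.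
Proof.
move=> iT [bU UT TU] Lf; have [bT cT] := iT.
have cU := inverse_commutes hp hw (bounded_right hp hw) bT (And3 bU UT TU) cT.
have iU : invariant right_shift U by split.
have LU := Lploc_rglue iU Lf.
apply: ae_Rplus => [N|x x0]; last first.
  by rewrite /rglue !glue_lt0//; case: Lf => _ -> // _; rewrite mulr0 addr0.
have EN := E_trunc hp hw N Lf; have EU := bounded_ET bU EN.
have hU := rglueE N iU Lf.
have hUN : \forall x \ae leb, 0 <= x < N%:R -> trunc N (rglue U f) x = U (trunc N f) x.
  by apply: aeS hU => x h xN; rewrite trunc_lt ?h//; case/andP: xN.
have h1 := right_causal hp hw bT cT (ler0n _ N) (E_trunc hp hw N LU) EU hUN.
have /EeqR h2 := TU _ EN.
apply: aeS (aeI (aeI (rglueE N iT LU) hU) (aeI h1 h2)) => x [[e1 e2] [e3 e4]] xN.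
rewrite e1// e3// e2//; have /andP[x0 xN'] := xN.
by rewrite -[f x](trunc_lt f xN') -e4// [RHS]addrC subrK.
Qed.

Lemma lglue_inverse T l U f : invariant left_shift T -> inverse_of p w T l U -> Lploc p f ->
  \forall x \ae leb, lglue T (lglue U f) x = l * lglue U f x + f x.
Proof.
move=> iT [bU UT TU] Lf; have [bT cT] := iT.
have cU := inverse_commutes hp hw (bounded_left hp hw) bT (And3 bU UT TU) cT.
have iU : invariant left_shift U by split.
have LU := Lploc_lglue iU Lf.
apply: ae_Rplus => [N|x x0]; last first.
  by rewrite /lglue !glue_lt0//; case: Lf => _ -> // _; rewrite mulr0 addr0.
have ER := E_refl hp hw (ler0n _ N) Lf; have EU := bounded_ET bU ER.
have hU := lglueE N iU Lf.
have hR : Eeq (refl N%:R (lglue U f)) (U (refl N%:R f)).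
  apply/EeqR; have hr := negligible_refl N%:R hU.
  have ho := T_refl_out hp hw bU cU (ler0n _ N) Lf.
  apply: aeS (aeI (aeI hr ho) (ae_neq 0)) => y [[e1 e2] y0] y0'.
  have [yN|Ny] := leP y N%:R; last by rewrite e2// (refl_out LU).
  rewrite /refl cut_id// e1 ?subKr// subr_ge0 yN /=.
  by rewrite ltrBlDr ltrDl lt_neqAle eq_sym y0.
have /EeqR/(negligible_refl N%:R) h1 := bounded_Eeq hp hw bT (E_refl hp hw (ler0n _ N) LU) EU hR.
have /EeqR/(negligible_refl N%:R) h2 := TU _ ER.
apply: aeS (aeI (aeI (lglueE N iT LU) hU) (aeI h1 h2)) => x [[e1 e2] [e3 e4]] xN.
have xN' : 0 <= N%:R - x by rewrite subr_ge0; case/andP: xN => _ /ltW.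
rewrite e1// e3// e2//; have e5 := e4 xN'.
have <- : refl N%:R f (N%:R - x) = f x by rewrite /refl cut_id// subKr.
by rewrite -e5 [RHS]addrC subrK.
Qed.

(** The eigenvalue m of the functional at z = x0 + i a, together with its
    distance to every point of the resolvent set. *)
Definition character (G : ((R -> C) -> (R -> C)) -> (R -> C) -> (R -> C))
    T x0 a (m : C) :=
  (forall (N : nat) f, Lp_itv p 0 N%:R f ->
     cintegrable (fun x => G T f x * lker x0 a x) /\ ell x0 a (G T f) = m * ell x0 a f) /\
  (forall l U (Mu : R), 0 < Mu -> energy_bound U Mu -> inverse_of p w T l U ->
     Mu^-1 <= cmod (m - l)).

Theorem right_character T x0 a : invariant right_shift T -> a < alpha0 p w ->
  (x0 != 0) || (a != 0) -> exists m, character rglue T x0 a m.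
Proof.
move=> iT aa z0; have [m [h1 h2]] := model_char (right_model aa) iT z0.
exists m; split => // l U Mu Mu0 UM iU; have [bU _ _] := iU.
apply: (h2 l U) => //.
  by split => //; exact: (inverse_commutes hp hw (bounded_right hp hw) iT.1 iU iT.2).
by move=> f Lf; exact: rglue_inverse iT iU Lf.
Qed.

Theorem left_character T x0 a : invariant left_shift T -> a < alpha1 p w ->
  (x0 != 0) || (a != 0) -> exists m, character lglue T x0 a m.
Proof.
move=> iT aa z0; have [m [h1 h2]] := model_char (left_model aa) iT z0.
exists m; split => // l U Mu Mu0 UM iU; have [bU _ _] := iU.
apply: (h2 l U) => //.
  by split => //; exact: (inverse_commutes hp hw (bounded_left hp hw) iT.1 iU iT.2).
by move=> f Lf; exact: lglue_inverse iT iU Lf.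
Qed.

End Characters.

(** * Neumann series *)

Section ComplexSequences.
Context {R : realType}.
Local Notation C := R[i].
Implicit Types (u v : nat -> C).

Definition cconv u (z : C) : Prop :=
  (complex.Re (u n) @[n --> \oo] --> complex.Re z) /\
  (complex.Im (u n) @[n --> \oo] --> complex.Im z).

(** A limit that is defined for every sequence and measurable in parameters. *)
Definition limC u : C :=
  fine (limn_esup (fun n => (complex.Re (u n))%:E)) +i*
  fine (limn_esup (fun n => (complex.Im (u n))%:E)).

Lemma cconv_limC u z : cconv u z -> limC u = z.
Proof.
have H (r : nat -> R) l : r @ \oo --> l -> fine (limn_esup (fun n => (r n)%:E)) = l.
  move=> rl; have /cvg_limn_einf_sup [_ ->] // : (r n)%:E @[n --> \oo] --> l%:E.
  by apply: cvg_EFin; [exact: nearW|exact: rl].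
by move=> [h1 h2]; rewrite /limC (H _ _ h1) (H _ _ h2); case: z {h1 h2}.
Qed.

Lemma cconv_unique u z z' : cconv u z -> cconv u z' -> z = z'.
Proof. by move=> /cconv_limC <- /cconv_limC <-. Qed.

Lemma cconv_cst z : cconv (fun=> z) z.
Proof. by split; exact: cvg_cst. Qed.

Lemma cconv_comb c u v z z' : cconv u z -> cconv v z' ->
  cconv (fun n => c * u n + v n) (c * z + z').
Proof.
move=> [u1 u2] [v1 v2]; split.
- under eq_fun do rewrite ReD ReM; rewrite ReD ReM.
  by apply: cvgD => //; apply: cvgB; apply: cvgMr.
- under eq_fun do rewrite ImD ImM; rewrite ImD ImM.
  by apply: cvgD => //; apply: cvgD; apply: cvgMr.
Qed.

Lemma cconv_le u z (B : R) : (forall n, cmod (u n) <= B) -> cconv u z -> cmod z <= B.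
Proof.
move=> uB [u1 u2]; have B0 : 0 <= B := le_trans (cmod_ge0 _) (uB 0).
rewrite cmodE -(ger0_norm B0) -sqrtr_sqr ler_wsqrtr//.
have cv : complex.Re (u n) ^+ 2 + complex.Im (u n) ^+ 2 @[n --> \oo] -->
    complex.Re z ^+ 2 + complex.Im z ^+ 2.
  by apply: cvgD; rewrite !expr2; [under eq_fun do rewrite expr2|under eq_fun do rewrite expr2];
    apply: cvgM.
rewrite -(cvg_lim _ cv)//; apply: limr_le; first by apply/cvg_ex; eexists; exact: cv.
apply: nearW => n; have := uB n; rewrite cmodE -{1}(ger0_norm B0) -sqrtr_sqr.
by rewrite ler_sqrt// sqr_ge0.
Qed.

Lemma cconv_shift u z : cconv u z -> cconv (fun n => u n.+1) z.
Proof.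
move=> [u1 u2]; split.
- by rewrite (cvg_shiftS (fun n => complex.Re (u n))).
- by rewrite (cvg_shiftS (fun n => complex.Im (u n))).
Qed.

Lemma abs_cconv (F : nat -> C) (B : R) :
  (forall N, \sum_(n < N) cmod (F n) <= B) ->
  exists z, cconv (fun N => \sum_(n < N) F n) z.
Proof.
move=> FB.
have ReS N : complex.Re (\sum_(n < N) F n) = \sum_(0 <= n < N) complex.Re (F n).
  by rewrite big_mkord; elim/big_ind2 : _ => // x1 x2 y1 y2 <- <-; rewrite ReD.
have ImS N : complex.Im (\sum_(n < N) F n) = \sum_(0 <= n < N) complex.Im (F n).
  by rewrite big_mkord; elim/big_ind2 : _ => // x1 x2 y1 y2 <- <-; rewrite ImD.
have H (r : nat -> R) : (forall n, `|r n| <= cmod (F n)) -> cvgn (series r).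
  move=> rF; apply: normed_cvg; apply: nondecreasing_is_cvgn.
    by apply: nondecreasing_series => n _ _; exact: normr_ge0.
  exists B => _ [N _ <-]; apply: le_trans (FB N); rewrite /normed_series_of /series /= big_mkord.
  by apply: ler_sum => n _; exact: rF.
have /H c1 n : `|complex.Re (F n)| <= cmod (F n) by exact: Re_le_cmod.
have /H c2 n : `|complex.Im (F n)| <= cmod (F n) by exact: Im_le_cmod.
exists (limn (series (fun n => complex.Re (F n))) +i* limn (series (fun n => complex.Im (F n)))).
split => /=.
- by under eq_fun do rewrite ReS; exact: c1.
- by under eq_fun do rewrite ImS; exact: c2.
Qed.

End ComplexSequences.

Section SummableSeries.
Context {R : realType}.
Local Notation C := R[i].
Local Notation leb := (@lebesgue_measure R).
Variable p : R.
Hypothesis hp : 1 <= p.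
Let p0 : 0 < p. Proof. exact: lt_le_trans ltr01 hp. Qed.

(** Iterating [powR_addle], each time with the same parameter th. The factors
    th^(1 - p) accumulate geometrically, and they are compensated when the
    energies of the terms decrease like th^(pn). *)
Lemma powR_sum (th : R) (a : nat -> R) N : 0 < th -> th < 1 -> (forall n, 0 <= a n) ->
  (\sum_(n < N) a n) `^ p <=
  \sum_(n < N) (1 - th) `^ (1 - p) * (th `^ (1 - p)) ^+ n * a n `^ p.
Proof.
move=> t0 t1; elim: N a => [|N ih] a a0; first by rewrite !big_ord0 powR0 ?gt_eqF.
rewrite !big_ord_recl /= expr0 mulr1.
apply: (le_trans (powR_addle hp t0 t1 (a0 _) (sumr_ge0 _ (fun i _ => a0 _)))).
rewrite lerD2l; apply: (le_trans (ler_wpM2l (powR_ge0 _ _) (ih (fun n => a n.+1) (fun n => a0 _)))).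
rewrite mulr_sumr; apply: ler_sum => n _; rewrite exprS.
by rewrite le_eqVlt; apply/orP; left; apply/eqP; rewrite /bump /=; ring.
Qed.

Lemma cmod_sum (F : nat -> C) N : cmod (\sum_(n < N) F n) <= \sum_(n < N) cmod (F n).
Proof.
elim: N => [|N ih]; first by rewrite !big_ord0 cmod0.
by rewrite !big_ord_recr /= (le_trans (cmodD _ _))// lerD2r.
Qed.

Lemma cmeas_limC (F : nat -> R -> C) : (forall n, cmeasurable setT (F n)) ->
  cmeasurable setT (fun x => limC (fun n => F n x)).
Proof.
move=> mF; split; apply: (measurableT_comp (fine_measurable _)) => //;
  apply: measurable_fun_limn_esup => n; apply/measurable_EFinP; [exact: (mF n).1|exact: (mF n).2].
Qed.

Lemma cmeas_sum (F : nat -> R -> C) N : (forall n, cmeasurable setT (F n)) ->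
  cmeasurable setT (fun x => \sum_(n < N) F n x).
Proof.
move=> mF; elim: N => [|N ih].
  by under eq_fun do rewrite big_ord0; exact: cmeas_cst.
by under eq_fun do rewrite big_ord_recr; exact: cmeasD.
Qed.

(** A series whose terms have norms O(th^n) converges almost everywhere and
    its sum has the expected norm. The p-th powers of its partial sums are
    dominated by one integrable function. *)
Lemma summable_pint v (F : nat -> R -> C) (th B : R) :
  density v -> (forall n, cmeasurable setT (F n)) -> 0 < th -> th < 1 -> 0 <= B ->
  (forall n, (pint p v (F n) <= (B * (th `^ p) ^+ n)%:E)%E) ->
  (\forall x \ae leb, 0 < v x -> cconv (fun N => \sum_(n < N) F n x) (limC (fun N => \sum_(n < N) F n x))) /\
  (pint p v (fun x => limC (fun N => \sum_(n < N) F n x))%R <= ((1 - th) `^ (- p) * B)%:E)%E.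
Proof.
move=> dv mF t0 t1 B0 FB; have [mv v0] := dv.
have t10 : 0 < 1 - th by rewrite subr_gt0.
pose c n : R := (1 - th) `^ (1 - p) * (th `^ (1 - p)) ^+ n.
have c0 n : 0 <= c n by rewrite mulr_ge0 ?exprn_ge0 ?powR_ge0.
pose h n x : \bar R := (c n * (cmod (F n x) `^ p * v x))%:E.
have hE n : h n = fun x => ((c n)%:E * (cmod (F n x) `^ p * v x)%:E)%E.
  by apply/funext => x; rewrite -EFinM.
have h0 n x : (0 <= h n x)%E by rewrite lee_fin mulr_ge0// mulr_ge0 ?powR_ge0.
have mh n : measurable_fun setT (h n).
  by rewrite hE; apply: measurable_funeM; exact: measurable_pint.
have ih n : (\int[leb]_x h n x <= ((1 - th) `^ (1 - p) * B * th ^+ n)%:E)%E.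
  rewrite hE ge0_integralZl_EFin//; last 2 first.
  - by move=> x _; rewrite lee_fin mulr_ge0 ?powR_ge0.
  - exact: measurable_pint.
  rewrite -pintE; apply: (@le_trans _ _ ((c n)%:E * (B * (th `^ p) ^+ n)%:E)%E).
    by rewrite lee_wpmul2l ?lee_fin.
  rewrite -EFinM lee_fin le_eqVlt; apply/orP; left; apply/eqP.
  rewrite /c -!mulrA; congr (_ * _); rewrite mulrCA; congr (_ * _).
  by rewrite -exprMn -powRD ?subrK ?powRr1 ?(ltW t0)// (gt_eqF t0) implybT.
(* The integrable function that dominates the p-th powers of all partial
   sums. *)
pose H x : \bar R := (\sum_(n <oo) h n x)%E.
have mH : measurable_fun setT H by apply: ge0_emeasurable_sum.
have iH : (\int[leb]_x H x <= ((1 - th) `^ (- p) * B)%:E)%E.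
  rewrite integral_nneseries//; apply: lime_le.
    by apply: is_cvg_nneseries => n _ _; exact: integral_ge0.
  apply: nearW => N.
  apply: (@le_trans _ _ (\sum_(0 <= n < N) ((1 - th) `^ (1 - p) * B * th ^+ n)%:E)%E).
    by apply: lee_sum.
  rewrite sumEFin lee_fin -mulr_sumr.
  have -> : (1 - th) `^ (- p) * B = (1 - th) `^ (1 - p) * B * (1 - th)^-1.
    rewrite -powR_inv1 ?(ltW t10)// mulrAC -powRD ?(gt_eqF t10) ?implybT//.
    by congr (_ `^ _ * _); ring.
  rewrite ler_wpM2l ?mulr_ge0 ?powR_ge0// big_mkord.
  rewrite -[leRHS]mul1r ler_pdivlMr//.
  have -> : (\sum_(i < N) th ^+ i) * (1 - th) = 1 - th ^+ N.
    by rewrite -[RHS]opprB subrX1 -mulNr opprB mulrC.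
  by rewrite gerBl exprn_ge0// ltW.
have H0 x : (0 <= H x)%E by apply: nneseries_ge0.
have intH : leb.-integrable setT H.
  apply/integrableP; split => //.
  under eq_integral do rewrite gee0_abs//.
  exact: le_lt_trans iH (ltry _).
have key x : H x \is a fin_num -> forall N, (\sum_(n < N) cmod (F n x)) `^ p * v x <= fine (H x).
  move=> Hfin N; rewrite -lee_fin fineK//.
  apply: le_trans (nneseries_lim_ge N (fun n _ _ => h0 n x)).
  rewrite big_mkord sumEFin lee_fin.
  apply: (le_trans (ler_wpM2r (v0 x) (powR_sum N t0 t1 (fun n => cmod_ge0 (F n x))))).
  rewrite mulr_suml; by apply: ler_sum => n _; rewrite /c mulrA.
pose b x := (fine (H x) / v x) `^ p^-1.
have key2 x : H x \is a fin_num -> 0 < v x -> forall N, \sum_(n < N) cmod (F n x) <= b x.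
  move=> Hfin vx N; have s0 : 0 <= \sum_(n < N) cmod (F n x) by apply: sumr_ge0 => n _; exact: cmod_ge0.
  rewrite -(powR_Kinv hp s0); apply: ge0_ler_powR; rewrite ?nnegrE ?invr_ge0 ?powR_ge0 ?(ltW p0)//.
    by rewrite divr_ge0 ?fine_ge0.
  by rewrite ler_pdivlMr//; exact: key.
have cv x : H x \is a fin_num -> 0 < v x ->
    cconv (fun N => \sum_(n < N) F n x) (limC (fun N => \sum_(n < N) F n x)).
  move=> Hfin vx; have [z hz] := abs_cconv (F := fun n => F n x) (key2 x Hfin vx).
  by rewrite (cconv_limC hz).
have aeH := integrable_ae measurableT intH.
split; first by apply: aeS aeH => x hx vx; apply: cv => //; exact: hx.
apply: le_trans iH; rewrite pintE; apply: ae_ge0_le_integral => //.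
- by move=> x _; rewrite lee_fin mulr_ge0 ?powR_ge0.
- by apply: measurable_pint => //; apply: cmeas_limC => n; exact: cmeas_sum.
- apply: aeS aeH => x /(_ I) Hfin _; rewrite -(fineK Hfin) lee_fin.
  move: (v0 x); rewrite le_eqVlt => /orP[/eqP <-|vx]; first by rewrite mulr0 fine_ge0.
  rewrite -ler_pdivlMr// -(powR_invK hp (divr_ge0 (fine_ge0 (H0 x)) (ltW vx))).
  apply: (powR_le hp (cmod_ge0 _)); apply: (cconv_le _ (cv x Hfin vx)) => N.
  by apply: (le_trans (cmod_sum (fun n => F n x) N)); exact: key2.
Qed.

End SummableSeries.

Section Neumann.
Context {R : realType}.
Local Notation C := R[i].
Local Notation leb := (@lebesgue_measure R).
Variables (p : R) (w : R -> R).
Hypothesis hp : 1 <= p.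
Hypothesis hw : weight w.
Implicit Types (f g h : R -> C).
#[local] Opaque opnorm Enorm.
Let p0 : 0 < p. Proof. exact: lt_le_trans ltr01 hp. Qed.

Variables (b : R -> bool) (phi : R -> R).
Let T (f : R -> C) : R -> C := fun x => if b x then f (phi x) else 0.
Hypothesis phi_ge0 : forall x, 0 <= x -> b x -> 0 <= phi x.
Hypothesis phi_null : forall P : R -> Prop, (\forall x \ae leb, P x) -> \forall x \ae leb, P (phi x).
Hypothesis bT : bounded_operator p w T.
Variables (K rho : R) (l : C).
Hypothesis K0 : 0 < K.
Hypothesis rho0 : 0 < rho.
Hypothesis TK : forall n f, E p w f ->
  (energy p w (iter n T f) <= ((K * rho ^+ n) `^ p)%:E * energy p w f)%E.
Hypothesis rho_l : rho < cmod l.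

Let l0 : l != 0.
Proof. by apply/eqP => le; move: (lt_trans rho0 rho_l); rewrite le cmod0 ltxx. Qed.

Let ET n f : E p w f -> E p w (iter n T f).
Proof. by move=> Ef; elim: n => [|n ih]; [exact: Ef|exact: (bounded_ET bT ih)]. Qed.

Let Tcomb c f g : T (fun x => c * f x + g x) = fun x => c * T f x + T g x.
Proof. by apply/funext => x; rewrite /T; case: ifP => // _; rewrite mulr0 addr0. Qed.

Let TnComb n c f g : iter n T (fun x => c * f x + g x) = fun x => c * iter n T f x + iter n T g x.
Proof. by elim: n => //= n ->; exact: Tcomb. Qed.

Let F f n x : C := - (l^-1 ^+ n.+1) * cut (iter n T f) x.
Let S f N x : C := \sum_(n < N) F f n x.
Let U f x : C := limC (fun N => S f N x).

Let th := rho / cmod l.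
Let cl0 : 0 < cmod l. Proof. exact: lt_trans rho_l. Qed.
Let th0 : 0 < th. Proof. by rewrite divr_gt0. Qed.
Let th1 : th < 1. Proof. by rewrite ltr_pdivrMr// mul1r. Qed.

Let mF f n : E p w f -> cmeasurable setT (F f n).
Proof.
by move=> Ef; apply: cmeasM; [exact: cmeas_cst|exact: (E_cmeas hp (ET n Ef))].
Qed.

Let B0 : R := (K / cmod l) `^ p.

Let FB f n : E p w f ->
  (pint p (wt p w) (F f n) <= (B0 * fine (energy p w f) * (th `^ p) ^+ n)%:E)%E.
Proof.
move=> Ef; rewrite pintZ//; last 2 first.
- exact: density_wt.
- exact: (E_cmeas hp (ET n Ef)).
rewrite cmodN cmodX cmodV.
apply: (@le_trans _ _ ((((cmod l)^-1 ^+ n.+1) `^ p)%:E * (((K * rho ^+ n) `^ p)%:E * energy p w f))%E).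
  by rewrite lee_wpmul2l ?lee_fin ?powR_ge0//; exact: TK.
rewrite -(fineK (energy_fin hp hw Ef)) -!EFinM lee_fin mulrA.
rewrite [leRHS]mulrAC ler_wpM2r ?fine_ge0 ?energy_ge0//.
have i0 : 0 <= (cmod l)^-1 by rewrite invr_ge0 ltW.
rewrite -powRM ?exprn_ge0 ?mulr_ge0 ?exprn_ge0 ?(ltW K0) ?(ltW rho0)//.
have -> : (th `^ p) ^+ n = (th ^+ n) `^ p.
  by rewrite -powR_mulrn ?powR_ge0// -powRrM mulrC powRrM powR_mulrn// ltW.
rewrite -powRM ?exprn_ge0 ?(ltW th0) ?divr_ge0 ?(ltW K0) ?(ltW cl0)//.
rewrite le_eqVlt; apply/orP; left; apply/eqP; congr (_ `^ _).
by rewrite exprS /th exprMn; ring.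
Qed.

Let fE0 f : 0 <= B0 * fine (energy p w f).
Proof. by rewrite mulr_ge0 ?powR_ge0// fine_ge0// energy_ge0. Qed.

Let conv f : E p w f -> \forall x \ae leb, 0 <= x -> cconv (fun N => S f N x) (U f x).
Proof.
move=> Ef; have [h _] := summable_pint hp (density_wt p hw) (fun n => mF n Ef) th0 th1 (fE0 f) (fun n => FB n Ef).
by apply: aeS h => x h x0; apply: h; rewrite wt_ge0// powR_gt0// weight_gt0.
Qed.

Let S_comb c f g N x : S (fun x => c * f x + g x) N x = c * S f N x + S g N x.
Proof.
rewrite /S mulr_sumr -big_split /=; apply: eq_bigr => n _.
by rewrite /F TnComb cutD; ring.
Qed.

Let Fx f n x : 0 <= x -> F f n x = - (l^-1 ^+ n.+1) * iter n T f x.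
Proof. by move=> x0; rewrite /F cut_id. Qed.

Let F0 f : E p w f -> \forall x \ae leb, 0 <= x -> cconv (fun N => l^-1 ^+ N * iter N T f x) 0.
Proof.
move=> /conv; apply: aeS => x h x0; have hx := h x0.
have := cconv_comb (- l) (cconv_comb (-1) hx (cconv_shift hx)) (cconv_cst 0).
rewrite mulN1r addNr mulr0 addr0; congr cconv; apply/funext => N.
rewrite mulN1r addr0 /S big_ord_recr /= addKr Fx// exprS; field.
exact: l0.
Qed.

Let U_left f : E p w f -> Eeq (U (fun x => T f x - l * f x)) f.
Proof.
move=> Ef; apply/EeqR.
have Eg : E p w (fun x => T f x - l * f x).
  have := E_comb hp hw (- l) Ef (ET 1 Ef); congr (E p w _).
  by apply/funext => x; rewrite mulNr addrC.
apply: aeS (aeI (conv Eg) (F0 Ef)) => x [h1 h2] x0.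
apply: cconv_unique (h1 x0) _.
have := cconv_comb (-1) (h2 x0) (cconv_cst (f x)).
rewrite mulr0 add0r; congr cconv; apply/funext => N.
elim: N => [|N ih]; first by rewrite /S big_ord0 expr0 mul1r mulN1r addNr.
rewrite /S big_ord_recr /= -[X in _ = X + _]/(S _ N x) -ih Fx//.
have -> : iter N T (fun x => T f x - l * f x) = fun x => - l * iter N T f x + iter N.+1 T f x.
  rewrite iterSr -TnComb; congr (iter N T _).
  by apply/funext => y; rewrite mulNr addrC.
rewrite /= exprS; field; exact: l0.
Qed.

Let U_right f : E p w f -> Eeq (fun x => T (U f) x - l * U f x) f.
Proof.
move=> Ef; apply/EeqR.
have c1 := conv Ef; have c2 := phi_null c1.
apply: aeS (aeI (aeI c1 c2) (F0 Ef)) => x [[h1 h2] h3] x0.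
have cT : cconv (fun N => T (S f N) x) (T (U f) x).
  rewrite /T; case: ifP => bx; last exact: cconv_cst.
  by apply: h2; exact: phi_ge0.
have := cconv_comb (- l) (h1 x0) cT; rewrite mulNr addrC => c3.
apply: cconv_unique c3 _.
have := cconv_comb (-1) (h3 x0) (cconv_cst (f x)).
rewrite mulr0 add0r; congr cconv; apply/funext => N.
have TF n : T (F f n) x = - (l^-1 ^+ n.+1) * iter n.+1 T f x.
  have TE g : T g x = if b x then g (phi x) else 0 by [].
  rewrite iterS !TE; case: ifP => bx; last by rewrite mulr0.
  by rewrite Fx//; exact: phi_ge0.
elim: N => [|N ih].
  rewrite /S big_ord0 expr0 mul1r mulN1r addNr mulr0 add0r /T; case: ifP => // _.
  by rewrite big_ord0.
have TS : T (S f N.+1) x = T (S f N) x + T (F f N) x.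
  by rewrite /T /S; case: ifP => _; rewrite ?addr0// big_ord_recr.
rewrite TS {1}/S big_ord_recr /= -[X in _ = - l * (X + _) + _]/(S f N x) mulrDr.
rewrite [RHS](_ : _ = (- l * S f N x + T (S f N) x) + (- l * F f N x + T (F f N) x)); last by ring.
rewrite -ih TF Fx// /= exprS; field; exact: l0.
Qed.

(** The inverse of T - l is - sum of l^(-n-1) T^n. It is formed pointwise: T
    is a composition operator, so it passes to almost everywhere limits, and
    the identities reduce to telescoping partial sums. *)
Theorem neumann_inverse : exists V, inverse_of p w T l V.
Proof.
exists U; split; [|exact: U_left|exact: U_right].
pose M : R := (1 - th)^-1 * (K / cmod l).
have t10 : 0 < 1 - th by rewrite subr_gt0.
have M0 : 0 <= M by rewrite mulr_ge0 ?invr_ge0 ?divr_ge0 ?(ltW t10) ?(ltW K0) ?(ltW cl0).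
have mU f : E p w f -> cmeasurable setT (U f).
  by move=> Ef; apply: cmeas_limC => N; apply: cmeas_sum => n; exact: mF.
have mcU f : E p w f -> cmeasurable setT (cut (U f)).
  by move=> Ef; apply: cmeas_if; [exact: measurable_geb|exact: mU|exact: cmeas_cst].
apply: (bounded_operatorP hp hw M0 mcU).
- move=> c f g Ef Eg; apply/EeqR.
  have Efg := E_comb hp hw c Ef Eg.
  apply: aeS (aeI (aeI (conv Ef) (conv Eg)) (conv Efg)) => x [[h1 h2] h3] x0.
  apply: cconv_unique (h3 x0) _.
  under eq_fun do rewrite S_comb.
  exact: cconv_comb (h1 x0) (h2 x0).
- move=> f Ef; have [_ h] := summable_pint hp (density_wt p hw) (fun n => mF n Ef) th0 th1 (fE0 f) (fun n => FB n Ef).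
  apply: (@le_trans _ _ (pint p (wt p w) (U f))).
    apply: (le_pint (density_wt p hw) (density_wt p hw) (mcU _ Ef) (mU _ Ef)) => x.
    rewrite /wt; case: (leP 0 x) => x0; last by rewrite !mulr0.
    by rewrite cut_id.
  apply: (le_trans h); rewrite -[in leRHS](fineK (energy_fin hp hw Ef)) -EFinM lee_fin mulrA.
  rewrite ler_wpM2r ?fine_ge0 ?energy_ge0//.
  rewrite /M powRM ?invr_ge0 ?divr_ge0 ?(ltW t10) ?(ltW K0) ?(ltW cl0)//.
  by rewrite -powR_inv1 ?(ltW t10)// -powRrM mulN1r.
Qed.

End Neumann.

Section DiscUpper.
Context {R : realType}.
Local Notation C := R[i].
Local Notation leb := (@lebesgue_measure R).
Variables (p : R) (w : R -> R).
Hypothesis hp : 1 <= p.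
Hypothesis hw : weight w.
#[local] Opaque opnorm Enorm alpha0 alpha1.

(** Any value above e^(al t) leaves room for a rate r > al, for which
    [growth_upper] bounds the powers of the shift. *)
Lemma rate_between (al t c : R) : 0 < t -> expR (al * t) < c ->
  exists2 r, al < r & expR (r * t) < c.
Proof.
move=> t0 ec; have c0 : 0 < c := lt_trans (expR_gt0 _) ec.
have lc : al < ln c / t by rewrite ltr_pdivlMr// -ltr_expR lnK.
exists ((al + ln c / t) / 2); first by move: lc; set u := ln c / t; lra.
rewrite -[ltRHS](@lnK _ c)// ltr_expR -ltr_pdivlMr//; move: lc; set u := ln c / t; lra.
Qed.

Lemma cut_iter_right n (t : R) (f : R -> C) : 0 <= t ->
  cut (iter n (right_shift t) f) = cut (right_shift (n%:R * t) f).
Proof.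
move=> t0; elim: n => [|n ih].
  by rewrite mul0r cut_right//; apply/funext => x; rewrite subr0.
rewrite iterS cut_right// ih !cut_right ?mulr_ge0 ?ler0n//; apply/funext => x.
by congr cut; rewrite -nat1r; ring.
Qed.

Lemma cut_iter_left n (t : R) (f : R -> C) : 0 <= t ->
  cut (iter n (left_shift t) f) = cut (left_shift (n%:R * t) f).
Proof.
move=> t0; elim: n => [|n ih].
  by rewrite mul0r cut_left//; apply/funext => x; rewrite addr0 /cut; case: ifP => // ->.
rewrite iterS cut_left// ih !cut_left ?mulr_ge0 ?ler0n//; apply/funext => x.
case: (leP 0 x) => // x0; rewrite addr_ge0//.
by congr cut; rewrite -nat1r; ring.
Qed.

Lemma right_spectrum_sub (t : R) : 0 < t ->
  spectrum p w (right_shift t) `<=` [set z : C | cmod z <= expR (alpha0 p w * t)].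
Proof.
move=> t0 l sp /=; rewrite leNgt; apply/negP => /(rate_between t0)[r ar rl]; apply: sp.
have [K K0 hK] := right_growth_upper hp hw ar.
have t0' := ltW t0.
apply: (@neumann_inverse _ _ _ hp hw (fun x => t <= x) (fun x => x - t) _ _
  (bounded_right hp hw t0') K (expR (r * t))) => //.
- by move=> x _; rewrite subr_ge0.
- by move=> P; exact: negligible_shift.
- exact: expR_gt0.
- move=> n f Ef.
  rewrite (energy_cut p w (cut_iter_right n f t0')) -expRM_natr.
  have -> : r * t * n%:R = r * (n%:R * t) by ring.
  by apply: hK => //; rewrite mulr_ge0.
Qed.

Lemma left_spectrum_sub (t : R) : 0 < t ->
  spectrum p w (left_shift t) `<=` [set z : C | cmod z <= expR (alpha1 p w * t)].
Proof.
move=> t0 l sp /=; rewrite leNgt; apply/negP => /(rate_between t0)[r ar rl]; apply: sp.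
have [K K0 hK] := left_growth_upper hp hw ar.
have t0' := ltW t0.
apply: (@neumann_inverse _ _ _ hp hw (fun x => 0 <= x) (fun x => x + t) _ _
  (bounded_left hp hw t0') K (expR (r * t))) => //.
- by move=> x x0 _; rewrite addr_ge0.
- by move=> P; exact: negligible_shift.
- exact: expR_gt0.
- move=> n f Ef.
  rewrite (energy_cut p w (cut_iter_left n f t0')) -expRM_natr.
  have -> : r * t * n%:R = r * (n%:R * t) by ring.
  by apply: hK => //; rewrite mulr_ge0.
Qed.

End DiscUpper.

(** * Spectra of the shifts *)

Section ShiftSpectrum.
Context {R : realType}.
Local Notation C := R[i].
Local Notation leb := (@lebesgue_measure R).
Variables (p : R) (w : R -> R).
Hypothesis hp : 1 <= p.
Hypothesis hw : weight w.
Implicit Types (f g h : R -> C).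
#[local] Opaque opnorm Enorm alpha0 alpha1.
Let p0 : 0 < p. Proof. exact: lt_le_trans ltr01 hp. Qed.

(** The indicator function of a short interval. *)
Lemma ell_test (x0 a : R) : exists N (f : R -> C), [/\ Lp_itv p 0 N%:R f,
  cintegrable (fun x => f x * lker x0 a x) & ell x0 a f != 0].
Proof.
pose V (n : nat) (x : R) : R := if 0 <= x < n%:R then expR (p * (a + 1) * x) else 0.
have dV n : density (V n).
  split; last by move=> x; rewrite /V; case: ifP => // _; rewrite expR_ge0.
  apply: measurable_fun_ifT => //; first exact: measurable_cob.
  by apply: measurableT_comp => //; exact: measurable_funM.
have Vge n x : 0 <= x < n%:R -> expR (p * (a + 1) * x) <= V n x by rewrite /V => ->.
have Vle (N : nat) : exists2 K : R, 0 <= K & forall n x, 0 <= x < N%:R -> V n x <= K.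
  exists (expR (`|p * (a + 1)| * N%:R)); first exact: expR_ge0.
  move=> n x /andP[x0' xN]; rewrite /V; case: ifP => _; last exact: expR_ge0.
  rewrite ler_expR (le_trans (ler_norm _))// normrM (ger0_norm x0').
  by rewrite ler_wpM2l// ltW.
have aa' : a < a + 1 by rewrite ltrDl.
have ne := ell_step_neq0 hp dV Vge Vle x0 aa'.
set s := _^-1 in ne; pose N := `|Num.ceil s|.+1.
have sN : s <= N%:R.
  by rewrite (le_trans (ceil_ge s))// -natr1 -[leLHS]addr0 lerD// natr_absz ler_int ler_norm.
have Ls := Lploc_step hp s.
have [B B0 sB] := nbound_compact hp dV Vle Ls (@step_out _ s).
exists N, (step s); split; [|exact: (cintegrable_ker hp dV Vge x0 aa' B0 Ls sB)|exact: ne].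
by apply: (Lploc_Lp_itv hp Ls) => x Nx; apply: step_out; exact: le_trans Nx.
Qed.

Lemma rglue_shift t (N : nat) f : 0 <= t -> Lp_itv p 0 N%:R f ->
  \forall x \ae leb, rglue (right_shift t) f x = f (x - t).
Proof.
move=> t0 Kf; have Lf := Lp_itv_Lploc Kf; have [_ f0 _] := Lf.
have iT : invariant p w right_shift (right_shift t).
  split; first exact: bounded_right.
  by move=> s s0 g _; rewrite -!right_shiftD// addrC; exact: Eeq_refl.
apply: ae_Rplus => [M|x x0]; last by rewrite /rglue glue_lt0// f0//; lra.
apply: aeS (rglueE hp hw M iT Lf) => x h xM; rewrite h// /right_shift.
have [tx|tx] := leP t x; last by rewrite f0// subr_lt0.
by rewrite trunc_lt//; case/andP: xM => _; lra.
Qed.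

Lemma lglue_shift t (N : nat) f : 0 <= t -> Lp_itv p 0 N%:R f ->
  \forall x \ae leb, lglue (left_shift t) f x = f (x - t).
Proof.
move=> t0 Kf; have Lf := Lp_itv_Lploc Kf; have [_ f0 _] := Lf.
have iT : invariant p w left_shift (left_shift t).
  split; first exact: bounded_left.
  by move=> s s0 g _; rewrite -!left_shiftD// addrC; exact: Eeq_refl.
apply: ae_Rplus => [M|x x0]; last by rewrite /lglue glue_lt0// f0//; lra.
apply: aeS (lglueE hp hw M iT Lf) => x h xM; rewrite h// /left_shift /refl.
have /andP[x0 xM'] := xM; have e : 0 <= M%:R - x by rewrite subr_ge0 ltW.
have e' : 0 <= M%:R - x + t by apply: addr_ge0.
rewrite e (cut_id _ e').
by have -> : M%:R - (M%:R - x + t) = x - t by ring.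
Qed.

(** The extension of the shift is the translation by t, which multiplies the
    functional by its kernel at t. *)
Lemma character_shift G T x0 a t m : 
  (forall N f, Lp_itv p 0 N%:R f -> \forall x \ae leb, G T f x = f (x - t)) ->
  character p w G T x0 a m -> m = lker x0 a t.
Proof.
move=> GT [hm _]; have [N [f [Kf fi fn]]] := ell_test x0 a.
have [Gi Gm] := hm N f Kf.
apply: (mulIf fn); rewrite -Gm /ell -cintegralZ//.
have [mf _] := fi.
rewrite -[RHS](cintegral_shift (- t)); last by apply: cmeasM => //; exact: cmeas_cst.
apply: eq_cintegral_ae; first by case: Gi.
  apply: cmeasM; first exact: cmeas_cst.
  exact: (cmeas_comp (measurable_shift (- t)) mf).
apply: aeS (GT N f Kf) => x ->.
by rewrite [RHS]mulrCA -lkerD [t + _]addrC subrK.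
Qed.

Lemma polar (z : C) : exists th : R, z = expi th * (cmod z)%:C.
Proof.
have [->|z0] := eqVneq z 0; first by exists 0; rewrite cmod0 mulr0.
have c0 := cmod_gt0 z0.
have sq : complex.Re z ^+ 2 + complex.Im z ^+ 2 = cmod z ^+ 2.
  by rewrite cmodE sqr_sqrtr// addr_ge0// sqr_ge0.
pose u := complex.Re z / cmod z; pose v := complex.Im z / cmod z.
have uv : u ^+ 2 + v ^+ 2 = 1.
  by rewrite /u /v !expr_div_n -mulrDl sq divff// expf_neq0// gt_eqF.
have u1 : -1 <= u <= 1.
  by rewrite -ler_norml -(@ler_pXn2r _ 2)// ?nnegrE// expr1n real_normK ?num_real// -uv lerDl sqr_ge0.
have zE th : cos th = u -> sin th = v -> z = expi th * (cmod z)%:C.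
  move=> hc hs; apply: complex_eq.
    by rewrite ReM /= hc mulr0 subr0 /u divfK// gt_eqF.
  by rewrite ImM /= hs mulr0 add0r /v divfK// gt_eqF.
have sv : sin (acos u) = `|v|.
  by rewrite sin_acos// -uv addrC addKr sqrtr_sqr.
have [v0|v0] := leP 0 v.
  by exists (acos u); apply: zE; rewrite ?acosK// sv ger0_norm.
exists (- acos u); apply: zE; first by rewrite cosN acosK.
by rewrite sinN sv ltr0_norm// opprK.
Qed.

Lemma expi_2pi (th : R) : expi (th + 2 * pi) = expi th.
Proof. by rewrite /expi mulr_natl cosD2pi sinD2pi. Qed.

(** The modulus of e^(-izt) is e^(at), any value below the radius, and its
    argument is - x0 t, defined up to a multiple of 2 pi, so that x0 can be
    chosen different from 0. *)
Lemma disc_approx (al t e : R) (l : C) : 0 < t -> cmod l <= expR (al * t) -> 0 < e ->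
  exists x0 a, [/\ x0 != 0, a < al & cmod (lker x0 a t - l) < e].
Proof.
move=> t0 lr e0; have [th lE] := polar l; set r := cmod l in lr lE.
pose rho := expR (al * t); have rho0 : 0 < rho by exact: expR_gt0.
have r0 : 0 <= r by exact: cmod_ge0.
have lrho : r <= rho by exact: lr.
pose d := Num.min 1 (e / (2 * rho)).
have d0 : 0 < d by rewrite lt_min ltr01 divr_gt0// mulr_gt0.
have d1 : d <= 1 by rewrite ge_min lexx.
have de : d * (2 * rho) <= e by rewrite -ler_pdivlMr ?mulr_gt0// ge_min lexx orbT.
(* The modulus of l is moved slightly towards half the radius, so that it
   becomes positive and smaller than the radius. *)
pose r' := r + (rho / 2 - r) * d.
have r'0 : 0 < r'.
  have -> : r' = r * (1 - d) + rho / 2 * d by rewrite /r'; ring.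
  by rewrite ltr_wpDl ?mulr_ge0 ?subr_ge0// !mulr_gt0.
have r'rho : r' < rho.
  have : r' = r * (1 - d) + rho / 2 * d by rewrite /r'; ring.
  have : r * (1 - d) <= rho * (1 - d) by rewrite ler_wpM2r ?subr_ge0.
  have : rho / 2 * d > 0 by rewrite !mulr_gt0.
  lra.
have [th' th'0 thE] : exists2 th', th' != 0 & expi th' = expi th :> C.
  have [->|th0] := eqVneq th 0; last by exists th.
  exists (0 + 2 * pi); last exact: expi_2pi.
  by rewrite add0r mulf_neq0// ?pnatr_eq0// gt_eqF// pi_gt0.
exists (- th' / t), (ln r' / t); split.
- by rewrite mulf_neq0 ?oppr_eq0// invr_neq0// gt_eqF.
- by rewrite ltr_pdivrMr// -ltr_expR lnK.
- rewrite /lker !divfK ?gt_eqF// opprK lnK// thE [in X in cmod X]lE -mulrBr cmodM cmod_expi mul1r.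
  rewrite -rmorphB cmodR /r' addrC addKr normrM (gtr0_norm d0).
  apply: lt_le_trans de; rewrite mulrC ltr_pM2l//.
  rewrite ltr_norml; move: lrho r0 rho0; clearbody rho r; move=> *; apply/andP; split; lra.
Qed.

(** A point of the disc outside of the spectrum would be at a positive
    distance from all the values e^(-izt), which are dense in the disc. *)
Lemma shift_spectrum_sup (S : R -> (R -> C) -> (R -> C)) G (al t : R) : 0 < t ->
  (forall N f, Lp_itv p 0 N%:R f -> \forall x \ae leb, G (S t) f x = f (x - t)) ->
  (forall x0 a, a < al -> (x0 != 0) || (a != 0) -> exists m, character p w G (S t) x0 a m) ->
  [set z : C | cmod z <= expR (al * t)] `<=` spectrum p w (S t).
Proof.
move=> t0 GS ch l /= lr [U [bU UT TU]].
have [Mu Mu0 UM] := bounded_energy hp hw bU.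
have Mi : 0 < Mu^-1 by rewrite invr_gt0.
have [x0 [a [x00 aal lt]]] := disc_approx t0 lr Mi.
have [m hm] := ch x0 a aal (introT orP (or_introl x00)).
have mE := character_shift GS hm; have [_ hr] := hm.
have := hr l U Mu Mu0 UM (And3 bU UT TU).
by rewrite mE leNgt lt.
Qed.

Theorem right_spectrum t : 0 < t ->
  spectrum p w (right_shift t) = [set z : C | cmod z <= expR (alpha0 p w * t)].
Proof.
move=> t0; have t0' := ltW t0; apply/seteqP; split; first exact: right_spectrum_sub.
have iT : invariant p w right_shift (right_shift t).
  split; first exact: bounded_right.
  by move=> s s0 g _; rewrite -!right_shiftD// addrC; exact: Eeq_refl.
apply: (shift_spectrum_sup (G := rglue) t0); last by move=> x0 a; exact: right_character.
by move=> N f; exact: rglue_shift.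
Qed.

Theorem left_spectrum t : 0 < t ->
  spectrum p w (left_shift t) = [set z : C | cmod z <= expR (alpha1 p w * t)].
Proof.
move=> t0; have t0' := ltW t0; apply/seteqP; split; first exact: left_spectrum_sub.
have iT : invariant p w left_shift (left_shift t).
  split; first exact: bounded_left.
  by move=> s s0 g _; rewrite -!left_shiftD// addrC; exact: Eeq_refl.
apply: (shift_spectrum_sup (G := lglue) t0); last by move=> x0 a; exact: left_character.
by move=> N f; exact: lglue_shift.
Qed.

End ShiftSpectrum.

(** * The Fejer kernel *)

Section Fejer.
Context {R : realType}.
Local Notation C := R[i].
Local Notation leb := (@lebesgue_measure R).

Lemma measurable_scale (r : R) : measurable_fun setT (fun x : R => r * x).
Proof. exact: measurable_funM. Qed.

Lemma lebesgue_measure_scale (r : R) (A : set R) : 0 < r -> measurable A ->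
  (r%:E * pushforward leb (fun x : R => (r * x)%R : measurableTypeR R) A = leb A)%E.
Proof.
move=> r0 mA; have mr := measurable_scale r; apply/esym.
apply: (lebesgue_measure_unique
  (mu := mscale (NngNum (ltW r0)) (pushforward leb (fun x : R => r * x : measurableTypeR R)))) => //.
move=> _ [[a b]] _ <-; rewrite [RHS](_ : _ = (r%:E * leb ((fun x : R => (r * x)%R) @^-1` `]a, b]%classic))%E)//.
rewrite (_ : _ @^-1` _ = `]a / r, b / r]%classic); last first.
  by apply/seteqP; split => x /=; rewrite !in_itv/= ltr_pdivrMr// ler_pdivlMr// [x * r]mulrC.
rewrite !lebesgue_measure_itv/= !lte_fin ltr_pM2r ?invr_gt0//; case: ifP => _; last by rewrite mule0.
by rewrite -!EFinB -EFinM; congr EFin; field; rewrite gt_eqF.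
Qed.

Lemma integral_scale (r : R) (f : R -> \bar R) : 0 < r -> measurable_fun setT f ->
  (forall x, (0 <= f x)%E) ->
  (r%:E * (\int[leb]_x f (r * x)%R) = \int[leb]_x f x)%E.
Proof.
move=> r0 mf f0; have mr := measurable_scale r.
have <- := @ge0_integral_pushforward _ _ (measurableTypeR R) (measurableTypeR R) R
  _ mr leb setT f measurableT mf (fun x _ => f0 x).
have <- := @ge0_integral_mscale _ _ _ (pushforward leb (fun x : R => r * x : measurableTypeR R)) setT
  measurableT (NngNum (ltW r0)) f mf (fun x _ => f0 x).
by apply: eq_measure_integral => //= A mA _; exact: lebesgue_measure_scale.
Qed.

Lemma sin_le_norm (x : R) : `|sin x| <= `|x|.
Proof.
wlog x0 : x / 0 <= x.
  move=> H; have [x0|x0] := leP 0 x; first exact: H.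
  by rewrite -normrN -sinN -[leRHS]normrN; apply: H; rewrite oppr_ge0 ltW.
have ds y : y \in `]0, x[ -> is_derive y 1 (@sin R) (cos y) by move=> _; exact: is_derive_sin.
have cs : {within `[0, x], continuous (@sin R)}.
  by apply: continuous_subspaceT => y; exact: continuous_sin.
have [c _] := MVT_segment x0 ds cs.
rewrite sin0 !subr0 => ->; rewrite normrM ler_piMl//.
by rewrite ler_norml cos_geN1 cos_le1.
Qed.

Definition fejer (y s : R) : R := (1 - cos (y * s)) / s ^+ 2.

Lemma fejer_ge0 y s : 0 <= fejer y s.
Proof. by rewrite divr_ge0 ?sqr_ge0// subr_ge0 cos_le1. Qed.

Lemma fejerN y s : fejer (- y) s = fejer y s.
Proof. by rewrite /fejer mulNr cosN. Qed.

Lemma fejer_even y s : fejer y (- s) = fejer y s.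
Proof. by rewrite /fejer mulrN cosN sqrrN. Qed.

Lemma fejer_scale y s : 0 < y -> fejer y s = y ^+ 2 * fejer 1 (y * s).
Proof.
move=> y0; rewrite /fejer mul1r; have [->|s0] := eqVneq s 0.
  by rewrite mulr0 expr0n /= invr0 !mulr0.
by field; rewrite s0 gt_eqF.
Qed.

Lemma measurable_fejer y : measurable_fun setT (fejer y).
Proof.
apply: measurable_funM.
- apply: measurable_funB => //; apply: measurableT_comp; last exact: measurable_scale.
  by apply: continuous_measurable_fun; exact: continuous_cos.
- apply: (eq_measurable_fun (fun s : R => (s ^+ 2) `^ (-1))).
    by move=> s _; rewrite powR_inv1// sqr_ge0.
  apply: (measurableT_comp (f := fun y : R => y `^ (-1))); last exact: measurable_funX.
  exact: measurable_powR.
Qed.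

Lemma fejer_le s : fejer 1 s <= 4 * (1 + s ^+ 2)^-1.
Proof.
have s2 : 0 <= s ^+ 2 by exact: sqr_ge0.
have d0 : 0 < 1 + s ^+ 2 by rewrite ltr_pwDl.
rewrite /fejer mul1r; have [->|s0] := eqVneq s 0.
  by rewrite expr0n /= invr0 mulr0 mulr_ge0.
have s20 : 0 < s ^+ 2 by rewrite exprn_even_gt0.
rewrite ler_pdivrMr// mulrAC -ler_pdivrMr ?invr_gt0// invrK.
have c1 : 1 - cos s <= 2 by have := cos_geN1 s; lra.
have c0 : 0 <= 1 - cos s by have := cos_le1 s; lra.
have c2 : 1 - cos s <= s ^+ 2 / 2.
  have sE : s = s / 2 + s / 2 by rewrite -splitr.
  rewrite [in cos _]sE cosD -!expr2.
  have h1 := cos2Dsin2 (s / 2).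
  have h2 : sin (s / 2) ^+ 2 <= (s / 2) ^+ 2.
    by rewrite -[leLHS]real_normK ?num_real// -[leRHS]real_normK ?num_real// lerXn2r ?nnegrE// sin_le_norm.
  have h3 : s ^+ 2 / 2 = 2 * (s / 2) ^+ 2 by field.
  rewrite h3; lra.
rewrite mulrDr mulr1; nra.
Qed.

Lemma measurable_EFejer y : measurable_fun setT (fun s => (fejer y s)%:E).
Proof. by apply/measurable_EFinP; exact: measurable_fejer. Qed.

Lemma measurable_oneDsqrV : measurable_fun setT (fun s : R => ((oneDsqr s)^-1)%:E).
Proof.
by apply/measurable_EFinP; apply: continuous_measurable_fun; exact: continuous_oneDsqrV.
Qed.

Lemma integral_oneDsqrV_lty : (\int[leb]_s ((oneDsqr s)^-1)%:E < +oo)%E.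
Proof.
rewrite ge0_symfun_integralT; last 3 first.
- by move=> s; rewrite invr_ge0 (le_trans _ (oneDsqr_ge1 s)).
- exact: continuous_oneDsqrV.
- by move=> s; rewrite /= /oneDsqr sqrrN.
rewrite (_ : [set x : R | 0 <= x] = `[0, +oo[%classic); last by rewrite -RplusE.
by rewrite integral0y_oneDsqr -!EFinM ltry.
Qed.

Lemma fejer1_lty : (\int[leb]_s (fejer 1 s)%:E < +oo)%E.
Proof.
apply: (@le_lt_trans _ _ (\int[leb]_s (4%:E * ((oneDsqr s)^-1)%:E))%E).
  apply: ge0_le_integral => //.
  - by move=> s _; rewrite lee_fin fejer_ge0.
  - exact: measurable_EFejer.
  - by apply: measurable_funeM; exact: measurable_oneDsqrV.
  - by move=> s _; rewrite -EFinM lee_fin fejer_le.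
rewrite ge0_integralZl_EFin//; last exact: measurable_oneDsqrV.
by apply: EFin_mul_lty => //; exact: integral_oneDsqrV_lty.
Qed.

Definition fejer_mass : R := fine (\int[leb]_s (fejer 1 s)%:E).

Let int1 : (\int[leb]_s (fejer 1 s)%:E = fejer_mass%:E)%E.
Proof.
rewrite fineK// ge0_fin_numE ?fejer1_lty//; apply: integral_ge0 => s _.
by rewrite lee_fin fejer_ge0.
Qed.

(** By scaling: the kernel of frequency y is y^2 times the kernel of frequency 1
    at y s.  That the mass is linear in |y| is what makes the Fourier transform
    of the kernel piecewise linear, hence of compact support. *)
Lemma integral_fejer y : (\int[leb]_s (fejer y s)%:E = (`|y| * fejer_mass)%:E)%E.
Proof.
wlog y0 : y / 0 < y.
  move=> H; have [y0|y0|->] := ltgtP y 0; [|exact: H|].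
    rewrite -normrN -H ?oppr_gt0//; by apply: eq_integral => s _; rewrite fejerN.
  rewrite normr0 mul0r; apply: integral0_eq => s _.
  by rewrite /fejer mul0r cos0 subrr mul0r.
rewrite gtr0_norm// EFinM -int1 -(integral_scale y0 (measurable_EFejer 1)); last first.
  by move=> s; rewrite lee_fin fejer_ge0.
rewrite muleA -EFinM -expr2 -ge0_integralZl_EFin ?sqr_ge0//; last 2 first.
- by move=> s _; rewrite lee_fin fejer_ge0.
- exact: (measurableT_comp (measurable_EFejer 1) (measurable_scale y)).
by apply: eq_integral => s _; rewrite -EFinM -fejer_scale.
Qed.

Lemma fejer_mass_gt0 : 0 < fejer_mass.
Proof.
have pi0 := pi_gt0 R.
pose c : R := (pi ^+ 2)^-1.
have c0 : 0 < c by rewrite invr_gt0 exprn_gt0.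
pose D : set R := `[pi / 2, pi]%classic.
have mD : measurable D by exact: measurable_itv.
have lD : leb D = (pi / 2)%:E.
  rewrite /D lebesgue_measure_itv /= lte_fin ltr_pdivrMr// ltr_pMr// ltr1n -EFinB.
  by congr EFin; lra.
rewrite -lte_fin -int1; apply: (@lt_le_trans _ _ (c * (pi / 2))%:E).
  by rewrite lte_fin mulr_gt0// divr_gt0.
have -> : ((c * (pi / 2))%:E = \int[leb]_s (c * \1_D s)%:E)%E.
  rewrite (_ : (fun s => _) = fun s => (c%:E * (\1_D s)%:E)%E); last first.
    by apply/funext => s; rewrite -EFinM.
  rewrite ge0_integralZl_EFin ?(ltW c0)//; last first.
    by apply/measurable_EFinP; exact: measurable_indic.
  by rewrite integral_indic// setIT EFinM -lD.
apply: ge0_le_integral => //.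
- by move=> s _; rewrite lee_fin mulr_ge0 ?(ltW c0)// indicE.
- by apply/measurable_EFinP; apply: measurable_funM => //; exact: measurable_indic.
- exact: measurable_EFejer.
move=> s _; rewrite lee_fin indicE mem_setE in_itv /=.
have [/andP[s1 s2]|_] := boolP (pi / 2 <= s <= pi); last by rewrite mulr0 fejer_ge0.
have s0 : 0 < s by apply: lt_le_trans s1; rewrite divr_gt0.
rewrite mulr1 /fejer mul1r.
have cs : cos s <= 0.
  rewrite -[s](subrK (pi / 2)) cosDpihalf oppr_le0 sin_ge0_pi//.
  by apply/andP; split; lra.
apply: (@le_trans _ _ (s ^+ 2)^-1).
  by rewrite lef_pV2 ?posrE ?exprn_gt0// lerXn2r ?nnegrE// ltW.
rewrite ler_pMl ?invr_gt0 ?exprn_gt0//; lra.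
Qed.

(** Product formula for cosines: it expresses the Fourier transform of the
    kernel through total masses of kernels of other frequencies. *)
Lemma fejer_cos y x s : fejer y s * cos (x * s) =
  2^-1 * fejer (x + y) s + 2^-1 * fejer (x - y) s - fejer x s.
Proof.
rewrite /fejer [(x + y) * s]mulrDl [(x - y) * s]mulrBl cosD cosB.
set k := (s ^+ 2)^-1; set a := cos (x * s); set b := cos (y * s).
set d := sin _ * sin _; by field.
Qed.

End Fejer.

(** * Fourier transforms of integrable functions *)

Section FourierKernel.
Context {R : realType}.
Local Notation C := R[i].
Local Notation leb := (@lebesgue_measure R).
Implicit Types (u v f g G : R -> C).

Definition fkernel (y x0 xi : R) : C := (fejer y (xi - x0))%:C.

Lemma cmod_fkernel y x0 xi : cmod (fkernel y x0 xi) = fejer y (xi - x0).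
Proof. by rewrite cmodR ger0_norm// fejer_ge0. Qed.

Lemma cmeas_fkernel y x0 : cmeasurable setT (fkernel y x0).
Proof.
apply: cmeas_real; apply: (measurableT_comp (measurable_fejer y)).
exact: (measurable_shift (- x0)).
Qed.

Lemma absint_fkernel y x0 : absint (fkernel y x0) = (`|y| * fejer_mass)%:E.
Proof.
rewrite absintE -integral_fejer -(integral_shift (- x0) (measurable_EFejer y)).
by apply: eq_integral => x _; rewrite cmod_fkernel.
Qed.

Lemma cint_fkernel y x0 : cintegrable (fkernel y x0).
Proof. by split; [exact: cmeas_fkernel|rewrite absint_fkernel ltry]. Qed.

Lemma cmeas_char (x : R) : cmeasurable setT (fun t : R => expi (- (x * t)) : C).
Proof. by apply: cmeas_expi; apply: measurable_funN; exact: measurable_scale. Qed.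

Lemma cint_char u x : cintegrable u -> cintegrable (fun t => u t * expi (- (x * t))).
Proof.
move=> [mu iu]; apply: (le_cintegrable _ _ (conj mu iu)).
  by apply: cmeasM => //; exact: cmeas_char.
by move=> t; rewrite cmodM cmod_expi mulr1.
Qed.

Lemma integrable_fejer y : leb.-integrable setT (EFin \o fejer y).
Proof.
apply/integrableP; split; first exact: measurable_EFejer.
have -> : (\int[leb]_x `|(EFin \o fejer y) x| = \int[leb]_s (fejer y s)%:E)%E.
  by apply: eq_integral => s _; rewrite /= ger0_norm ?fejer_ge0.
by rewrite integral_fejer ltry.
Qed.

Lemma Rintegral_fejer y : \int[leb]_s fejer y s = `|y| * fejer_mass.
Proof. by rewrite /Rintegral integral_fejer. Qed.

(** By [fejer_cos] and [integral_fejer] this is a tent function of x: a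
    combination of absolute values that vanishes for |x| >= y. *)
Lemma fourier_fejer y x : cintegral (fun s => (fejer y s)%:C * expi (- (x * s))) =
  (fejer_mass / 2 * (`|x + y| + `|x - y| - 2 * `|x|))%:C :> C.
Proof.
pose h s : C := (fejer y s)%:C * expi (- (x * s)).
have ih : cintegrable h.
  apply: (@cint_char (fun s => (fejer y s)%:C)).
  have := cint_fkernel y 0; congr cintegrable.
  by apply/funext => s; rewrite /fkernel subr0.
rewrite -/h; apply: complex_eq.
  transitivity (\int[leb]_s (2^-1 * fejer (x + y) s + 2^-1 * fejer (x - y) s - fejer x s)).
    rewrite /= /Rintegral; congr fine; apply: eq_integral => s _; congr EFin.
    by rewrite /= mul0r subr0 cosN fejer_cos.
  have iZ z : leb.-integrable setT (EFin \o (fun s => 2^-1 * fejer z s)).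
    by have := integrableZl measurableT 2^-1 (integrable_fejer z).
  have iD : leb.-integrable setT (EFin \o (fun s => 2^-1 * fejer (x + y) s + 2^-1 * fejer (x - y) s)).
    by have := integrableD measurableT (iZ (x + y)) (iZ (x - y)).
  rewrite RintegralB//; last exact: integrable_fejer.
  rewrite RintegralD// !RintegralZl//; last 2 first.
  - exact: integrable_fejer.
  - exact: integrable_fejer.
  by rewrite !Rintegral_fejer /=; field.
(* the kernel is even, so that the sine part vanishes *)
have mh := ih.1.
have ihr : cintegrable (fun s => h (0 - s)).
  split; first exact: (cmeas_comp (measurable_refl 0) mh).
  by rewrite absint_refl//; case: ih.
have e : cintegral (fun s => h s + h (0 - s)) = cintegral h + cintegral h.
  by rewrite cintegralD// cintegral_refl.
have : complex.Im (cintegral (fun s => h s + h (0 - s))) = 0.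
  rewrite /= /Rintegral integral0_eq// => s _; congr EFin.
  by rewrite sub0r fejer_even mulrN opprK sinN; ring.
by rewrite e ImD /= => h0; move: h0; lra.
Qed.

Lemma fourier_fkernel y x0 x : fourier (fkernel y x0) x =
  expi (- (x * x0)) * (fejer_mass / 2 * (`|x + y| + `|x - y| - 2 * `|x|))%:C.
Proof.
rewrite -fourier_fejer /fourier -[LHS](cintegral_shift x0); last first.
  by apply: cmeasM; [exact: cmeas_fkernel|exact: cmeas_char].
rewrite -cintegralZ; last first.
  apply: (@cint_char (fun s => (fejer y s)%:C)).
  have := cint_fkernel y 0; congr cintegrable.
  by apply/funext => s; rewrite /fkernel subr0.
congr cintegral; apply/funext => s.
by rewrite /fkernel addrK mulrDr opprD expiD; ring.
Qed.

Lemma fourier_fkernel_out y x0 x : 0 <= y -> y <= `|x| -> fourier (fkernel y x0) x = 0.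
Proof.
move=> y0 yx; rewrite fourier_fkernel.
have -> : `|x + y| + `|x - y| - 2 * `|x| = 0.
  move: yx; have [h|/ltW h] := leP 0 x.
    rewrite (ger0_norm h) => yx.
    by rewrite (ger0_norm (addr_ge0 h y0)) ger0_norm ?subr_ge0//; ring.
  rewrite (ler0_norm h) => yx.
  by rewrite ler0_norm ?(ler0_norm (_ : x - y <= 0)); lra.
by rewrite mulr0 rmorph0 mulr0.
Qed.

Lemma cmod_fourier u x (B : R) : cmeasurable setT u -> (absint u <= B%:E)%E ->
  cmod (fourier u x) <= 2 * B.
Proof.
move=> mu uB; apply: cintegral_le; first by apply: cmeasM => //; exact: cmeas_char.
apply: le_trans uB; apply: le_absint => //; first by apply: cmeasM => //; exact: cmeas_char.
by move=> t; rewrite cmodM cmod_expi mulr1.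
Qed.

Lemma fourier_bound u : cintegrable u -> exists2 B : R, 0 <= B & forall x, cmod (fourier u x) <= B.
Proof.
move=> [mu iu]; have fi : absint u \is a fin_num by rewrite ge0_fin_numE// absint_ge0.
exists (2 * fine (absint u)) => [|x]; first by rewrite mulr_ge0// fine_ge0// absint_ge0.
by apply: cmod_fourier => //; rewrite fineK.
Qed.

Lemma fourier_continuous u : cintegrable u ->
  continuous (fun x => complex.Re (fourier u x)) /\ continuous (fun x => complex.Im (fourier u x)).
Proof.
move=> iu; have [mu fu] := iu.
have ig : leb.-integrable setT (EFin \o (fun t => cmod (u t))).
  apply/integrableP; split; first exact: measurable_cmodE.
  have -> : (\int[leb]_x `|(EFin \o (fun t => cmod (u t))) x| = absint u)%E.
    by rewrite absintE; apply: eq_integral => s _; rewrite /= ger0_norm ?cmod_ge0.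
  exact: fu.
have lin (t x : R) : {for x, continuous (fun y : R => - (y * t))}.
  by apply: continuousN; apply: continuousM; [exact: cvg_id|exact: cvg_cst].
have ce (t : R) : continuous (fun y : R => cos (- (y * t))).
  by move=> x; apply: continuous_comp; [exact: lin|exact: continuous_cos].
have se (t : R) : continuous (fun y : R => sin (- (y * t))).
  by move=> x; apply: continuous_comp; [exact: lin|exact: continuous_sin].
have key (F : R -> R -> R) : (forall y, leb.-integrable setT (EFin \o F y)) ->
    (forall t, continuous (F^~ t)) -> (forall y t, `|F y t| <= cmod (u t)) ->
    continuous (fun y => \int[leb]_t F y t).
  move=> iF cF Fu x.
  have H1 y : `]x - 1, x + 1[%classic y -> leb.-integrable setT (EFin \o F y) by move=> _; exact: iF.
  have H2 : \forall t \ae leb, setT t -> {in `]x - 1, x + 1[%classic, continuous (F^~ t)}.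
    by apply: aeT => t _ y _; exact: cF.
  have H3 y : `]x - 1, x + 1[%classic y -> \forall t \ae leb, setT t -> `|F y t| <= cmod (u t).
    by move=> _; apply: aeT => t _; exact: Fu.
  have H := continuity_under_integral measurableT H1 H2 ig H3.
  by apply: H; rewrite inE /= in_itv /=; apply/andP; split; lra.
split.
- apply: (key (fun y t => complex.Re (u t * expi (- (y * t))))).
  + by move=> y; have := cintegrable_Re (cint_char y iu).
  + move=> t; under eq_fun do rewrite ReM /=.
    move=> y; apply: cvgB; apply: cvgMr; [exact: ce|exact: se].
  + move=> y t; apply: (le_trans (Re_le_cmod _)).
    by rewrite cmodM cmod_expi mulr1.
- apply: (key (fun y t => complex.Im (u t * expi (- (y * t))))).
  + by move=> y; have := cintegrable_Im (cint_char y iu).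
  + move=> t; under eq_fun do rewrite ImM /=.
    move=> y; apply: cvgD; apply: cvgMr; [exact: se|exact: ce].
  + move=> y t; apply: (le_trans (Im_le_cmod _)).
    by rewrite cmodM cmod_expi mulr1.
Qed.

Lemma cmeas_fourier u : cintegrable u -> cmeasurable setT (fourier u).
Proof.
by move=> /fourier_continuous [c1 c2]; split; exact: continuous_measurable_fun.
Qed.

Lemma cint_boundedM u v : cintegrable v -> cmeasurable setT u ->
  (exists2 B : R, 0 <= B & forall x, cmod (u x) <= B) -> cintegrable (fun x => u x * v x).
Proof.
move=> iv mu [B B0 uB]; apply: (@le_cintegrable _ _ (fun x => B%:C * v x)).
- by apply: cmeasM => //; case: iv.
- by move=> x; rewrite !cmodM cmodR (ger0_norm B0) ler_wpM2r ?cmod_ge0.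
- exact: cintegrableZ.
Qed.

(** A bound by a product of integrable functions of each variable makes the
    double integral converge absolutely. In a Fourier transform the
    exponential has modulus 1, so such a bound is available. *)
Lemma fubini_real (K : R -> R -> R) (h1 h2 : R -> R) :
  measurable_fun setT (fun z : R * R => K z.1 z.2) ->
  measurable_fun setT h1 -> measurable_fun setT h2 ->
  (forall x, 0 <= h1 x) -> (forall x, 0 <= h2 x) ->
  (\int[leb]_x (h1 x)%:E < +oo)%E -> (\int[leb]_x (h2 x)%:E < +oo)%E ->
  (forall x t, `|K x t| <= h1 x * h2 t) ->
  (\int[leb]_x \int[leb]_t (K x t)%:E = \int[leb]_t \int[leb]_x (K x t)%:E)%E.
Proof.
move=> mK mh1 mh2 h10 h20 i1 i2 Kh.
have mEK : measurable_fun setT (fun z : R * R => (K z.1 z.2)%:E) by exact/measurable_EFinP.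
apply: (@Fubini _ _ _ _ _ leb leb (fun z : R * R => (K z.1 z.2)%:E)).
apply/integrable12ltyP => //.
have h2p : (0 <= \int[leb]_t (h2 t)%:E)%E by apply: integral_ge0 => t _; rewrite lee_fin.
have cE : (\int[leb]_t (h2 t)%:E = (fine (\int[leb]_t (h2 t)%:E))%:E)%E.
  by rewrite fineK// ge0_fin_numE.
apply: (@le_lt_trans _ _ (\int[leb]_x ((\int[leb]_t (h2 t)%:E) * (h1 x)%:E))%E).
  apply: ge0_le_integral => //.
  - by move=> x _; apply: integral_ge0.
  - apply: (measurable_fun_fubini_tonelli_F (m2 := leb) (fun z : R * R => `|(K z.1 z.2)%:E|%E)) => //.
    exact: measurableT_comp.
  - by apply: measurable_funeM; exact/measurable_EFinP.
  - move=> x _; rewrite muleC -ge0_integralZl_EFin//; last 2 first.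
    + by move=> t _; rewrite lee_fin.
    + exact/measurable_EFinP.
    apply: ge0_le_integral => //.
    + apply/measurable_EFinP; apply: measurableT_comp => //.
      exact: (measurableT_comp mK (measurable_pair1 x)).
    + by apply: measurable_funeM; exact/measurable_EFinP.
    + by move=> t _; rewrite -EFinM lee_fin.
rewrite cE ge0_integralZl_EFin ?fine_ge0//; last 2 first.
- by move=> t _; rewrite lee_fin.
- exact/measurable_EFinP.
by apply: EFin_mul_lty => //; rewrite fine_ge0.
Qed.

(** Both sides are the double integral of u(t) v(x) e^(-ixt), which converges
    absolutely. *)
Lemma multiplication_formula u v : cintegrable u -> cintegrable v ->
  cintegral (fun x => fourier u x * v x) = cintegral (fun t => u t * fourier v t).
Proof.
move=> iu iv; have [mu fu] := iu; have [mv fv] := iv.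
rewrite !absintE in fu fv.
have mcu := measurable_cmod mu; have mcv := measurable_cmod mv.
pose K (x t : R) : C := u t * expi (- (x * t)) * v x.
have KB x t : cmod (K x t) <= cmod (v x) * cmod (u t).
  by rewrite /K !cmodM cmod_expi mulr1 mulrC.
have mfst (f : R -> R) : measurable_fun setT f -> measurable_fun setT (fun z : R * R => f z.1).
  by move=> mf; apply: measurableT_comp.
have msnd (f : R -> R) : measurable_fun setT f -> measurable_fun setT (fun z : R * R => f z.2).
  by move=> mf; apply: measurableT_comp.
have m12 : measurable_fun setT (fun z : R * R => - (z.1 * z.2)).
  by apply: measurable_funN; apply: measurable_funM; [exact: (mfst id)|exact: (msnd id)].
have mcos : measurable_fun setT (fun z : R * R => cos (- (z.1 * z.2))).
  by apply: (measurableT_comp (f := @cos R)) => //; apply: continuous_measurable_fun; exact: continuous_cos.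
have msin : measurable_fun setT (fun z : R * R => sin (- (z.1 * z.2))).
  by apply: (measurableT_comp (f := @sin R)) => //; apply: continuous_measurable_fun; exact: continuous_sin.
have mRe : measurable_fun setT (fun z : R * R => complex.Re (u z.2 * expi (- (z.1 * z.2)))).
  under eq_fun do rewrite ReM /=.
  by apply: measurable_funB; apply: measurable_funM => //; [exact: (msnd _ mu.1)|exact: (msnd _ mu.2)].
have mIm : measurable_fun setT (fun z : R * R => complex.Im (u z.2 * expi (- (z.1 * z.2)))).
  under eq_fun do rewrite ImM /=.
  by apply: measurable_funD; apply: measurable_funM => //; [exact: (msnd _ mu.1)|exact: (msnd _ mu.2)].
have mKR : measurable_fun setT (fun z : R * R => complex.Re (K z.1 z.2)).
  under eq_fun do rewrite /K ReM.
  by apply: measurable_funB; apply: measurable_funM => //; [exact: (mfst _ mv.1)|exact: (mfst _ mv.2)].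
have mKI : measurable_fun setT (fun z : R * R => complex.Im (K z.1 z.2)).
  under eq_fun do rewrite /K ImM.
  by apply: measurable_funD; apply: measurable_funM => //; [exact: (mfst _ mv.2)|exact: (mfst _ mv.1)].
have FR := fubini_real mKR mcv mcu (fun x => cmod_ge0 (v x)) (fun t => cmod_ge0 (u t)) fv fu
  (fun x t => le_trans (Re_le_cmod _) (KB x t)).
have FI := fubini_real mKI mcv mcu (fun x => cmod_ge0 (v x)) (fun t => cmod_ge0 (u t)) fv fu
  (fun x t => le_trans (Im_le_cmod _) (KB x t)).
have i1 x : cintegrable (K x).
  have := cintegrableZ (v x) (cint_char x iu); congr cintegrable.
  by apply/funext => t; rewrite /K mulrC.
have i2 t : cintegrable (K^~ t).
  have := cintegrableZ (u t) (cint_char t iv); congr cintegrable.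
  by apply/funext => x; rewrite /K [x * t]mulrC; ring.
have e1 x : cintegral (K x) = fourier u x * v x.
  rewrite mulrC /fourier -cintegralZ; last exact: cint_char.
  by congr cintegral; apply/funext => t; rewrite /K mulrC.
have e2 t : cintegral (K^~ t) = u t * fourier v t.
  rewrite /fourier -cintegralZ; last exact: cint_char.
  by congr cintegral; apply/funext => x; rewrite /K [x * t]mulrC; ring.
have fin (f : R -> R) : leb.-integrable setT (fun x => (f x)%:E) ->
    (\int[leb]_x (f x)%:E = (\int[leb]_x f x)%:E)%E.
  by move=> i; rewrite /Rintegral (fineK (integrable_fin_num measurableT i)).
apply: complex_eq.
- rewrite /= /Rintegral; congr fine.
  transitivity (\int[leb]_x \int[leb]_t (complex.Re (K x t))%:E)%E.
    apply: eq_integral => x _; rewrite fin; last exact: cintegrable_Re (i1 x).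
    by rewrite -e1.
  rewrite FR; apply: eq_integral => t _; rewrite fin; last exact: cintegrable_Re (i2 t).
  by rewrite -e2.
- rewrite /= /Rintegral; congr fine.
  transitivity (\int[leb]_x \int[leb]_t (complex.Im (K x t))%:E)%E.
    apply: eq_integral => x _; rewrite fin; last exact: cintegrable_Im (i1 x).
    by rewrite -e1.
  rewrite FI; apply: eq_integral => t _; rewrite fin; last exact: cintegrable_Im (i2 t).
  by rewrite -e2.
Qed.

End FourierKernel.

(** * Pairings of Plancherel transforms *)

Section L2Pairing.
Context {R : realType}.
Local Notation C := R[i].
Local Notation leb := (@lebesgue_measure R).
Implicit Types (u v f g G : R -> C).

Let two1 : (1 : R) <= 2. Proof. by rewrite ler1n. Qed.
Let two0 : (0 : R) < 2. Proof. by []. Qed.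
Local Notation sq f := (pint 2 (cst 1%R) f).

Lemma wnorm2E f : wnorm setT 2 (cst 1) f = (sq f `^ 2^-1)%E.
Proof.
rewrite /wnorm pintE; congr (_ `^ _)%E; apply: eq_integral => x _.
by rewrite powR1.
Qed.

Lemma L2P f : L2 f <-> cmeasurable setT f /\ (sq f < +oo)%E.
Proof.
rewrite /L2 /wLp /= wnorm2E; split => -[mf h]; split => //.
- by apply: (lty_poweRy _ h).
- exact: poweR_lty.
Qed.

Lemma L1P f : L1 f -> cintegrable f.
Proof.
rewrite /L1 /wLp /= /wnorm invr1 => -[mf h]; split => //.
move: h; rewrite poweRe1; last first.
  by apply: integral_ge0 => x _; rewrite lee_fin mulr_ge0 ?powR_ge0.
rewrite absintE; congr (_ < _)%E; apply: eq_integral => x _.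
by rewrite powR1 mulr1 powRr1 ?cmod_ge0.
Qed.

(** From ab <= d a^2 + b^2 / d. A large d makes the contribution of v small,
    whatever v, and u then contributes little when it is small in the mean. *)
Lemma absint_mul u v (d : R) : 0 < d -> cmeasurable setT u -> cmeasurable setT v ->
  (absint (fun x => u x * v x)%R <= d%:E * sq u + d^-1%:E * sq v)%E.
Proof.
move=> d0 mu mv; have i0 : 0 <= d^-1 by rewrite invr_ge0 ltW.
have dd := @density1 R.
rewrite -(pintZv 2 (ltW d0) dd mu) -(pintZv 2 i0 dd mv) absintE !pintE -ge0_integralD//; last 4 first.
- by move=> x _; rewrite lee_fin !mulr_ge0 ?powR_ge0// ltW.
- exact: (measurable_pint 2 (densityZ (ltW d0) dd) mu).
- by move=> x _; rewrite lee_fin !mulr_ge0 ?powR_ge0.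
- exact: (measurable_pint 2 (densityZ i0 dd) mv).
apply: ge0_le_integral => //.
- by move=> x _; rewrite lee_fin cmod_ge0.
- by apply: measurable_cmodE; exact: cmeasM.
- apply: emeasurable_funD.
  + exact: (measurable_pint 2 (densityZ (ltW d0) dd) mu).
  + exact: (measurable_pint 2 (densityZ i0 dd) mv).
move=> x _; rewrite -EFinD lee_fin !mulr1 cmodM !powR_mulrn ?cmod_ge0//.
set a := cmod (u x); set b := cmod (v x).
have a0 : 0 <= a by exact: cmod_ge0.
have b0 : 0 <= b by exact: cmod_ge0.
rewrite -subr_ge0.
have -> : a ^+ 2 * d + b ^+ 2 / d - a * b = (a * d - b) ^+ 2 / d + a * b by field; rewrite gt_eqF.
by apply: addr_ge0; apply: mulr_ge0 => //; exact: sqr_ge0.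
Qed.

Lemma L2_mul u v : L2 u -> L2 v -> cintegrable (fun x => u x * v x).
Proof.
move=> /L2P[mu iu] /L2P[mv iv]; split; first exact: cmeasM.
apply: (le_lt_trans (absint_mul ltr01 mu mv)).
by rewrite invr1 !mul1e lte_add_pinfty.
Qed.

Lemma L2dist_near (u_ : nat -> R -> C) g (e : R) : 0 < e -> L2dist (u_ n) g @[n --> \oo] --> 0%E ->
  \forall n \near \oo, (sq (fun x => u_ n x - g x)%R <= e%:E)%E.
Proof.
move=> e0 /fine_cvgP[fin cv].
have e'0 : 0 < e `^ 2^-1 by exact: powR_gt0.
have : \forall n \near \oo, `|0 - fine (L2dist (u_ n) g)| < e `^ 2^-1.
  by move/cvgrPdist_lt : cv => /(_ _ e'0).
apply: filter_app; apply: filterS fin => n; rewrite /L2dist wnorm2E => fn.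
rewrite sub0r normrN ger0_norm ?fine_ge0 ?poweR_ge0//.
set X := pint _ _ _ in fn *; have X0 : (0 <= X)%E by apply: pint_ge0; exact: density1.
move: fn X0; case: X => [r| |]//; last by rewrite poweRyr ?invr_eq0.
rewrite poweR_EFin /= !lee_fin => _ r0 h.
rewrite leNgt; apply/negP => er; move: h; rewrite ltNge => /negP; apply.
by rewrite ge0_ler_powR ?nnegrE ?invr_ge0// ltW.
Qed.

Lemma absint_mul_near (u_ : nat -> R -> C) g v (e : R) : 0 < e -> L2 v ->
  (forall n, cmeasurable setT (u_ n)) -> cmeasurable setT g ->
  L2dist (u_ n) g @[n --> \oo] --> 0%E ->
  \forall n \near \oo, (absint (fun x => (u_ n x - g x) * v x)%R <= e%:E)%E.
Proof.
move=> e0 Lv mu mg cv; have /L2P[mv iv] := Lv.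
have sv0 : (0 <= sq v)%E by apply: pint_ge0; exact: density1.
pose N := fine (sq v) + 1.
have N0 : 0 < N by rewrite ltr_wpDl ?fine_ge0.
have vN : (sq v <= N%:E)%E.
  by rewrite -(@fineK _ (sq v)) ?ge0_fin_numE// lee_fin lerDl.
pose d := 2 * N / e; have d0 : 0 < d by rewrite divr_gt0 ?mulr_gt0.
have h0 : 0 < e / 2 / d by apply: divr_gt0 => //; exact: divr_gt0.
have := L2dist_near h0 cv; apply: filterS => n hn.
apply: (le_trans (absint_mul d0 (cmeasB (mu n) mg) mv)).
have -> : e%:E = (d%:E * (e / 2 / d)%:E + d^-1%:E * N%:E)%E.
  rewrite -!EFinM -EFinD; congr EFin; rewrite /d; field.
  by rewrite !gt_eqF.
by apply: leeD; apply: lee_wpmul2l => //; rewrite lee_fin ?invr_ge0 ltW.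
Qed.

Lemma cmod_small (z : C) : (forall e : R, 0 < e -> cmod z <= e) -> z = 0.
Proof.
move=> h; apply/cmod_eq0/eqP; rewrite eq_le cmod_ge0 andbT.
by apply/ler_addgt0Pl => e e0; rewrite addr0; exact: h.
Qed.

(** The multiplication formula passes to limits in the mean on both sides, v
    and its transform being square integrable. *)
Lemma plancherel_pairing g G v : fourierL2 g G -> cintegrable v -> L2 v -> L2 (fourier v) ->
  cintegral (fun x => G x * v x) = cintegral (fun x => g x * fourier v x).
Proof.
move=> [Lg LG [u [uL ug uG]]] iv Lv Lfv.
have u1 n : cintegrable (u n) by apply: L1P; case: (uL n).
have u2 n : L2 (u n) by case: (uL n).
have mF n := cmeas_fourier (u1 n).
have [mG _] := LG; have [mg _] := Lg; have [mv _] := iv; have [mfv _] := Lfv.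
have iFv n : cintegrable (fun x => fourier (u n) x * v x).
  exact: (cint_boundedM iv (mF n) (fourier_bound (u1 n))).
apply/eqP; rewrite -subr_eq0; apply/eqP/cmod_small => e e0.
have e4 : 0 < e / 4 by rewrite divr_gt0.
have N1 := absint_mul_near e4 Lfv (fun n => (u1 n).1) mg ug.
have N2 := absint_mul_near e4 Lv mF mG uG.
have [n [h1 h2]] : exists n, (absint (fun x => (u n x - g x) * fourier v x)%R <= (e / 4)%:E)%E /\
    (absint (fun x => (fourier (u n) x - G x) * v x)%R <= (e / 4)%:E)%E.
  by have [n [? ?]] := filter_ex (filterI N1 N2); exists n.
have c1 : cmod (cintegral (fun x => (u n x - g x) * fourier v x)) <= 2 * (e / 4).
  by apply: cintegral_le => //; apply: cmeasM => //; apply: cmeasB => //; case: (u1 n).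
have c2 : cmod (cintegral (fun x => (fourier (u n) x - G x) * v x)) <= 2 * (e / 4).
  by apply: cintegral_le => //; apply: cmeasM => //; apply: cmeasB.
have E1 : cintegral (fun x => (u n x - g x) * fourier v x) =
    cintegral (fun x => u n x * fourier v x) - cintegral (fun x => g x * fourier v x).
  rewrite -(cintegralB (L2_mul (u2 n) Lfv) (L2_mul Lg Lfv)).
  by congr cintegral; apply/funext => x; rewrite mulrBl.
have E2 : cintegral (fun x => (fourier (u n) x - G x) * v x) =
    cintegral (fun x => fourier (u n) x * v x) - cintegral (fun x => G x * v x).
  rewrite -(cintegralB (iFv n) (L2_mul LG Lv)).
  by congr cintegral; apply/funext => x; rewrite mulrBl.
have MF := multiplication_formula (u1 n) iv.
have -> : cintegral (fun x => G x * v x) - cintegral (fun x => g x * fourier v x) =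
    cintegral (fun x => (u n x - g x) * fourier v x) -
    cintegral (fun x => (fourier (u n) x - G x) * v x).
  by rewrite E1 E2 MF; ring.
apply: (le_trans (cmodB _ _)); apply: (le_trans (lerD c1 c2)); lra.
Qed.

End L2Pairing.

(** * Recovering the symbol at a point *)

Section SymbolIdentity.
Context {R : realType}.
Local Notation C := R[i].
Local Notation leb := (@lebesgue_measure R).
Implicit Types (u v f g G D k : R -> C).
Let kap := @fejer_mass R.
Let kap0 : 0 < kap. Proof. exact: fejer_mass_gt0. Qed.

Lemma fejer_tail y s (eta : R) : 0 < eta -> eta <= `|s| ->
  fejer y s <= 2 * (1 + (eta ^+ 2)^-1) * (oneDsqr s)^-1.
Proof.
move=> e0 es; have s0 : 0 < `|s| := lt_le_trans e0 es.
have s20 : 0 < s ^+ 2 by rewrite -real_normK ?num_real// exprn_gt0.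
have es2 : eta ^+ 2 <= s ^+ 2.
  by rewrite -[leRHS]real_normK ?num_real// lerXn2r ?nnegrE// ltW.
have i2 : (s ^+ 2)^-1 <= (eta ^+ 2)^-1 by rewrite lef_pV2 ?posrE ?s20 ?exprn_gt0.
have d0 : 0 < oneDsqr s by apply: lt_le_trans (oneDsqr_ge1 s).
apply: (@le_trans _ _ (2 * (s ^+ 2)^-1)).
  by rewrite ler_wpM2r ?invr_ge0 ?(ltW s20)//; have := cos_geN1 (y * s); lra.
have -> : 2 * (s ^+ 2)^-1 = 2 * (1 + (s ^+ 2)^-1) * (oneDsqr s)^-1.
  have sn : s != 0 by rewrite -normr_gt0.
  have dn : 1 + s ^+ 2 != 0 by rewrite gt_eqF.
  by rewrite /oneDsqr; field; rewrite ?sn ?dn.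
by rewrite ler_wpM2r ?invr_ge0 ?(ltW d0)// ler_wpM2l// lerD2l.
Qed.

Lemma cintegral_fkernel y x0 : 0 <= y -> cintegral (fkernel y x0) = (kap * y)%:C.
Proof.
move=> y0; have := fourier_fkernel y x0 0.
rewrite !mul0r oppr0 expi0 mul1r add0r sub0r normrN normr0 mulr0 subr0 ger0_norm//.
have -> : fejer_mass / 2 * (y + y) = kap * y by rewrite /kap; field.
move=> <-; rewrite /fourier; congr cintegral; apply/funext => t.
by rewrite mul0r oppr0 expi0 mulr1.
Qed.

(** The kernel of frequency n has mass proportional to n, while its mass
    outside of a fixed neighbourhood of x0 stays bounded. So the integral of
    D against the kernel, which is 0, differs from a fixed multiple of n
    D(x0) by O(1) and a small multiple of n. *)
Lemma fejer_separation D x0 (B : R) : cmeasurable setT D -> (forall x, cmod (D x) <= B) ->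
  (forall e : R, 0 < e -> exists2 eta : R, 0 < eta &
     forall x, `|x - x0| < eta -> cmod (D x0 - D x) <= e) ->
  (forall n : nat, cintegral (fun x => D x * fkernel n%:R x0 x) = 0) -> D x0 = 0.
Proof.
move=> mD DB cD D0; have B0 : 0 <= B := le_trans (cmod_ge0 _) (DB 0).
apply: cmod_small => e e0.
have e3 : 0 < e / 3 by rewrite divr_gt0.
have [eta eta0 hD] := cD _ e3.
pose A := fine (\int[leb]_s ((oneDsqr s)^-1)%:E).
have Ap : (0 <= \int[leb]_s ((oneDsqr s)^-1)%:E)%E.
  by apply: integral_ge0 => s _; rewrite lee_fin invr_ge0 (le_trans _ (oneDsqr_ge1 s)).
have AE : (\int[leb]_s ((oneDsqr s)^-1)%:E = A%:E)%E.
  by rewrite fineK// ge0_fin_numE// integral_oneDsqrV_lty.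
have A0 : 0 <= A by rewrite fine_ge0.
(* K / (1 + s^2) dominates the kernel and the oscillation 2 B of D away from
   x0, by [fejer_tail]. *)
pose K := 2 * B * (2 * (1 + (eta ^+ 2)^-1)).
have K0 : 0 <= K by rewrite !mulr_ge0// addr_ge0// invr_ge0 sqr_ge0.
have [n nK] : exists n : nat, 2 * (K * A) / (kap * (e / 3)) < n%:R.
  by exists (Num.truncn (2 * (K * A) / (kap * (e / 3)))).+1; exact: truncnS_gt.
pose h x : C := (D x0 - D x) * fkernel n%:R x0 x.
have iv := cint_fkernel n%:R x0.
have n0 : 0 < n%:R :> R.
  by apply: le_lt_trans nK; apply: divr_ge0; apply: mulr_ge0; rewrite ?(ltW kap0) ?(ltW e3)// mulr_ge0.
have mE : cmeasurable setT (fun x => D x0 - D x) by apply: cmeasB => //; exact: cmeas_cst.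
have mh : cmeasurable setT h by apply: cmeasM => //; case: iv.
have iDv : cintegrable (fun x => D x * fkernel n%:R x0 x).
  by apply: cint_boundedM => //; exists B.
have hE : cintegral h = D x0 * (kap * n%:R)%:C.
  have := cintegralB (cintegrableZ (D x0) iv) iDv.
  rewrite D0 subr0 cintegralZ// cintegral_fkernel// => <-.
  by congr cintegral; apply/funext => x; rewrite /h mulrBl.
have habs : (absint h <= (e / 3 * (kap * n%:R) + K * A)%:E)%E.
  have mo : measurable_fun setT (fun x : R => ((oneDsqr (x - x0))^-1)%:E).
    exact: (measurableT_comp measurable_oneDsqrV (measurable_shift (- x0))).
  have mf : measurable_fun setT (fun x : R => (fejer n%:R (x - x0))%:E).
    exact: (measurableT_comp (measurable_EFejer n%:R) (measurable_shift (- x0))).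
  apply: (@le_trans _ _ (\int[leb]_x ((e / 3)%:E * (fejer n%:R (x - x0))%:E +
      K%:E * ((oneDsqr (x - x0))^-1)%:E))%E).
    rewrite absintE; apply: ge0_le_integral => //.
    - by move=> x _; rewrite lee_fin cmod_ge0.
    - exact: measurable_cmodE.
    - by apply: emeasurable_funD; apply: measurable_funeM.
    move=> x _; rewrite -!EFinM -EFinD lee_fin /h cmodM cmod_fkernel.
    have o0 : 0 <= (oneDsqr (x - x0))^-1 by rewrite invr_ge0 (le_trans _ (oneDsqr_ge1 _)).
    have f0 := fejer_ge0 n%:R (x - x0).
    have [lt|ge] := ltP `|x - x0| eta.
      by rewrite (le_trans (ler_wpM2r f0 (hD x lt)))// lerDl mulr_ge0.
    have c2 : cmod (D x0 - D x) <= 2 * B.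
      by rewrite (le_trans (cmodB _ _))// mulrDl !mul1r lerD.
    apply: (@le_trans _ _ (K * (oneDsqr (x - x0))^-1)); last by rewrite lerDr mulr_ge0// ltW.
    rewrite /K -mulrA; apply: ler_pM => //; first exact: cmod_ge0.
    exact: fejer_tail.
  rewrite ge0_integralD//; last 4 first.
  - by move=> x _; rewrite -EFinM lee_fin mulr_ge0 ?fejer_ge0// ltW.
  - exact: measurable_funeM.
  - by move=> x _; rewrite -EFinM lee_fin mulr_ge0// invr_ge0 (le_trans _ (oneDsqr_ge1 _)).
  - exact: measurable_funeM.
  rewrite !ge0_integralZl_EFin ?(ltW e3)//; last first.
    by move=> x _; rewrite lee_fin fejer_ge0.
  rewrite (integral_shift (- x0) (measurable_EFejer n%:R)) (integral_shift (- x0) measurable_oneDsqrV).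
  by rewrite integral_fejer AE ger0_norm ?(ltW n0)// -!EFinM -EFinD [n%:R * _]mulrC.
have := cintegral_le mh habs; rewrite hE cmodM cmodR ger0_norm ?mulr_ge0 ?(ltW kap0) ?(ltW n0)//.
set m := cmod (D x0) => hm.
have kn : 0 < kap * n%:R by rewrite mulr_gt0.
rewrite -(ler_pM2r kn); apply: (le_trans hm).
have hK : 2 * (K * A) <= e / 3 * (kap * n%:R).
  by move: nK; rewrite ltr_pdivrMr ?mulr_gt0// => /ltW/le_trans; apply; rewrite le_eqVlt; apply/orP; left; apply/eqP; ring.
have -> : e * (kap * n%:R) = 2 * (e / 3 * (kap * n%:R)) + e / 3 * (kap * n%:R) by field.
by rewrite mulrDr lerD2l.
Qed.

Lemma fourier_twist a f x : fourier (exp_twist a f) x = ell x a f.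
Proof.
rewrite /fourier /ell; congr cintegral; apply/funext => t.
by rewrite /exp_twist /lker; ring.
Qed.

Lemma cint_twist a f x : cintegrable (exp_twist a f) <-> cintegrable (fun t => f t * lker x a t).
Proof.
have me : cmeasurable setT (fun t : R => (expR (a * t))%:C).
  by apply: cmeas_real; apply: measurableT_comp => //; exact: measurable_scale.
split => -[mf hf].
- have := cint_char x (conj mf hf); congr cintegrable; apply/funext => t.
  by rewrite /exp_twist /lker; ring.
- have := cint_char (- x) (conj mf hf); congr cintegrable; apply/funext => t.
  rewrite /exp_twist /lker mulNr opprK [expi _ * _]mulrC mulrA -[LHS]mulrA -expiD addNr expi0.
  by rewrite mulr1.
Qed.

Lemma fourier_twist_shift a f X x : cmeasurable setT (exp_twist a f) -> cintegrable (exp_twist a f) ->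
  fourier (exp_twist a (fun t => f (t - X))) x = lker x a X * fourier (exp_twist a f) x.
Proof.
move=> mf iF; have il := (cint_twist a f x).1 iF.
rewrite !fourier_twist /ell -cintegralZ//.
rewrite -[RHS](cintegral_shift (- X)); last by apply: cmeasM; [exact: cmeas_cst|case: il].
congr cintegral; apply/funext => t; rewrite [RHS]mulrCA -lkerD [X + _]addrC subrK//.
Qed.

Lemma fkernel_le n (x0 x : R) : cmod (fkernel n%:R x0 x) <= 4 * n%:R ^+ 2.
Proof.
rewrite cmod_fkernel; case: n => [|n].
  by rewrite /fejer mul0r cos0 subrr mul0r mulr_ge0// sqr_ge0.
rewrite fejer_scale// [leRHS]mulrC ler_wpM2l ?sqr_ge0// (le_trans (fejer_le _))//.
by rewrite ler_piMr// invf_le1 ?(lt_le_trans _ (oneDsqr_ge1 _))//; exact: oneDsqr_ge1.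
Qed.

Lemma L2_fkernel n (x0 : R) : L2 (fkernel n%:R x0).
Proof.
have [mv fv] := cint_fkernel n%:R x0.
apply/L2P; split => //; rewrite pintE.
pose M : R := 4 * n%:R ^+ 2; have M0 : 0 <= M by rewrite mulr_ge0 ?sqr_ge0.
apply: (@le_lt_trans _ _ (M%:E * absint (fkernel n%:R x0))%E); last exact: EFin_mul_lty.
rewrite absintE -ge0_integralZl_EFin//; last 2 first.
- by move=> x _; rewrite lee_fin cmod_ge0.
- exact: measurable_cmodE.
apply: ge0_le_integral => //.
- by move=> x _; rewrite lee_fin mulr_ge0 ?powR_ge0.
- exact: (measurable_pint 2 density1 mv).
- by apply: measurable_funeM; exact: measurable_cmodE.
move=> x _; rewrite -EFinM lee_fin mulr1 powR_mulrn ?cmod_ge0// expr2.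
by rewrite ler_wpM2r ?cmod_ge0// fkernel_le.
Qed.

Lemma L2_fourier_fkernel n (x0 : R) : L2 (fourier (fkernel n%:R x0)).
Proof.
have iv := cint_fkernel n%:R x0.
have [B B0 hB] := fourier_bound iv; have mF := cmeas_fourier iv.
pose s x : C := step (2 * n%:R) (x + n%:R).
have two1 : (1 : R) <= 2 by rewrite ler1n.
have [ms _ fs] : Lp_itv (2 : R) 0 (2 * n)%:R (step (2 * n%:R)).
  apply: (Lploc_Lp_itv two1 (Lploc_step two1 _)) => x; rewrite natrM; exact: step_out.
have mss : cmeasurable setT s := cmeas_comp (measurable_shift n%:R) ms.
apply/L2P; split => //.
apply: (@le_lt_trans _ _ (pint 2 (cst 1%R) (fun x => B%:C * s x)%R)).
  apply: (le_pint density1 density1 mF); first by apply: cmeasM => //; exact: cmeas_cst.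
  move=> x; rewrite !mulr1; apply: (powR_le two1 (cmod_ge0 _)).
  rewrite cmodM cmodR (ger0_norm B0) /s /step.
  case: ifPn => [_|]; first by rewrite cmod1 mulr1.
  rewrite cmod0 mulr0 => h; rewrite fourier_fkernel_out ?cmod0//.
  move: h (ler0n R n); rewrite negb_and -ltNge -leNgt => /orP[h|h] n0.
    by rewrite ler0_norm; lra.
  by rewrite ger0_norm; lra.
rewrite (pintZ 2 _ density1 mss); apply: EFin_mul_lty; first exact: powR_ge0.
by rewrite (pint_shift 2 n%:R density1 ms).
Qed.

(** The symbol is only tested on the half-line, but the translates of [f] make the
    window on which the function [k] is seen as large as the compact support of
    the Fourier transform of the kernel. *)
Lemma symbol_identity (T : (R -> C) -> (R -> C)) (mu : R -> C) a f k x0 (Bm : R) :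
  cintegrable (exp_twist a f) -> cintegrable (exp_twist a k) ->
  (forall x, cmod (mu x) <= Bm) ->
  (forall e : R, 0 < e -> exists2 eta : R, 0 < eta &
     forall x, `|x - x0| < eta -> cmod (mu x0 - mu x) <= e) ->
  (forall X : nat, exists2 g,
     fourierL2 g (fun x => mu x * fourier (exp_twist a (fun t => f (t - X%:R))) x) &
     Eeq (exp_twist a (T (fun t => f (t - X%:R)))) g) ->
  (forall X : nat, \forall x \ae leb, 0 <= x -> T (fun t => f (t - X%:R)) x = k (x - X%:R)) ->
  mu x0 * fourier (exp_twist a f) x0 = fourier (exp_twist a k) x0.
Proof.
move=> iF ik muB muc hX hk; set phi := fourier (exp_twist a f).
pose G x := mu x * phi x.
have [Bf Bf0 phiB] := fourier_bound iF; have [Bk Bk0 kB] := fourier_bound ik.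
have Bm0 : 0 <= Bm := le_trans (cmod_ge0 _) (muB 0).
have [mF _] := iF; have mphi := cmeas_fourier iF; have mfk := cmeas_fourier ik.
have GXE X x : mu x * fourier (exp_twist a (fun t => f (t - X))) x = lker x a X * G x.
  by rewrite fourier_twist_shift// mulrCA.
have mG : cmeasurable setT G.
  have [g [_ [mG _] _] _] := hX 0; move: mG; congr (cmeasurable setT _).
  apply/funext => x; rewrite GXE /lker !mulr0 oppr0 expi0 expR0 rmorph1 !mul1r//.
have GB x : cmod (G x) <= Bm * Bf by rewrite cmodM ler_pM ?cmod_ge0.
pose D x := G x - fourier (exp_twist a k) x.
have mD : cmeasurable setT D by exact: cmeasB.
suff D0 : D x0 = 0 by apply/eqP; rewrite -subr_eq0; apply/eqP.
apply: (@fejer_separation D x0 (Bm * Bf + Bk)) => //.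
- by move=> x; rewrite (le_trans (cmodB _ _))// lerD.
- move=> e e0.
  have [c1 c2] := fourier_continuous ik; have [c3 c4] := fourier_continuous iF.
  have e4 : 0 < e / 4 by rewrite divr_gt0.
  have near (F : R -> C) : continuous (fun x => complex.Re (F x)) ->
      continuous (fun x => complex.Im (F x)) -> forall d : R, 0 < d ->
      exists2 eta : R, 0 < eta & forall x, `|x - x0| < eta -> cmod (F x0 - F x) <= 2 * d.
    move=> cR cI d d0.
    have /cvgrPdist_le/(_ d d0) nR := cR x0; have /cvgrPdist_le/(_ d d0) nI := cI x0.
    have [eta /= eta0 h] := filterI nR nI; exists eta => // x xx.
    have [h1 h2] : `|complex.Re (F x0) - complex.Re (F x)| <= d /\
      `|complex.Im (F x0) - complex.Im (F x)| <= d by apply: h; rewrite /= distrC.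
    rewrite (le_trans (cmod_le_ReIm _))// ReD ImD ReN ImN mulrDl !mul1r lerD//.
  have q0 : 0 < Bm + 1 by rewrite ltr_wpDl.
  have d10 : 0 < e / 8 / (Bm + 1) by rewrite !divr_gt0.
  have e8 : 0 < e / 8 by rewrite divr_gt0.
  have [t1 t10 h1] := near phi c3 c4 _ d10.
  have [t2 t20 h2] := near (fourier (exp_twist a k)) c1 c2 _ e8.
  have d30 : 0 < e / 4 / (Bf + 1) by rewrite !divr_gt0// ltr_wpDl.
  have [t3 t30 h3] := muc _ d30.
  exists (Num.min t1 (Num.min t2 t3)); first by rewrite !lt_min t10 t20 t30.
  move=> x; rewrite !lt_min => /andP[x1 /andP[x2 x3]].
  rewrite /D /G (_ : _ - _ = mu x0 * (phi x0 - phi x) + (mu x0 - mu x) * phi x -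
    (fourier (exp_twist a k) x0 - fourier (exp_twist a k) x)); last by ring.
  apply: (le_trans (cmodB _ _)); apply: (@le_trans _ _ (e / 4 + e / 4 + e / 4)); last by lra.
  apply: lerD; last by apply: (le_trans (h2 x x2)); lra.
  apply: (le_trans (cmodD _ _)); rewrite !cmodM; apply: lerD.
    apply: (@le_trans _ _ ((Bm + 1) * (2 * (e / 8 / (Bm + 1))))).
      by apply: ler_pM; rewrite ?cmod_ge0 ?h1// (le_trans (muB _))// lerDl.
    by rewrite le_eqVlt; apply/orP; left; apply/eqP; field; rewrite gt_eqF.
  apply: (@le_trans _ _ (e / 4 / (Bf + 1) * (Bf + 1))).
    by apply: ler_pM; rewrite ?cmod_ge0 ?h3// (le_trans (phiB _))// lerDl.
  by rewrite divfK// gt_eqF// ltr_wpDl.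
move=> n; set v := fkernel n%:R x0.
have iv : cintegrable v := cint_fkernel _ _; have [mv _] := iv.
have iGv : cintegrable (fun x => G x * v x).
  by apply: cint_boundedM => //; exists (Bm * Bf) => //; rewrite mulr_ge0.
have ikv : cintegrable (fun x => fourier (exp_twist a k) x * v x).
  by apply: cint_boundedM => //; exists Bk.
suff E : cintegral (fun x => G x * v x) = cintegral (fun x => fourier (exp_twist a k) x * v x).
  have := cintegralB iGv ikv; rewrite E subrr => <-.
  by congr cintegral; apply/funext => x; rewrite mulrBl.
pose X : R := n%:R.
(* The translation of f by X multiplies its transform by e^(-ixX), which the
   modulation of the kernel cancels. *)
pose vX x : C := v x * expi (X * x).
have me : cmeasurable setT (fun x : R => expi (X * x) : C).
  by apply: cmeas_expi; exact: measurable_scale.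
have vXn x : cmod (vX x) = cmod (v x) by rewrite cmodM cmod_expi mulr1.
have mvX : cmeasurable setT vX by exact: cmeasM.
have ivX : cintegrable vX by apply: (le_cintegrable mvX _ iv) => x; rewrite vXn.
have LvX : L2 vX.
  have /L2P[_ h] := L2_fkernel n x0; apply/L2P; split => //; apply: le_lt_trans h.
  by apply: (le_pint density1 density1 mvX mv) => x; rewrite vXn.
have fvX x : fourier vX x = fourier v (x - X).
  congr cintegral; apply/funext => t; rewrite /vX -mulrA -expiD.
  by congr (_ * expi _); ring.
have LfvX : L2 (fourier vX).
  have -> : fourier vX = fun x => fourier v (x - X) by apply/funext.
  have /L2P[m h] := L2_fourier_fkernel n x0; apply/L2P.
  split; first exact: (cmeas_comp (measurable_shift (- X)) m).
  by rewrite (pint_shift 2 (- X) density1 m).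
have [g gG gE] := hX n; have [Lg _ _] := gG; have [mg _] := Lg.
have P := plancherel_pairing gG ivX LvX LfvX.
pose c : C := (expR (a * X))%:C.
have c0 : c != 0.
  by apply/eqP => /(congr1 (@cmod R)); rewrite cmodR cmod0 ger0_norm ?expR_ge0// => /eqP; rewrite gt_eqF ?expR_gt0.
apply: (mulfI c0); rewrite -!cintegralZ//.
have -> : (fun x => c * (G x * v x)) =
    (fun x => mu x * fourier (exp_twist a (fun t => f (t - n%:R))) x * vX x).
  apply/funext => x; rewrite GXE /vX /lker -/X.
  have e1 : expi (- (x * X)) * expi (X * x) = 1 :> C by rewrite -expiD [X * x]mulrC addNr expi0.
  rewrite -/c; transitivity (c * (G x * v x) * (expi (- (x * X)) * expi (X * x))); last by ring.
  by rewrite e1 mulr1.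
rewrite P cintegralZ// (multiplication_formula ik iv) -cintegralZ; last first.
  have [mfv _] := cmeas_fourier iv.
  have h := cint_boundedM ik (cmeas_fourier iv) (fourier_bound iv).
  by move: h; congr cintegrable; apply/funext => x; rewrite mulrC.
have mk : cmeasurable setT (exp_twist a k) by case: ik.
have mck : cmeasurable setT (fun x => c * (exp_twist a k x * fourier v x)).
  by apply: cmeasM; [exact: cmeas_cst|apply: cmeasM => //; exact: cmeas_fourier].
rewrite -[RHS](cintegral_shift (- X))//.
apply: eq_cintegral_ae.
- by apply: cmeasM => //; case: LfvX.
- exact: (cmeas_comp (measurable_shift (- X)) mck).
move/EeqR : gE => gE; apply: aeS (aeI gE (hk n)) => x [e1 e2].
(* For x < 0 the transform of the kernel at x - X vanishes, as X equals its
   frequency. *)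
rewrite fvX; have [x0'|x0'] := ltP x 0.
  by rewrite fourier_fkernel_out ?mulr0// ler0_norm /X; have := ler0n R n; lra.
rewrite -e1// /exp_twist e2//.
have -> : (expR (a * x))%:C = c * (expR (a * (x - X)))%:C.
  by rewrite /c -rmorphM -expRD; congr (_%:C); congr expR; ring.
by rewrite /X; ring.
Qed.

End SymbolIdentity.

(** * Smooth bumps *)

Section Bump.
Context {R : realType}.
Local Notation C := R[i].
Local Notation leb := (@lebesgue_measure R).

(** The functions x^(-k) e^(-1/x), extended by zero, are stable under
    differentiation up to linear combinations, including at 0. *)
Definition flat (k : nat) (x : R) : R := if 0 < x then x ^- k * expR (- x^-1) else 0.

(** From 1 + v <= e^v at v = u / (n + 1). *)
Lemma expR_ge_pow (n : nat) (u : R) : 0 < u -> (u / n.+1%:R) ^+ n.+1 <= expR u.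
Proof.
move=> u0; have n0 : 0 < n.+1%:R :> R by rewrite ltr0n.
have -> : expR u = expR (u / n.+1%:R) ^+ n.+1 by rewrite -expRM_natr divfK// gt_eqF.
rewrite lerXn2r ?nnegrE ?expR_ge0 ?divr_ge0// ?(ltW u0)//.
by apply: le_trans (expR_ge1Dx _); rewrite lerDr.
Qed.

Lemma flat_ge0 k x : 0 <= flat k x.
Proof.
by rewrite /flat; case: ifP => // x0; rewrite mulr_ge0 ?expR_ge0// invr_ge0 exprn_ge0// ltW.
Qed.

Lemma flat_le k : exists2 K : R, 0 <= K & forall x, flat k x <= K * `|x|.
Proof.
exists (k.+1%:R ^+ k.+1) => [|x]; first by rewrite exprn_ge0.
rewrite /flat; case: ifP => [x0|_]; last by rewrite mulr_ge0 ?exprn_ge0.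
rewrite gtr0_norm// expRN.
have i0 : 0 < x^-1 by rewrite invr_gt0.
have := expR_ge_pow k i0.
set E := expR _ => hE; have E0 : 0 < E by exact: expR_gt0.
rewrite ler_pdivrMr//.
have n0 : 0 < k.+1%:R :> R by rewrite ltr0n.
apply: (@le_trans _ _ (k.+1%:R ^+ k.+1 * x * (x^-1 / k.+1%:R) ^+ k.+1)); last first.
  by rewrite ler_wpM2l// mulr_ge0 ?exprn_ge0// ltW.
rewrite le_eqVlt; apply/orP; left; apply/eqP.
have nk : k.+1%:R ^+ k.+1 != 0 :> R by rewrite expf_neq0// gt_eqF.
have xk : x ^+ k != 0 by rewrite expf_neq0// gt_eqF.
rewrite expr_div_n exprVn [x ^+ k.+1]exprS.
move: nk xk; set a := _ ^+ k.+1; set b := x ^+ k => nk xk; field.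
by rewrite nk xk gt_eqF.
Qed.

Lemma flat_div k x : x != 0 -> x^-1 * flat k x = flat k.+1 x.
Proof.
by move=> x0; rewrite /flat; case: ifP => _; rewrite ?mulr0// mulrA exprS invfM.
Qed.

Lemma is_derive_comp (f g : R -> R) (x df dg : R) : is_derive x 1 g dg ->
  is_derive (g x) 1 f df -> is_derive x 1 (f \o g) (df * dg).
Proof.
move=> [g1 g2] [f1 f2]; apply: DeriveDef.
  apply/derivable1_diffP; apply: differentiable_comp; exact/derivable1_diffP.
by rewrite -derive1E derive1_comp// !derive1E f2 g2.
Qed.

(** At 0 the difference quotient is [flat k.+1], which tends to 0 by
    [flat_le]. *)
Lemma is_derive_flat k (x : R) : is_derive x 1 (flat k) (- (k%:R * flat k.+1 x) + flat k.+2 x).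
Proof.
have [x0|x0|->] := ltgtP x 0.
- have -> : - (k%:R * flat k.+1 x) + flat k.+2 x = 0.
    by rewrite /flat !ltNge !(ltW x0) /= mulr0 oppr0 addr0.
  have dz : is_derive x (1 : R) (cst (0 : R)) (0 : R) by exact: is_derive_cst.
  apply: (near_eq_is_derive _ dz).
  near=> y; rewrite /flat ltNge; suff -> : y <= 0 by [].
  by apply: ltW; near: y; exact: lt_nbhsl.
- pose F (y : R) := y ^- k * expR (- y^-1).
  have xn0 : x != 0 by rewrite gt_eqF.
  have d1 : is_derive x 1 (fun y : R => y^-1) (- x ^- 2).
    by have := is_deriveV xn0 (is_derive_id x 1); rewrite /GRing.scale /= mulr1.
  have d2 : is_derive x 1 (expR \o (fun y : R => - y^-1)) (expR (- x^-1) * x ^- 2).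
    have d1n : is_derive x 1 (fun y : R => - y^-1) (x ^- 2).
      by have := is_deriveN d1; rewrite opprK.
    exact: (is_derive_comp d1n (is_derive_expR (- x^-1))).
  have d3 : is_derive x 1 (fun y : R => y ^- k) (- (k%:R * x ^- k.+1)).
    have xk : x ^+ k != 0 by rewrite expf_neq0.
    have dX : is_derive x 1 (fun y : R => y ^+ k) (k%:R * x ^+ k.-1).
      have -> : (fun y : R => y ^+ k) = (id : R -> R) ^+ k by apply/funext => y; rewrite exprfctE.
      by have := is_deriveX k (is_derive_id x 1); rewrite /GRing.scale /= mulr1.
    have := is_deriveV (f := fun y : R => y ^+ k) xk dX; congr (is_derive _ _ _ _).
    rewrite /GRing.scale /=; case: k {F xk dX} => [|k]; first by rewrite !mul0r mulr0 oppr0.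
    by rewrite /= !exprS; field; rewrite xn0 expf_neq0.
  have dF : is_derive x 1 F (- (k%:R * flat k.+1 x) + flat k.+2 x).
    have := is_deriveM d3 d2; congr (is_derive _ _ _ _).
    rewrite /flat x0 /GRing.scale /= !exprS; field.
    by rewrite xn0 expf_neq0.
  apply: (near_eq_is_derive _ dF).
  near=> y; rewrite /flat; suff -> : 0 < y by [].
  by near: y; exact: lt_nbhsr.
- have -> : - (k%:R * flat k.+1 0) + flat k.+2 0 = 0 :> R.
    by rewrite /flat ltxx mulr0 oppr0 addr0.
  have cv : (fun h : R => h^-1 *: ((flat k \o shift 0) (h *: 1) - flat k 0)) @ 0^' --> (0 : R).
    have [K K0 hK] := flat_le k.+1.
    apply/cvgrPdist_le => e e0; near=> h.
    have h0 : h != 0 by near: h; exact: nbhs_dnbhs_neq.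
    rewrite /= addr0 /GRing.scale /= mulr1 {2}/flat ltxx subr0 sub0r normrN flat_div//.
    rewrite ger0_norm ?flat_ge0// (le_trans (hK h))//.
    have : `|h| <= e / (K + 1).
      near: h; apply: dnbhs0_le; rewrite divr_gt0// ltr_wpDl//.
    rewrite ler_pdivlMr ?ltr_wpDl// => /(le_trans _); apply.
    by rewrite mulrC ler_wpM2l// lerDl.
  apply: DeriveDef; first by apply/cvg_ex; exists 0.
  exact: (cvg_lim _ cv).
Unshelve. all: by end_near. Qed.

Variables (c d : R).

(** The linear span of the products of flat functions at both ends of the
    interval. It is stable under differentiation, which makes all its
    elements smooth. *)
Inductive bump_class : (R -> R) -> Prop :=
| bump_base (r : R) k l : bump_class (fun x => r * (flat k (x - c) * flat l (d - x)))
| bump_add f g : bump_class f -> bump_class g -> bump_class (fun x => f x + g x).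

Lemma bump_class_derive f : bump_class f -> exists2 f', bump_class f' &
  forall x : R, is_derive x 1 f (f' x).
Proof.
elim=> [r k l|f1 f2 _ [f1' h1 d1] _ [f2' h2 d2]]; last first.
  exists (fun x => f1' x + f2' x); first exact: bump_add.
  by move=> x; apply: is_deriveD.
exists (fun x => ((- k%:R * r) * (flat k.+1 (x - c) * flat l (d - x)) +
                 r * (flat k.+2 (x - c) * flat l (d - x))) +
                ((l%:R * r) * (flat k (x - c) * flat l.+1 (d - x)) +
                 - r * (flat k (x - c) * flat l.+2 (d - x)))).
  by do 2 apply: bump_add; exact: bump_base.
move=> x.
have e1 : is_derive x 1 (fun y : R => y - c) 1.
  by have := is_deriveD (is_derive_id x 1) (is_derive_cst (- c) x 1); rewrite addr0.
have e2 : is_derive x 1 (fun y : R => d - y) (- 1).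
  by have := is_deriveB (is_derive_cst d x 1) (is_derive_id x 1); rewrite sub0r.
have := is_deriveZ r (is_deriveM (is_derive_comp e1 (is_derive_flat k (x - c)))
  (is_derive_comp e2 (is_derive_flat l (d - x)))).
by congr (is_derive _ _ _ _); rewrite /GRing.scale /=; ring.
Qed.

Lemma bump_class_smooth f n : bump_class f -> exists2 h, bump_class h & derive1n n f = h.
Proof.
move=> bf; elim: n => [|n [h bh hE]]; first by exists f.
have [h' bh' dh] := bump_class_derive bh; exists h' => //.
rewrite derive1nS hE; apply/funext => x; rewrite derive1E.
by have [_ ->] := dh x.
Qed.

Definition bump (x : R) : R := flat 0 (x - c) * flat 0 (d - x).

Lemma bump_derivable n x : derivable (derive1n n bump) x 1.
Proof.
have bb : bump_class bump.
  have := bump_base 1 0 0; congr bump_class.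
  by apply/funext => y; rewrite mul1r.
have [h bh ->] := bump_class_smooth n bb.
by have [h' _ /(_ x)[]] := bump_class_derive bh.
Qed.

Lemma bump_out x : ~~ (c < x < d) -> bump x = 0.
Proof.
rewrite negb_and -!leNgt /bump /flat !subr_gt0 => /orP[xc|dx].
  by rewrite ltNge xc mul0r.
by rewrite [x < d]ltNge dx mulr0.
Qed.

Lemma bump_gt0 x : c < x < d -> 0 < bump x.
Proof.
by move=> /andP[cx xd]; rewrite /bump /flat !subr_gt0 cx xd !expr0 !invr1 !mul1r mulr_gt0 ?expR_gt0.
Qed.

Lemma bump_ge0 x : 0 <= bump x.
Proof. by rewrite mulr_ge0 ?flat_ge0. Qed.

Lemma bump_le1 x : bump x <= 1.
Proof.
have h y : flat 0 y <= 1.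
  rewrite /flat; case: ifP => // y0; rewrite expr0 invr1 mul1r -expR0 ler_expR oppr_le0.
  by rewrite invr_ge0 ltW.
by rewrite -[1]mulr1 ler_pM ?flat_ge0.
Qed.

Lemma measurable_bump : measurable_fun setT bump.
Proof.
apply: continuous_measurable_fun => x.
have := @bump_derivable 0%N x; rewrite derive1n0 => /derivable1_diffP/differentiable_continuous.
exact.
Qed.

Lemma test_function_bump : 0 <= c -> test_function (fun x => (bump x)%:C : C).
Proof.
move=> c0.
have sub : [set x | (bump x)%:C != 0 :> C] `<=` `[c, d]%classic.
  move=> x /=; rewrite in_itv /=; apply: contraNT => h.
  rewrite bump_out ?rmorph0//; apply: contra h => /andP[h1 h2].
  by rewrite !ltW.
have sub' : closure [set x | (bump x)%:C != 0 :> C] `<=` `[c, d]%classic.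
  have cl : closed (`[c, d]%classic : set R) by exact: itv_closed.
  have := closure_subset sub; rewrite -[X in _ `<=` X -> _]((closure_id _).1 cl); exact.
split.
- by move=> n x; exact: bump_derivable.
- move=> n x; rewrite (_ : (fun y => _) = cst 0); last by apply/funext.
  have -> : derive1n n (cst 0 : R -> R) = cst 0.
    by elim: n => [//|n ih]; rewrite derive1nS ih; apply/funext => y; rewrite derive1_cst.
  exact: derivable_cst.
- apply: (subclosed_compact _ (segment_compact (a := c) (b := d))) => //.
  exact: closed_closure.
- by apply: (subset_trans sub') => x; rewrite RplusE /= in_itv /= => /andP[/(le_trans c0)].
Qed.

End Bump.

(** * Values of the symbol and the spectrum *)

Section SymbolValues.
Context {R : realType}.
Local Notation C := R[i].
Local Notation leb := (@lebesgue_measure R).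
Variables (p : R) (w : R -> R).
Hypothesis hp : 1 <= p.
Hypothesis hw : weight w.
Implicit Types (f g h : R -> C) (T U : (R -> C) -> (R -> C)).
#[local] Opaque opnorm Enorm alpha0 alpha1.
Let p0 : 0 < p. Proof. exact: lt_le_trans ltr01 hp. Qed.

Definition cbump (c d x : R) : C := (bump c d x)%:C.

Lemma cbump_shift c d (t x : R) : cbump c d (x - t) = cbump (c + t) (d + t) x.
Proof.
rewrite /cbump /bump; congr (_%:C); congr (flat 0 _ * flat 0 _); ring.
Qed.

Lemma cbump_out c d (x : R) : ~~ (c < x < d) -> cbump c d x = 0.
Proof. by move=> h; rewrite /cbump bump_out. Qed.

Lemma Lploc_cbump c d : 0 <= c -> Lploc p (cbump c d).
Proof.
move=> c0; have m : cmeasurable setT (cbump c d).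
  by apply: cmeas_real; exact: measurable_bump.
apply: (Lploc_le hp (Lploc_step hp d) m) => x; rewrite /step.
have [/andP[x0 xd]|h] := boolP (0 <= x < d).
  by rewrite cmod1 /cbump cmodR ger0_norm ?bump_ge0// bump_le1.
rewrite cbump_out; first by rewrite cmod0.
by apply: contra h => /andP[cx ->]; rewrite (le_trans c0 (ltW cx)).
Qed.

Lemma Lp_itv_cbump c d (N : nat) : 0 <= c -> d <= N%:R -> Lp_itv p 0 N%:R (cbump c d).
Proof.
move=> c0 dN; apply: (Lploc_Lp_itv hp (Lploc_cbump d c0)) => x Nx.
by apply: cbump_out; rewrite negb_and -!leNgt (le_trans dN Nx) orbT.
Qed.

Lemma cint_cbump_twist c d a : 0 <= c -> cintegrable (exp_twist a (cbump c d)).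
Proof.
move=> c0; have m : cmeasurable setT (cbump c d).
  by apply: cmeas_real; exact: measurable_bump.
have me : cmeasurable setT (fun t : R => (expR (a * t))%:C : C).
  by apply: cmeas_real; apply: measurableT_comp => //; exact: measurable_scale.
pose B := expR (`|a| * `|d|).
have [N dN] : exists N : nat, d <= N%:R.
  exists `|Num.ceil d|.+1.
  by rewrite (le_trans (ceil_ge d))// -natr1 -[leLHS]addr0 lerD// natr_absz ler_int ler_norm.
have one1 : (1 : R) <= 1 by [].
have [ms _ fs] : Lp_itv (1 : R) 0 N%:R (step d : R -> C).
  apply: (Lploc_Lp_itv one1 (Lploc_step one1 d)) => x Nx; apply: step_out; exact: le_trans Nx.
have istep : cintegrable (step d : R -> C).
  split => //; move: fs; rewrite absintE pintE; congr (_ < _)%E.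
  by apply: eq_integral => x _; rewrite mulr1 powRr1 ?cmod_ge0.
apply: (le_cintegrable _ _ (cintegrableZ B%:C istep)); first exact: cmeasM.
move=> x; rewrite /exp_twist !cmodM !cmodR (ger0_norm (expR_ge0 _)) (ger0_norm (expR_ge0 _)).
have [/andP[cx xd]|h] := boolP (c < x < d); last by rewrite bump_out// normr0 mul0r mulr_ge0 ?expR_ge0 ?cmod_ge0.
have x0 : 0 < x := le_lt_trans c0 cx.
rewrite /step xd (ltW x0) cmod1 mulr1 ger0_norm ?bump_ge0//.
rewrite -[leRHS]mul1r; apply: ler_pM; rewrite ?bump_ge0 ?expR_ge0 ?bump_le1//.
rewrite ler_expR (le_trans (ler_norm _))// normrM ler_wpM2l// (gtr0_norm x0).
by rewrite (le_trans (ltW xd))// ler_norm.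
Qed.

(** On a support of length less than 1 / |x0| the cosine of the kernel stays
    positive, so nothing cancels in the real part. *)
Lemma ell_cbump_neq0 (x0 a : R) : exists2 d : R, 0 < d <= 1 & ell x0 a (cbump 0 d) != 0.
Proof.
pose d : R := (1 + `|x0|)^-1.
have q0 : 0 < 1 + `|x0| by rewrite ltr_pwDl.
have d0 : 0 < d by rewrite invr_gt0.
have d1 : d <= 1 by rewrite invf_le1// lerDl.
exists d; first by rewrite d0.
have cosge x : 0 < x < d -> 0 < cos (x0 * x).
  move=> /andP[xp xd].
  have -> : cos (x0 * x) = cos `|x0 * x| by case: (ler0P (x0 * x)) => _; rewrite ?cosN.
  have lt1 : `|x0 * x| < 1.
    rewrite normrM (gtr0_norm xp); apply: (@le_lt_trans _ _ (`|x0| * d)).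
      by rewrite ler_wpM2l// ltW.
    by rewrite ltr_pdivrMr// mul1r ltrDr.
  have := pihalf_ge1 R => p1.
  have h0 : 0 <= `|x0 * x| by exact: normr_ge0.
  by rewrite cos_gt0_pihalf//; apply/andP; split; lra.
have i := (cint_twist a (cbump 0 d) x0).1 (cint_cbump_twist d a (lexx 0)).
apply/eqP => e0.
pose F (x : R) : R := complex.Re (cbump 0 d x * lker x0 a x).
have FE x : F x = bump 0 d x * (cos (x0 * x) * expR (a * x)).
  by rewrite /F /cbump /lker !ReM /= cosN; ring.
have F0 x : 0 <= F x.
  rewrite FE; have [h|h] := boolP (0 < x < d); last by rewrite bump_out// mul0r.
  by apply: mulr_ge0; [exact: bump_ge0|apply: mulr_ge0; [exact: ltW (cosge _ h)|exact: expR_ge0]].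
have iF := cintegrable_Re i.
have mF : measurable_fun setT (fun x => (F x)%:E) by case/integrableP: iF.
have z : (\int[leb]_x (F x)%:E = 0)%E.
  have := congr1 (@complex.Re R) e0; rewrite /= /Rintegral => h.
  rewrite -[LHS]fineK; last exact: (integrable_fin_num measurableT iF).
  by congr EFin.
have ae0 : \forall x \ae leb, (F x)%:E = 0%E.
  have za : (\int[leb]_x `|(F x)%:E| = 0)%E.
    by rewrite -z; apply: eq_integral => x _; rewrite gee0_abs// lee_fin.
  move/(ae_eq_integral_abs leb measurableT mF) : za.
  by apply: aeS => x /(_ I).
have [A [mA A0 sA]] := ae0.
have I01 : `]0, d[%classic `<=` A.
  move=> x; rewrite /= in_itv /= => xd; apply: sA => /= -[] /eqP.
  rewrite FE gt_eqF//; apply: mulr_gt0; first exact: bump_gt0.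
  by apply: mulr_gt0; [exact: cosge|exact: expR_gt0].
have : (leb `]0%R, d[%classic <= leb A)%E by apply: le_measure => //; rewrite inE.
rewrite [X in (_ <= X)%E -> _]A0 lebesgue_measure_itv /= lte_fin d0 -EFinB subr0.
by rewrite lee_fin leNgt d0.
Qed.

Lemma cintegrable_ae f g : cmeasurable setT f -> cmeasurable setT g ->
  (\forall x \ae leb, f x = g x) -> cintegrable g -> cintegrable f.
Proof. by move=> mf mg fg [_ ig]; split => //; rewrite (eq_absint_ae mf mg fg). Qed.

Lemma derivable_continuous (mu : C -> C) (z : C) : derivable (mu : C^o -> C^o) z 1 ->
  forall e : R, 0 < e -> exists2 eta : R, 0 < eta &
    forall y, cmod (y - z) < eta -> cmod (mu z - mu y) <= e.
Proof.
move=> dz e e0.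
have e0C : 0 < e%:C :> C by rewrite ltcR.
have /derivable1_diffP/differentiable_continuous/cvgrPdist_le/(_ _ e0C) := dz.
case/nbhs_ballP => eta /= eta0 h.
have etaE : eta = (complex.Re eta)%:C.
  by move: eta0; rewrite ltcE => /andP[/eqP im0 _]; apply: complex_eq.
exists (complex.Re eta); first by rewrite -ltcR -etaE.
move=> y yz; have : ball (z : C^o) eta (y : C^o).
  by rewrite -ball_normE /ball_ /= etaE -opprB normrN ltcR.
by move=> /h; rewrite /= lecR.
Qed.

Lemma holomorphic_line (D : set C) (mu : C -> C) (x0 a : R) : holomorphic_on D mu -> D (x0 +i* a) ->
  forall e : R, 0 < e -> exists2 eta : R, 0 < eta &
    forall x, `|x - x0| < eta -> cmod (mu (x0 +i* a) - mu (x +i* a)) <= e.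
Proof.
move=> hol Dz e e0; have [eta eta0 h] := derivable_continuous (hol _ Dz) e0.
exists eta => // x xx; apply: h.
have -> : x +i* a - (x0 +i* a) = (x - x0)%:C.
  by apply: complex_eq => /=; rewrite ?subrr.
by rewrite cmodR.
Qed.

Section RightSymbol.
Variables (T : (R -> C) -> (R -> C)) (mu : C -> C).
Hypothesis iT : invariant p w right_shift T.
Hypothesis sT : is_symbol T (calO p w) mu.

Lemma rglue_T d : d <= 1 -> \forall x \ae leb, rglue T (cbump 0 d) x = cut (T (cbump 0 d)) x.
Proof.
move=> d1; have Lf := Lploc_cbump d (lexx 0).
apply: ae_Rplus => [N|x x0]; last by rewrite /rglue glue_lt0// cut_lt0.
have tr : trunc N.+1 (cbump 0 d) = cbump 0 d.
  apply/funext => x; rewrite /trunc; case: ltP => // Nx; rewrite cbump_out//.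
  rewrite negb_and -!leNgt; apply/orP; right; apply: (le_trans d1); apply: le_trans Nx.
  by rewrite ler1n.
apply: aeS (rglueE hp hw N.+1 iT Lf) => x h /andP[x0 xN].
by rewrite h ?tr ?cut_id// x0 (lt_trans xN)// ltr_nat.
Qed.

(** [symbol_identity] applies with k = T f, as T commutes with the
    translations of f, and both sides are compared with the eigenvalue
    relation for the same bump f. *)
Lemma right_symbol_character x0 a m : a < alpha0 p w ->
  character p w rglue T x0 a m -> mu (x0 +i* a) = m.
Proof.
move=> aa [hm _]; have [d /andP[d0 d1] ne] := ell_cbump_neq0 x0 a.
set f := cbump 0 d in ne; have [bT cT] := iT; have [hol [Bm muB] hs] := sT.
have line x : calO p w (x +i* a) by [].
have Kf : Lp_itv p 0 1%:R f by exact: Lp_itv_cbump.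
have Lf := Lploc_cbump d (lexx 0).
have Ef : E p w f.
  apply: (@Lploc_E _ _ _ hp hw _ 1 Lf) => x x1; apply: cbump_out.
  by rewrite negb_and -!leNgt (le_trans d1 x1) orbT.
pose k := cut (T f).
have mk : cmeasurable setT k by apply: (E_cmeas hp (bounded_ET bT Ef)).
have [iG eG] := hm 1%N f Kf; have aeG := rglue_T d1.
have mkl : cmeasurable setT (fun x => k x * lker x0 a x) by apply: cmeasM => //; exact: cmeas_lker.
have aekl : \forall x \ae leb, k x * lker x0 a x = rglue T f x * lker x0 a x.
  by apply: aeS aeG => x ->.
have ik : cintegrable (fun x => k x * lker x0 a x).
  exact: (cintegrable_ae mkl iG.1 aekl iG).
have fX (X : nat) : (fun t => f (t - X%:R)) = cbump X%:R (d + X%:R).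
  by apply/funext => t; rewrite /f cbump_shift add0r.
have key : mu (x0 +i* a) * fourier (exp_twist a f) x0 = fourier (exp_twist a k) x0.
  apply: (@symbol_identity _ T (fun x => mu (x +i* a)) a f k x0 Bm).
  - exact: cint_cbump_twist.
  - exact/(cint_twist a k x0).
  - by move=> x; apply: muB.
  - exact: holomorphic_line hol (line x0).
  - move=> X; rewrite fX; apply: hs => //.
    by apply: test_function_bump; exact: ler0n.
  - move=> X.
    have -> : (fun t => f (t - X%:R)) = right_shift X%:R f.
      apply/funext => t; rewrite /right_shift; case: leP => // tX.
      by rewrite /f cbump_out// negb_and -!leNgt subr_le0 (ltW tX).
    have /EeqR := cT X%:R (ler0n _ X) f Ef; apply: aeS => x h x0'.
    by rewrite h// /right_shift /k /cut subr_ge0.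
apply: (mulIf ne); rewrite -eG -fourier_twist key fourier_twist.
by apply: eq_cintegral_ae => //; case: iG.
Qed.

End RightSymbol.

(** Reversing time changes z into - z, up to the factor e^(-iz). *)
Lemma ell_refl x0 a h : cintegrable (fun s => h s * lker (- x0) (- a) s) ->
  cintegrable (fun t => h (1 - t) * lker x0 a t) /\
  ell x0 a (fun t => h (1 - t)) = lker x0 a 1 * ell (- x0) (- a) h.
Proof.
move=> ih; pose H s : C := lker x0 a 1 * (h s * lker (- x0) (- a) s).
have iH : cintegrable H by exact: cintegrableZ.
have [mH fH] := iH.
have e : (fun t => h (1 - t) * lker x0 a t) = fun t => H (1 - t).
  apply/funext => t; rewrite /H.
  have -> : lker (- x0) (- a) (1 - t) = lker x0 a (t - 1).
    by rewrite /lker; congr (expi _ * (expR _)%:C); ring.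
  by rewrite [RHS]mulrCA -lkerD (addrC 1 (t - 1)) subrK.
rewrite /ell e; split.
  split; first exact: (cmeas_comp (measurable_refl 1) mH).
  by rewrite absint_refl.
by rewrite cintegral_refl// cintegralZ.
Qed.

Section LeftSymbol.
Variables (T : (R -> C) -> (R -> C)) (mu : C -> C).
Hypothesis iT : invariant p w left_shift T.
Hypothesis sT : is_symbol T (calV p w) mu.

(** The translates f (. - X) are reversals on [0, X + 1] of one and the same
    bump F = f (1 - .). Hence their images under T are the reversals of the
    extension of T applied to F; this is why z and - z correspond. *)
Lemma left_symbol_character x0 a m : - alpha1 p w < a ->
  character p w lglue T (- x0) (- a) m -> mu (x0 +i* a) = m.
Proof.
move=> aa [hm _]; have [d /andP[d0 d1] ne] := ell_cbump_neq0 x0 a.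
set f := cbump 0 d in ne; have [bT cT] := iT; have [hol [Bm muB] hs] := sT.
have line x : calV p w (x +i* a) by [].
have d10 : 0 <= 1 - d by rewrite subr_ge0.
pose F := cbump (1 - d) 1.
have fF : f = fun t => F (1 - t).
  apply/funext => t; rewrite /f /F /cbump /bump mulrC; congr (_%:C); congr (flat 0 _ * flat 0 _); ring.
have KF : Lp_itv p 0 1%:R F by exact: Lp_itv_cbump.
have LF := Lploc_cbump 1 d10.
have [iG eG] := hm 1%N F KF.
pose k t := lglue T F (1 - t).
have [ik ek] := ell_refl iG.
have [_ ef] : cintegrable (fun t => F (1 - t) * lker x0 a t) /\
    ell x0 a (fun t => F (1 - t)) = lker x0 a 1 * ell (- x0) (- a) F.
  by apply: ell_refl; apply/cint_twist; exact: cint_cbump_twist.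
have fX (X : nat) : (fun t => f (t - X%:R)) = cbump X%:R (d + X%:R).
  by apply/funext => t; rewrite /f cbump_shift add0r.
have key : mu (x0 +i* a) * fourier (exp_twist a f) x0 = fourier (exp_twist a k) x0.
  apply: (@symbol_identity _ T (fun x => mu (x +i* a)) a f k x0 Bm).
  - exact: cint_cbump_twist.
  - exact/(cint_twist a k x0).
  - by move=> x; apply: muB.
  - exact: holomorphic_line hol (line x0).
  - move=> X; rewrite fX; apply: hs => //.
    by apply: test_function_bump; exact: ler0n.
  (* The window [0, X + 1] contains the support of f (. - X). *)
  - move=> X; pose M : R := X.+1%:R.
    have fXE : (fun t => f (t - X%:R)) = refl M F.
      apply/funext => t; rewrite /refl /cut; case: leP => t0.
        by rewrite fF; congr F; rewrite /M -natr1; ring.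
      by rewrite /f cbump_out// negb_and -!leNgt subr_le0 (le_trans (ltW t0)).
    rewrite fXE.
    have h1 := negligible_refl M (lglueE hp hw X.+1 iT LF).
    have h2 := T_refl_out hp hw bT cT (ler0n _ X.+1) LF.
    apply: aeS (aeI (aeI h1 h2) (ae_neq 0)) => x [[e1 e2] xn0] x0'.
    have kE : k (x - X%:R) = lglue T F (M - x) by rewrite /k /M -natr1; congr (lglue T F _); ring.
    rewrite kE; have [xM|Mx] := leP x M; last first.
      by rewrite e2// /lglue glue_lt0// subr_lt0.
    rewrite e1; first by rewrite subKr.
    by rewrite subr_ge0 xM /= gtrBl lt_neqAle eq_sym xn0.
have efE : ell x0 a f = lker x0 a 1 * ell (- x0) (- a) F by rewrite fF.
apply: (mulIf ne); transitivity (ell x0 a k); first by rewrite -!fourier_twist.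
by rewrite ek eG efE; ring.
Qed.

End LeftSymbol.

(** At z = 0, where the eigenvalue is not available, the bound carries over
    from nearby points by the continuity of mu. *)
Lemma closure_avoids (D : set C) (mu : C -> C) (l : C) (e : R) : 0 < e -> holomorphic_on D mu ->
  (forall z, D z -> z != 0 -> e <= cmod (mu z - l)) ->
  (forall eta : R, D 0 -> 0 < eta -> exists z, [/\ D z, z != 0 & cmod z < eta]) ->
  ~ closure (mu @` D : set C^o) l.
Proof.
move=> e0 hol far acc cl.
have e4 : 0 < e / 4 by rewrite divr_gt0.
have nb : nbhs (l : C^o) [set y : C^o | cmod (l - y) < e / 2].
  apply/nbhs_ballP; exists (e / 2)%:C; first by rewrite /= ltcR divr_gt0.
  by move=> y; rewrite -ball_normE /ball_ /= ltcR.
have [_ [[z Dz <-] /= lt]] := cl _ nb.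
rewrite cmodBC in lt.
have [z0|zn0] := eqVneq z 0; last by have := far z Dz zn0; lra.
subst z; have [eta eta0 h] := derivable_continuous (hol _ Dz) e4.
have [z' [Dz' zn0 ze]] := acc eta Dz eta0.
have := far z' Dz' zn0; have := h z'; rewrite subr0 => /(_ ze).
have := cmodD (mu z' - mu 0) (mu 0 - l).
have -> : mu z' - mu 0 + (mu 0 - l) = mu z' - l by ring.
rewrite (cmodBC (mu z') (mu 0)); lra.
Qed.

Lemma im_neq0 (z : C) : z != 0 -> (complex.Re z != 0) || (complex.Im z != 0).
Proof.
by apply: contraNT; rewrite negb_or !negbK => /andP[/eqP h1 /eqP h2]; apply/eqP/complex_eq.
Qed.

Theorem right_symbol_spectrum T mu : bounded_operator p w T ->
  commutes_with p w right_shift T -> is_symbol T (calO p w) mu ->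
  closure (mu @` calO p w : set C^o) `<=` spectrum p w T.
Proof.
move=> bT cT sT l cl [U iU]; have iT : invariant p w right_shift T by split.
have [bU _ _] := iU; have [Mu Mu0 UM] := bounded_energy hp hw bU.
have Mi : 0 < Mu^-1 by rewrite invr_gt0.
have [hol _ _] := sT.
apply: (closure_avoids Mi hol _ _ cl).
- move=> [x0 a] Dz /im_neq0 zn0.
  have [m hm] := right_character hp hw iT Dz zn0.
  by rewrite (right_symbol_character iT sT Dz hm); case: hm => _ /(_ l U Mu Mu0 UM iU).
- move=> eta D0 eta0; exists (0 +i* (- (eta / 2))); split.
  + rewrite /calO /= in D0 *; apply: lt_trans D0; rewrite oppr_lt0 divr_gt0//.
  + by rewrite eq_complex /= eqxx /= oppr_eq0 gt_eqF// divr_gt0.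
  + apply: (le_lt_trans (cmod_le_ReIm _)); rewrite /= normr0 add0r normrN gtr0_norm; lra.
Qed.

Theorem left_symbol_spectrum T mu : bounded_operator p w T ->
  commutes_with p w left_shift T -> is_symbol T (calV p w) mu ->
  closure (mu @` calV p w : set C^o) `<=` spectrum p w T.
Proof.
move=> bT cT sT l cl [U iU]; have iT : invariant p w left_shift T by split.
have [bU _ _] := iU; have [Mu Mu0 UM] := bounded_energy hp hw bU.
have Mi : 0 < Mu^-1 by rewrite invr_gt0.
have [hol _ _] := sT.
apply: (closure_avoids Mi hol _ _ cl).
- move=> [x0 a] Dz /im_neq0 zn0.
  have aa : - a < alpha1 p w by rewrite ltrNl.
  have zn0' : (- x0 != 0) || (- a != 0) by rewrite !oppr_eq0.
  have [m hm] := left_character hp hw iT aa zn0'.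
  by rewrite (left_symbol_character iT sT Dz hm); case: hm => _ /(_ l U Mu Mu0 UM iU).
- move=> eta D0 eta0; exists (0 +i* (eta / 2)); split.
  + rewrite /calV /= in D0 *; apply: lt_trans D0 _; rewrite divr_gt0//.
  + by rewrite eq_complex /= eqxx /= gt_eqF// divr_gt0.
  + apply: (le_lt_trans (cmod_le_ReIm _)); rewrite /= normr0 add0r gtr0_norm; lra.
Qed.

End SymbolValues.

Theorem theorem4 (R : realType) (p : R) (w : R -> R) (hp : 1 <= p)
    (hw : weight w) :
  [/\ (forall t : R, 0 < t ->
         spectrum p w (right_shift t) =
         [set z : R[i] | cmod z <= expR (alpha0 p w * t)]),
      (forall t : R, 0 < t ->
         spectrum p w (left_shift t) =
         [set z : R[i] | cmod z <= expR (alpha1 p w * t)]),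
      (forall (T : (R -> R[i]) -> (R -> R[i])) (mu : R[i] -> R[i]),
         bounded_operator p w T ->
         commutes_with p w right_shift T ->
         is_symbol T (calO p w) mu ->
         closure (mu @` calO p w : set R[i]^o) `<=` spectrum p w T) &
      (forall (T : (R -> R[i]) -> (R -> R[i])) (mu : R[i] -> R[i]),
         bounded_operator p w T ->
         commutes_with p w left_shift T ->
         is_symbol T (calV p w) mu ->
         closure (mu @` calV p w : set R[i]^o) `<=` spectrum p w T)].
Proof.
split.
- by move=> t; exact: right_spectrum.
- by move=> t; exact: left_spectrum.
- by move=> T mu; exact: right_symbol_spectrum.
- by move=> T mu; exact: left_symbol_spectrum.
Qed.
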